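(* Let $d\ge 1$, let $\{b_{ij}\}_{1\le i,j\le d}$ be a symmetric array of nonnegative reals, and let $X$ be the $d\times d$ symmetric random matrix with entries $X_{ij}=b_{ij}g_{ij}$ described in the context. Let $B$ be the $d\times d$ symmetric matrix with entries $B_{ij}=b_{ij}^2$, and let $B^-$ be its negative part. Let $Y=(Y_1,\dots,Y_d)\sim N(0,B^-)$ be a centered Gaussian vector with covariance matrix $B^-$, and let $g_1,\ldots,g_d$ be i.i.d. standard Gaussian random variables. Then for every $\gamma>0$ $$ \mathbf{E}\|X\|\le\sqrt{2+\gamma+\gamma^{-1}}\;\mathbf{E}\Bigg[\max_i\sqrt{\sum_j b_{ij}^2g_j^2}\Bigg]+\sqrt{\gamma}\;\mathbf{E}\Big[\max_i Y_i\Big]+2\max_{ij}b_{ij}. $$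
   Context: $\{b_{ij}\}_{1\le i,j\le d}$ are nonnegative reals with $b_{ij}=b_{ji}$; $\{g_{ij}: i\ge j\}$ are independent standard Gaussian random variables, and $g_{ij}:=g_{ji}$ for $i<j$. $X$ is the $d\times d$ symmetric random matrix with entries $X_{ij}=b_{ij}g_{ij}$. $\|\cdot\|$ is the spectral norm (operator norm on Euclidean space). If $B=\sum_i\lambda_i u_iu_i^*$ is the spectral decomposition of $B$ (orthonormal eigenvectors $u_i$, eigenvalues $\lambda_i$), then $B^-:=-\sum_i(\lambda_i\wedge 0)u_iu_i^*$, which is positive semidefinite. All indices range over $\{1,\dots,d\}$. *)

(* Defs.v *)
From HB Require Import structures.
From mathcomp Require Export all_boot all_order all_algebra.
From mathcomp Require Export all_classical all_reals all_analysis.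
Export numFieldNormedType.Exports.

Set Implicit Arguments.
Unset Strict Implicit.
Unset Printing Implicit Defensive.

Import Order.TTheory GRing.Theory Num.Theory.

Local Open Scope classical_set_scope.
Local Open Scope ring_scope.

(* The index set is nonempty and [F] may be negative, so the neutral element of
   the iterated maximum is a value of [F] rather than 0. *)
Definition maxf (R : realType) (n : nat) (F : 'I_n.+1 -> R) : R :=
  \big[Num.max/F ord0]_(i < n.+1) F i.

(* The library norm on matrices is the entrywise sup norm. *)
Definition eucl_norm (R : realType) (n : nat) (x : 'cV[R]_n) : R :=
  Num.sqrt (\sum_i x i ord0 ^+ 2).

Definition spectral_norm (R : realType) (n : nat) (A : 'M[R]_n) : R :=
  sup [set eucl_norm (A *m x) | x in [set x : 'cV[R]_n | eucl_norm x <= 1]].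

Definition spectral_decomposition (R : realType) (n : nat) (B : 'M[R]_n)
    (lam : 'I_n -> R) (u : 'I_n -> 'cV[R]_n) : Prop :=
  (forall i j, (u i)^T *m u j = (i == j)%:R%:M) /\
  B = \sum_i lam i *: (u i *m (u i)^T).

Definition is_negative_part (R : realType) (n : nat) (B M : 'M[R]_n) : Prop :=
  exists (lam : 'I_n -> R) (u : 'I_n -> 'cV[R]_n),
    spectral_decomposition B lam u /\
    M = - \sum_i Num.min (lam i) 0 *: (u i *m (u i)^T).

Section Probability.
Context (d : measure_display) (T : measurableType d) (R : realType)
  (P : probability T R).

Definition standard_gaussian (X : {RV P >-> R}) : Prop :=
  forall A : set R, measurable A ->
    distribution P X A = normal_prob (0 : R) 1 A.

(* [normal_prob m 0] is a junk value in the library (the uniform law on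
   [0, 1]), so the degenerate Gaussian laws are given as Dirac masses. *)
Definition gaussian (X : T -> R) : Prop :=
  exists m s : R, 0 <= s /\
    forall A : set R, measurable A ->
      pushforward P X A = (if s == 0 then \d_m A else normal_prob m s A).

Definition gaussian_vector (n : nat) (Y : 'I_n -> {RV P >-> R}) : Prop :=
  forall t : 'I_n -> R, gaussian (fun w => \sum_i t i * Y i w).

(* Y ~ N(0, S), where S may be singular. *)
Definition centered_gaussian_vector (n : nat) (S : 'M[R]_n)
    (Y : 'I_n -> {RV P >-> R}) : Prop :=
  [/\ gaussian_vector Y,
      forall i, ('E_P[Y i] = 0)%E
    & forall i j, covariance P (Y i) (Y j) = (S i j)%:E].

(* Mutual independence of the subfamily of [X] indexed by [D]. *)
Definition independent_RVs (I : finType) (D : {set I})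
    (X : I -> {RV P >-> R}) : Prop :=
  forall J : {set I}, J \subset D ->
  forall A : I -> set R, (forall i, measurable (A i)) ->
    P (\bigcap_(i in [set` J]) (X i @^-1` A i)) =
    (\prod_(i in J) P (X i @^-1` A i))%E.

Definition iid_standard_gaussian (n : nat) (g : 'I_n -> {RV P >-> R}) : Prop :=
  (forall i, standard_gaussian (g i)) /\
  independent_RVs [set: 'I_n]%SET g.

Definition symmetric_gaussian_array (n : nat)
    (g : 'I_n -> 'I_n -> {RV P >-> R}) : Prop :=
  [/\ forall i j w, g i j w = g j i w,
      forall i j, standard_gaussian (g i j)
    & independent_RVs [set p : 'I_n * 'I_n | (p.2 <= p.1)%N]%SET
        (fun p => g p.1 p.2)].

Definition random_matrix (n : nat) (b : 'M[R]_n)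
    (g : 'I_n -> 'I_n -> {RV P >-> R}) (w : T) : 'M[R]_n :=
  \matrix_(i, j) (b i j * g i j w).

End Probability.

(* Main.v *)
(* Bounding the quadratic form x |-> <x, X x> over a finite net of unit vectors
   reduces the claim to a comparison of maxima of two finite Gaussian families.
   For unit vectors v, w and f(v)_j = sqrt (sum_i b_ij^2 v_i^2), the increments
   of v |-> <v, X v> satisfy
     E |<v, X v> - <w, X w>|^2 <= 2 sum_ij b_ij^2 (v_i v_j - w_i w_j)^2
       <= (2 + gamma + 1/gamma) sum_j (v_j f(v)_j - w_j f(w)_j)^2
          - gamma <v^2 - w^2, B (v^2 - w^2)>,
   and - B <= B^-, so they are dominated by those of
     sqrt (2 + gamma + 1/gamma) sum_j v_j f(v)_j g_j + sqrt gamma sum_i v_i^2 Y_i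
   with independent g and Y.  Both signs of the form are treated together by
   adding +- sqrt 2 (max b) xi with an independent standard Gaussian xi, at the
   price of sqrt 2 (max b) E |xi| <= 2 max b.  The Sudakov-Fernique inequality
   then bounds the expected maximum.  It is proved by exchanging small portions
   of one family for the other inside the log-sum-exp function (Lindeberg),
   where Gaussian laws are identified through their cosine transforms. *)
From HB Require Import structures.
Require Import Defs.
From mathcomp Require Import ring lra measurable_realfun.

Set Implicit Arguments.
Unset Strict Implicit.
Unset Printing Implicit Defensive.
Import Order.TTheory GRing.Theory Num.Theory.
Local Open Scope classical_set_scope.
Local Open Scope ring_scope.

(** * Integration *)

(** The matrix, [Y] and [g] live on three unrelated probability spaces, and their Gaussianity is
    given in different forms: independence of events on one hand, laws of linear combinations with
    covariances on the other. Everything is first brought to one format, [gaussian_cf], in which an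
    independent copy is just a further product factor. The comparison needs only variances of
    increments because the second-order Taylor term of log-sum-exp is a Gibbs average of squared
    differences, while the first-order term vanishes by centering. Exchanging a portion h costs
    order h^(3/2), so m^2 exchanges of size 1/m^2 cost order 1/m in total. The term with xi comes
    from (s x - t y)^2 = (x - y)^2 + x y (s - t)^2 for signs s, t: opposite signs cost at most 2
    (max b)^2 (s - t)^2, which is exactly the increment variance of sqrt 2 (max b) s xi. The net
    error is relative to the norm itself. It becomes a factor 1 + 1/k, so no prior bound on E |X| is
    needed and finiteness of E |X| is a by-product. *)

Section Toolbox.
Context d (T : measurableType d) (R : realType).

Lemma measurable_EFin (D : set T) (f : T -> R) :
  measurable_fun D f -> measurable_fun D (fun x => (f x)%:E).
Proof. by move=> mf; apply/measurable_EFinP. Qed.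

Lemma integrable_le (mu : {measure set T -> \bar R}) (f g : T -> R) :
  measurable_fun setT f -> (forall x, `|f x| <= g x) ->
  mu.-integrable setT (EFin \o g) -> mu.-integrable setT (EFin \o f).
Proof.
move=> mf fg; apply: le_integrable => //; first exact/measurable_EFinP.
by move=> x _ /=; rewrite lee_fin (le_trans (fg x))// ler_norm.
Qed.

Lemma integrable_bounded (P : probability T R) (f : T -> R) (M : R) :
  measurable_fun setT f -> (forall x, `|f x| <= M) ->
  P.-integrable setT (EFin \o f).
Proof.
move=> mf fM; apply: (@integrable_le _ _ (cst M)) => //.
exact: finite_measure_integrable_cst.
Qed.

Lemma integrable_addR (mu : {measure set T -> \bar R}) (f g : T -> R) :
  mu.-integrable setT (EFin \o f) -> mu.-integrable setT (EFin \o g) ->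
  mu.-integrable setT (EFin \o (fun x => f x + g x)).
Proof. by move=> intf intg; have := integrableD measurableT intf intg. Qed.

Lemma integrable_subR (mu : {measure set T -> \bar R}) (f g : T -> R) :
  mu.-integrable setT (EFin \o f) -> mu.-integrable setT (EFin \o g) ->
  mu.-integrable setT (EFin \o (fun x => f x - g x)).
Proof. by move=> intf intg; have := integrableB measurableT intf intg. Qed.

Lemma integrable_scaleR (mu : {measure set T -> \bar R}) (a : R) (f : T -> R) :
  mu.-integrable setT (EFin \o f) ->
  mu.-integrable setT (EFin \o (fun x => a * f x)).
Proof. by move=> intf; have := integrableZl measurableT a intf. Qed.

Lemma integrable_sumR (mu : {measure set T -> \bar R}) (I : Type) (r : seq I)
    (f : I -> T -> R) :
  (forall i, mu.-integrable setT (EFin \o f i)) ->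
  mu.-integrable setT (EFin \o (fun x => \sum_(i <- r) f i x)).
Proof.
move=> intf; elim: r => [|i r IH].
  under [X in _.-integrable _ (_ \o X)]eq_fun do rewrite big_nil.
  exact: integrable0.
under [X in _.-integrable _ (_ \o X)]eq_fun do rewrite big_cons.
exact: integrable_addR.
Qed.

Lemma Rintegral_prob_cst (P : probability T R) (r : R) : \int[P]_x r = r.
Proof.
rewrite Rintegral_cst//.
rewrite -[RHS]mulr1; congr (_ * _).
exact: (congr1 fine (probability_setT P)).
Qed.

Lemma normr_Rintegral_le (P : probability T R) (f : T -> R) (M : R) :
  measurable_fun setT f -> (forall x, `|f x| <= M) -> `|\int[P]_x f x| <= M.
Proof.
move=> mf fM; have intf := integrable_bounded P mf fM.
apply: (le_trans (le_normr_Rintegral _ _)) => //.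
rewrite -[leRHS](Rintegral_prob_cst P); apply: le_Rintegral => //.
- exact: (integrable_abse intf).
- exact: finite_measure_integrable_cst.
Qed.

Lemma Rintegral_sum (mu : {measure set T -> \bar R}) (I : Type) (r : seq I)
    (f : I -> T -> R) :
  (forall i, mu.-integrable setT (EFin \o f i)) ->
  \int[mu]_x (\sum_(i <- r) f i x) = \sum_(i <- r) \int[mu]_x f i x.
Proof.
move=> intf; elim: r => [|i r IH].
  under eq_Rintegral do rewrite big_nil.
  by rewrite /Rintegral integral0 big_nil.
under eq_Rintegral do rewrite big_cons.
by rewrite RintegralD// ?big_cons ?IH//; exact: integrable_sumR.
Qed.

Lemma Rdominated_cvg (mu : {measure set T -> \bar R}) (f_ : nat -> T -> R)
    (f g : T -> R) :
  (forall n, measurable_fun setT (f_ n)) ->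
  (forall x, f_ ^~ x @ \oo --> f x) ->
  mu.-integrable setT (EFin \o g) -> (forall n x, `|f_ n x| <= g x) ->
  mu.-integrable setT (EFin \o f) /\
  \int[mu]_x f_ n x @[n --> \oo] --> \int[mu]_x f x.
Proof.
move=> mf_ ff ig fg.
have mf : measurable_fun setT f by exact: (measurable_fun_cvg mf_).
have [|||||h1 _ h3] := @dominated_convergence _ _ _ mu _ measurableT
  (fun n x => (f_ n x)%:E) (EFin \o f) (EFin \o g).
- by move=> n; exact: measurable_EFin.
- exact: measurable_EFin.
- by apply: aeW => x _; apply: cvg_EFin; [exact: nearW|exact: ff].
- exact: ig.
- by apply: aeW => x n _ /=; rewrite lee_fin.
split=> //; apply: fine_cvg; rewrite fineK//.
exact: integrable_fin_num.
Qed.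

End Toolbox.

(** * The normal law *)

Section NormalDensity.
Context (R : realType) (m s : R).
Notation mu := lebesgue_measure.
Notation N := (normal_prob m s).

Let mpdf : measurable_fun setT (fun x : R => (normal_pdf m s x)%:E).
Proof. by apply/measurable_EFinP; exact: measurable_normal_pdf. Qed.

(** Change of variables holds with the Radon-Nikodym derivative of [N]; this derivative agrees
    almost everywhere with [normal_pdf], since both integrate to [N] over every measurable set. *)
Lemma ge0_integral_normal_prob (f : R -> \bar R) :
  measurable_fun setT f -> (forall x, 0 <= f x)%E ->
  (\int[N]_x f x = \int[mu]_x (f x * (normal_pdf m s x)%:E))%E.
Proof.
move=> mf f0.
have dom := normal_prob_dominates m s.
rewrite -(Radon_Nikodym_SigmaFinite.change_of_variables dom f0)//.
have ih := Radon_Nikodym_SigmaFinite.f_integrable dom.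
apply: ae_eq_integral => //.
- by apply: emeasurable_funM => //; exact: (measurable_int mu).
- by apply: emeasurable_funM => //; exact: mpdf.
- apply: ae_eqe_mul2l; apply: integral_ae_eq; [by []|exact: ih| |].
    exact: mpdf.
  by move=> E _ mE; rewrite -Radon_Nikodym_SigmaFinite.f_integral.
Qed.

Lemma integrable_normal_prob (f : R -> R) :
  measurable_fun setT f ->
  N.-integrable setT (EFin \o f) <->
  mu.-integrable setT (fun x => (f x * normal_pdf m s x)%:E).
Proof.
move=> mf.
have mfp : measurable_fun setT (fun x => f x * normal_pdf m s x).
  by apply: measurable_funM => //; exact: measurable_normal_pdf.
suff E : (\int[N]_x `|(f x)%:E| = \int[mu]_x `|(f x * normal_pdf m s x)%:E|)%E.
  split=> /integrableP[_ h]; apply/integrableP; split.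
  - exact: measurable_EFin.
  - by rewrite -E.
  - exact: measurable_EFin.
  - by rewrite /= E.
rewrite ge0_integral_normal_prob//; last first.
  by apply: measurableT_comp => //; exact: measurable_EFin.
apply: eq_integral => x _ /=.
by rewrite normrM EFinM (ger0_norm (normal_pdf_ge0 _ _ _)).
Qed.

Lemma Rintegral_normal_prob (f : R -> R) :
  measurable_fun setT f -> N.-integrable setT (EFin \o f) ->
  \int[N]_x f x = \int[mu]_x (f x * normal_pdf m s x).
Proof.
move=> mf intf; congr fine.
rewrite [in LHS]integralE [in RHS]integralE.
rewrite !ge0_integral_normal_prob//; first last.
- by apply: measurable_funepos; exact: measurable_EFin.
- by apply: measurable_funeneg; exact: measurable_EFin.
congr (_ - _)%E; apply: eq_integral => x _.
  rewrite !funeposE/= -!EFin_max -EFinM; congr EFin.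
  by rewrite maxr_pMl ?normal_pdf_ge0// mul0r.
rewrite !funenegE/= -!EFin_max -EFinM; congr EFin.
by rewrite maxr_pMl ?normal_pdf_ge0// mul0r mulNr.
Qed.

End NormalDensity.

Section NormalIntegrability.
Context (R : realType) (m s : R).
Hypothesis s0 : s != 0.
Notation mu := lebesgue_measure.
Notation N := (normal_prob m s).

Lemma is_derive_normal_pdf (x : R) :
  is_derive x 1 (normal_pdf m s) (- ((x - m) / s ^+ 2) * normal_pdf m s x).
Proof.
rewrite normal_pdfE// /normal_fun.
apply: is_derive_eq; rewrite /GRing.scale/= /normal_fun; field.
by rewrite s0.
Qed.

(** With z = (x - m)^2 / (4 s^2) the Gaussian factor is exp(-z) exp(-z). One exponential absorbs the
    quartic growth, the other is a normal density of deviation sqrt 2 s up to the ratio of peaks.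
    Degree four covers every moment used later. *)
Lemma integrable_poly_normal (f : R -> R) (C : R) : measurable_fun setT f ->
  (forall x, `|f x| <= C * (1 + (x - m) ^+ 4)) ->
  N.-integrable setT (EFin \o f).
Proof.
move=> mf fC; apply/integrable_normal_prob => //.
have s20 : Num.sqrt 2 * s != 0 by rewrite mulf_neq0// sqrtr_eq0 -ltNge.
have C0 : 0 <= C.
  have := fC m; rewrite subrr expr0n/= addr0 mulr1; exact: le_trans.
pose K := C * (1 + 32 * s ^+ 4) * (normal_peak s / normal_peak (Num.sqrt 2 * s)).
have bnd (x : R) : `|f x * normal_pdf m s x| <= K * normal_pdf m (Num.sqrt 2 * s) x.
  rewrite normrM (ger0_norm (normal_pdf_ge0 _ _ _)).
  rewrite !normal_pdfE//.
  have p0 := normal_peak_gt0 s20.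
  have q0 := normal_peak_gt0 s0.
  have -> : K * (normal_peak (Num.sqrt 2 * s) * normal_fun m (Num.sqrt 2 * s) x) =
    normal_peak s * (C * (1 + 32 * s ^+ 4) * normal_fun m (Num.sqrt 2 * s) x).
    by rewrite /K; field; rewrite gt_eqF.
  rewrite mulrCA ler_wpM2l ?(ltW q0)//.
  set z := (x - m) ^+ 2 / (4 * s ^+ 2).
  have z0 : 0 <= z by apply: divr_ge0; [exact: sqr_ge0|apply: mulr_ge0; [exact: ler0n|exact: sqr_ge0]].
  have -> : normal_fun m s x = expR (- z) * expR (- z).
    rewrite -expRD /normal_fun; congr expR; rewrite /z; field.
    by rewrite s0.
  have -> : normal_fun m (Num.sqrt 2 * s) x = expR (- z).
    rewrite /normal_fun; congr expR; rewrite /z exprMn sqr_sqrtr//; field.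
    by rewrite s0.
  rewrite mulrA ler_wpM2r ?expR_ge0//.
  (* Here (x - m)^4 = 16 s^4 z^2 and exp z >= 1 + z^2 / 2, whence the constant 32 s^4. *)
  have h1 : 1 + (x - m) ^+ 4 <= (1 + 32 * s ^+ 4) * expR z.
    have -> : (x - m) ^+ 4 = 16 * s ^+ 4 * z ^+ 2.
      by rewrite /z; field; rewrite s0.
    have := expR_ge1Dxn 1 z0; rewrite (_ : 2`!%:R = 2)// => h.
    have s4 : 0 <= s ^+ 4 by rewrite (exprM s 2 2) sqr_ge0.
    apply: (@le_trans _ _ ((1 + 32 * s ^+ 4) * (1 + z ^+ 2 / 2))).
      by have := sqr_ge0 z; nra.
    by rewrite ler_wpM2l// addr_ge0// mulr_ge0.
  rewrite expRN ler_pdivrMr ?expR_gt0// -mulrA.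
  by apply: (le_trans (fC x)); rewrite ler_wpM2l.
apply: (@integrable_le _ _ _ mu (fun x => f x * normal_pdf m s x) (fun x => K * normal_pdf m (Num.sqrt 2 * s) x)).
- by apply: measurable_funM => //; exact: measurable_normal_pdf.
- exact: bnd.
- have -> : EFin \o (fun x => K * normal_pdf m (Num.sqrt 2 * s) x) =
     (fun x => K%:E * (normal_pdf m (Num.sqrt 2 * s) x)%:E)%E by [].
  by apply: integrableZl => //; exact: integrable_normal_pdf.
Qed.

End NormalIntegrability.

Lemma cvgr0_harmonic_le (R : realType) (u : nat -> R) (C : R) :
  (forall n, `|u n| <= C * n.+1%:R^-1) -> u n @[n --> \oo] --> 0.
Proof.
move=> uC; apply: norm_cvg0.
have h : C * n.+1%:R^-1 @[n --> \oo] --> (0 : R).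
  rewrite -(mulr0 C); apply: cvgM; [exact: cvg_cst|exact: cvg_harmonic].
apply: (squeeze_cvgr _ (cvg_cst (0 : R)) h).
by apply: nearW => n; rewrite uC normr_ge0.
Qed.

Section NormalIBP.
Context (R : realType) (m s : R).
Hypothesis s0 : s != 0.
Notation mu := (@lebesgue_measure R).
Notation N := (normal_prob m s).
Notation phi := (normal_pdf m s).

(** The fundamental theorem of calculus on [m - (n+1), m + (n+1)] leaves two boundary values of [F],
    each at most C / (n+1) by the decay hypothesis; dominated convergence handles the truncated
    integrals. *)
Lemma Rintegral_derivative_eq0 (F f : R -> R) (C : R) :
  (forall x : R, is_derive x (1 : R) F (f x)) -> continuous f ->
  mu.-integrable setT (EFin \o f) ->
  (forall x, `|F x| * (1 + `|x - m|) <= C) ->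
  \int[mu]_x f x = 0.
Proof.
move=> dF cf intf FC.
have cF : continuous F.
  by move=> x; apply/differentiable_continuous/derivable1_diffP; exact: ex_derive.
have mf : measurable_fun setT f by exact: continuous_measurable_fun.
pose I n : set R := `[m - n.+1%:R, m + n.+1%:R]%classic.
pose f_ n := f \_ (I n).
have [||||_ cv] := @Rdominated_cvg _ _ _ mu f_ f (fun x => `|f x|).
- move=> n; apply/(measurable_restrictT _ _).1; first exact: measurable_itv.
  exact: measurable_funTS.
- move=> x; apply: cvg_near_cst.
  near=> n; rewrite /f_ patchE ifT// inE /I/= in_itv/=.
  rewrite -ler_distl; apply: (@le_trans _ _ n%:R); last by rewrite ler_nat.
  by near: n; exact: nbhs_infty_ger.
- exact: (integrable_abse intf).
- move=> n x; rewrite /f_ patchE; case: ifPn => //=.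
  by rewrite normr0.
have E n : \int[mu]_x f_ n x = F (m + n.+1%:R) - F (m - n.+1%:R).
  rewrite /f_ -Rintegral_mkcond /Rintegral.
  rewrite (@continuous_FTC2 _ f F)//.
  - by have : (0 : R) < n.+1%:R by []; lra.
  - exact: continuous_subspaceT.
  - split.
    + by move=> x _; exact: ex_derive.
    + by apply: cvg_at_right_filter; exact: cF.
    + by apply: cvg_at_left_filter; exact: cF.
  - by move=> x _; rewrite derive1E; exact: derive_val.
apply: (cvg_unique _ cv) => //.
apply: (@cvgr0_harmonic_le _ _ (2 * C)) => n; rewrite E.
apply: (le_trans (ler_normB _ _)).
have h (y : R) : `|y - m| = n.+1%:R -> `|F y| <= C * n.+1%:R^-1.
  move=> yn; rewrite ler_pdivlMr//; apply: le_trans (FC y).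
  by rewrite yn ler_wpM2l// lerDr.
have h1 : `|m + n.+1%:R - m| = n.+1%:R by rewrite addrC addKr ger0_norm.
have h2 : `|m - n.+1%:R - m| = n.+1%:R.
  by rewrite addrAC subrr add0r normrN ger0_norm.
by rewrite -mulrA mulr_natl mulr2n lerD ?h.
Unshelve. all: by end_near. Qed.

(** Stein's identity: the derivative of s^2 f phi is (s^2 f' - (x - m) f) phi, and a derivative with
    decaying primitive integrates to 0. *)
Lemma Rintegral_normal_by_parts (f df : R -> R) (A : R) :
  (forall x : R, is_derive x (1 : R) f (df x)) -> continuous df ->
  (forall x, `|f x| <= A * (1 + `|x - m|)) -> (forall x, `|df x| <= A) ->
  \int[N]_x ((x - m) * f x) = s ^+ 2 * \int[N]_x df x.
Proof.
move=> dF cdf fA dfA.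
have cf : continuous f.
  by move=> x; apply/differentiable_continuous/derivable1_diffP; exact: ex_derive.
have A0 : 0 <= A by exact: le_trans (dfA 0).
have mf : measurable_fun setT f by exact: continuous_measurable_fun.
have mdf : measurable_fun setT df by exact: continuous_measurable_fun.
have mx : measurable_fun setT (fun x : R => x - m) by exact: measurable_funB.
have i1 : N.-integrable setT (EFin \o (fun x => (x - m) * f x)).
  apply: (@integrable_poly_normal _ _ _ s0 _ (4 * A)); first exact: measurable_funM.
  move=> x; rewrite normrM; apply: (@le_trans _ _ (`|x - m| * (A * (1 + `|x - m|)))).
    by rewrite ler_wpM2l.
  have -> : (x - m) ^+ 4 = `|x - m| ^+ 4.
    by rewrite -normrX ger0_norm// (exprM _ 2 2) sqr_ge0.
  have := normr_ge0 (x - m); set u := `|x - m| => u0.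
  have -> : u * (A * (1 + u)) = A * (u * (1 + u)) by ring.
  have -> : 4 * A * (1 + u ^+ 4) = A * (4 * (1 + u ^+ 4)) by ring.
  rewrite ler_wpM2l//.
  have := sqr_ge0 (u - 1); have := sqr_ge0 (u ^+ 2 - 1); rewrite !expr2 => *; nra.
have i2 : N.-integrable setT (EFin \o df) by exact: (@integrable_bounded _ _ _ N df A).
pose g x := (s ^+ 2 * df x - (x - m) * f x).
have ig : N.-integrable setT (EFin \o g).
  by apply: integrable_subR => //; exact: integrable_scaleR.
have mg : measurable_fun setT g.
  by apply: measurable_funB; apply: measurable_funM.
suff : \int[N]_x g x = 0.
  rewrite /g RintegralB//; last first.
    exact: integrable_scaleR.
  by rewrite RintegralZl// => /eqP; rewrite subr_eq0 => /eqP.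
rewrite Rintegral_normal_prob//.
pose G x := s ^+ 2 * (f x * phi x).
have dG (x : R) : is_derive x (1 : R) G (g x * phi x).
  have := is_derive_normal_pdf m s0 x => dphi.
  rewrite /G; apply: is_derive_eq; rewrite /GRing.scale/= /g; field.
  by rewrite s0.
have cphi : continuous phi by exact: continuous_normal_pdf.
apply: (@Rintegral_derivative_eq0 G _
   (s ^+ 2 * A * normal_peak s * (2 + 4 * s ^+ 2))) => //.
- move=> x; apply: cvgM; last exact: cphi.
  apply: (@cvgB _ R^o); first by apply: cvgM; [exact: cvg_cst|exact: cdf].
  apply: cvgM; last exact: cf.
  by apply: (@cvgB _ R^o); [exact: cvg_id|exact: cvg_cst].
- by apply/integrable_normal_prob.
- move=> x; rewrite /G normrM (ger0_norm (sqr_ge0 s)) normrM.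
  rewrite (ger0_norm (normal_pdf_ge0 _ _ _)).
  set u := `|x - m|; have u0 : 0 <= u by exact: normr_ge0.
  suff q : `|f x| * (phi x * (1 + u)) <= A * (normal_peak s * (2 + 4 * s ^+ 2)).
    have -> : s ^+ 2 * (`|f x| * phi x) * (1 + u) = s ^+ 2 * (`|f x| * (phi x * (1 + u))) by ring.
    have -> : s ^+ 2 * A * normal_peak s * (2 + 4 * s ^+ 2) =
      s ^+ 2 * (A * (normal_peak s * (2 + 4 * s ^+ 2))) by ring.
    exact: ler_wpM2l (sqr_ge0 s) _ _ q.
  (* It remains to bound (1 + u)^2 exp(-z) with u^2 = 2 s^2 z: (1 + u)^2 <= 2 + 2 u^2 = 2 + 4 s^2 z
     <= (2 + 4 s^2) (1 + z), and 1 + z <= exp z. *)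
  apply: (@le_trans _ _ (A * (1 + u) * (phi x * (1 + u)))).
    by apply: ler_wpM2r; [rewrite mulr_ge0 ?normal_pdf_ge0// addr_ge0|exact: fA].
  rewrite -mulrA; apply: ler_wpM2l => //; rewrite normal_pdfE//.
  rewrite mulrCA -mulrA; apply: ler_wpM2l; first exact: normal_peak_ge0.
  rewrite /normal_fun.
  set z := (x - m) ^+ 2 / (s ^+ 2 *+ 2).
  have -> : - (x - m) ^+ 2 / (s ^+ 2 *+ 2) = - z by rewrite mulNr.
  rewrite expRN mulrC ler_pdivrMr ?expR_gt0//.
  have zE : u ^+ 2 = 2 * s ^+ 2 * z.
    by rewrite /u -normrX ger0_norm ?sqr_ge0// /z; field; rewrite s0.
  have z0 : 0 <= z.
    by rewrite /z divr_ge0 ?sqr_ge0// mulrn_wge0// sqr_ge0.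
  have p0 : 0 <= 2 + 4 * s ^+ 2 by rewrite addr_ge0// mulr_ge0// sqr_ge0.
  apply: (@le_trans _ _ ((2 + 4 * s ^+ 2) * (1 + z))); last first.
    by apply: ler_wpM2l => //; exact: expR_ge1Dx.
  have a1 := sqr_ge0 (u - 1); have a2 := sqr_ge0 s.
  have a3 := mulr_ge0 a2 z0.
  have -> : (1 + u) * (1 + u) = 2 + 2 * u ^+ 2 - (u - 1) ^+ 2 by ring.
  by rewrite zE; nra.
Qed.

End NormalIBP.

Lemma normr_cos_le1 (R : realType) (x : R) : `|cos x| <= 1.
Proof. by rewrite ler_norml cos_geN1 cos_le1. Qed.

Lemma normr_sin_le1 (R : realType) (x : R) : `|sin x| <= 1.
Proof. by rewrite ler_norml sin_geN1 sin_le1. Qed.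

Lemma measurable_cos_comp d (T : measurableType d) (R : realType) (f : T -> R) :
  measurable_fun setT f -> measurable_fun setT (fun x => cos (f x)).
Proof.
move=> mf; apply: (measurableT_comp _ mf).
exact: continuous_measurable_fun (@continuous_cos R).
Qed.

Section NormalMoments.
Context (R : realType) (m s : R).
Hypothesis s0 : s != 0.
Notation N := (normal_prob m s).

Lemma measurable_subr_cst : measurable_fun setT (fun x : R => x - m).
Proof. exact: measurable_funB. Qed.
Local Hint Resolve measurable_subr_cst : core.

Lemma integrable_normal_sub : N.-integrable setT (EFin \o (fun x => x - m)).
Proof.
apply: (@integrable_poly_normal _ _ _ s0 _ 1) => // x; rewrite mul1r.
rewrite -(ger0_norm (_ : 0 <= (x - m) ^+ 4)); last by rewrite (exprM _ 2 2) sqr_ge0.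
rewrite normrX; set u := `|x - m|; have u0 : 0 <= u by exact: normr_ge0.
have a := sqr_ge0 (u - 1); have b := sqr_ge0 (u ^+ 2 - 1).
have -> : u ^+ 4 = (u ^+ 2) ^+ 2 by ring.
move: a b; rewrite !expr2; nra.
Qed.

Lemma Rintegral_normal_mean : \int[N]_x (x - m) = 0.
Proof.
have -> : \int[N]_x (x - m) = \int[N]_x ((x - m) * cst 1 x).
  by apply: eq_Rintegral => x _; rewrite mulr1.
rewrite (@Rintegral_normal_by_parts _ _ _ s0 _ (cst 0) 1) //.
- by rewrite Rintegral_cst// mul0r mulr0.
- by move=> x; exact: cvg_cst.
- by move=> x; rewrite normr1 mul1r lerDl.
- by move=> x; rewrite normr0.
Qed.

Lemma Rintegral_normal_variance : \int[N]_x ((x - m) ^+ 2) = s ^+ 2.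
Proof.
have d (x : R) : is_derive x (1 : R) (fun x => x - m) (cst 1 x).
  by apply: is_derive_eq; rewrite subr0.
have -> : \int[N]_x ((x - m) ^+ 2) = \int[N]_x ((x - m) * (x - m)) by [].
rewrite (Rintegral_normal_by_parts s0 d (A := 1)).
- by rewrite (Rintegral_prob_cst N 1) mulr1.
- by move=> x; exact: cvg_cst.
- by move=> x; rewrite mul1r lerDr.
- by move=> x; rewrite normr1.
Qed.

(** As a function of t the left side solves psi' = - s^2 t psi: differentiation under the integral
    brings out (x - m) sin(c + t (x - m)), and Stein's identity turns it back into psi. Hence psi
    times exp(s^2 t^2 / 2) is constant. *)
Lemma Rintegral_normal_cos (c t : R) :
  \int[N]_x cos (c + t * (x - m)) = cos c * expR (- (s ^+ 2 * t ^+ 2 / 2)).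
Proof.
pose f (t x : R) : R := cos (c + t * (x - m)).
have mf u : measurable_fun setT (f u).
  by apply: measurable_cos_comp; apply: measurable_funD => //; exact: measurable_funM.
have intf u : N.-integrable setT (EFin \o f u).
  have fu1 (x : R) : `|f u x| <= 1 by exact: normr_cos_le1.
  exact: (@integrable_bounded _ _ _ N (f u) 1 (mf u) fu1).
pose psi (t : R) := \int[N]_x f t x.
have df (u x : R) : is_derive u (1 : R) (f ^~ x) (- (sin (c + u * (x - m)) * (x - m))).
  rewrite /f; apply: is_derive_eq.
  by rewrite /GRing.scale/=; ring.
have d1 (u x : R) : partial1of2 f u x = - (sin (c + u * (x - m)) * (x - m)).
  by rewrite /partial1of2 derive1E; exact: derive_val.
have ibp (u : R) : \int[N]_x ((x - m) * sin (c + u * (x - m))) = s ^+ 2 * (u * psi u).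
  have d (x : R) : is_derive x (1 : R) (fun x => sin (c + u * (x - m))) (u * f u x).
    by apply: is_derive_eq; rewrite /GRing.scale/= /f; ring.
  rewrite (Rintegral_normal_by_parts s0 d (A := 1 + `|u|)).
  - by rewrite RintegralZl.
  - move=> x; apply: cvgM; first exact: cvg_cst.
    apply: (cvg_comp _ cos); last exact: continuous_cos.
    apply: (@cvgD _ R^o); first exact: cvg_cst.
    apply: cvgM; first exact: cvg_cst.
    by apply: (@cvgB _ R^o); [exact: cvg_id|exact: cvg_cst].
  - move=> x; apply: (le_trans (normr_sin_le1 _)).
    have := normr_ge0 u; have := normr_ge0 (x - m); nra.
  - move=> x; rewrite normrM; have := normr_cos_le1 (c + u * (x - m)).
    rewrite -/(f u x); have := normr_ge0 u; have := normr_ge0 (f u x); nra.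
have dpsi (u : R) : is_derive u (1 : R) psi (- (s ^+ 2 * u * psi u)).
  (* Any open interval around [u] would do: the dominating function |y - m| is uniform in the
     parameter. *)
  have Iu : (`]u - 1, u + 1[%classic : set R) u by rewrite /= in_itv/=; lra.
  have iG : N.-integrable setT (EFin \o (fun x => `|x - m|)).
    exact: (integrable_abse integrable_normal_sub).
  have G0 : forall y : R, 0 <= `|y - m| by [].
  have Gub : forall x y : R, (`]u - 1, u + 1[%classic : set R) x -> setT y ->
      `|partial1of2 f x y| <= `|y - m|.
    move=> x y _ _; rewrite d1 normrN normrM.
    by have := normr_sin_le1 (c + x * (y - m)); have := normr_ge0 (y - m); nra.
  have hd : forall x y : R, (`]u - 1, u + 1[%classic : set R) x -> setT y ->
      derivable (f ^~ y) x 1 by move=> x y _ _; exact: ex_derive.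
  have hi : forall x : R, (`]u - 1, u + 1[%classic : set R) x ->
     N.-integrable setT (EFin \o f x) by [].
  have h1 := derivable_under_integral measurableT Iu hi hd G0 iG Gub.
  have h2 := differentiation_under_integral measurableT Iu hi hd G0 iG Gub.
  apply: DeriveDef => //.
  rewrite -derive1E h2.
  transitivity (\int[N]_x (-1 * ((x - m) * sin (c + u * (x - m))))).
    by apply: eq_Rintegral => x _; rewrite d1; ring.
  rewrite RintegralZl//.
    by rewrite ibp; ring.
  apply: (@integrable_le _ _ _ N _ (fun x => `|x - m|)) => //.
    apply: measurable_funM => //; apply: measurableT_comp.
      exact: continuous_measurable_fun (@continuous_sin R).
    by apply: measurable_funD => //; exact: measurable_funM.
  move=> x; rewrite normrM.
  by have := normr_sin_le1 (c + u * (x - m)); have := normr_ge0 (x - m); nra.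
pose h (u : R) := psi u * expR (s ^+ 2 * u ^+ 2 / 2).
have dh (u : R) : is_derive u (1 : R) h 0.
  have := dpsi u => d; rewrite /h; apply: is_derive_eq.
  by rewrite /GRing.scale/=; field.
have := is_derive_0_is_cst t 0 dh; rewrite /h.
have -> : psi 0 = cos c.
  rewrite /psi /f.
  under eq_Rintegral do rewrite mul0r addr0.
  by rewrite (Rintegral_prob_cst N (cos c)).
rewrite expr0n/= mulr0 mul0r expR0 mulr1 => <-.
by rewrite expRN mulfK ?gt_eqF ?expR_gt0.
Qed.

End NormalMoments.

(** * Laws and cosine transforms *)

Section RealFubini.
Context d1 d2 (T1 : measurableType d1) (T2 : measurableType d2) (R : realType).
Variables (m1 : {sigma_finite_measure set T1 -> \bar R})
  (m2 : {sigma_finite_measure set T2 -> \bar R}) (f : T1 * T2 -> R).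
Hypothesis intf : (m1 \x m2)%E.-integrable setT (EFin \o f).
Hypothesis intf1 : forall x, m2.-integrable setT (EFin \o (fun y => f (x, y))).
Hypothesis intf2 : forall y, m1.-integrable setT (EFin \o (fun x => f (x, y))).

Let E1 x : (\int[m2]_y (f (x, y))%:E)%E = (\int[m2]_y f (x, y))%:E.
Proof. by rewrite /Rintegral fineK//; exact: (integrable_fin_num measurableT (intf1 x)). Qed.

Let E2 y : (\int[m1]_x (f (x, y))%:E)%E = (\int[m1]_x f (x, y))%:E.
Proof. by rewrite /Rintegral fineK//; exact: (integrable_fin_num measurableT (intf2 y)). Qed.

Lemma integrable_Rintegral1 :
  m1.-integrable setT (EFin \o (fun x => \int[m2]_y f (x, y))).
Proof.
have := integrable_fubini_F intf; rewrite /fubini_F.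
by apply: eq_integrable => // x _ /=; rewrite E1.
Qed.

Lemma measurable_Rintegral1 : measurable_fun setT (fun x => \int[m2]_y f (x, y)).
Proof. by apply/measurable_EFinP; exact: (measurable_int m1 integrable_Rintegral1). Qed.

Lemma Rintegral_prod1 :
  \int[(m1 \x m2)%E]_z f z = \int[m1]_x \int[m2]_y f (x, y).
Proof.
rewrite /Rintegral -(integral12_prod_meas1 intf) /fubini_F.
by congr fine; apply: eq_integral => x _ /=; rewrite E1.
Qed.

Lemma Rintegral_prod2 :
  \int[(m1 \x m2)%E]_z f z = \int[m2]_y \int[m1]_x f (x, y).
Proof.
rewrite /Rintegral -(integral21_prod_meas1 intf) /fubini_G.
by congr fine; apply: eq_integral => x _ /=; rewrite E2.
Qed.

Lemma RFubini :
  \int[m1]_x \int[m2]_y f (x, y) = \int[m2]_y \int[m1]_x f (x, y).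
Proof. by rewrite -Rintegral_prod1 Rintegral_prod2. Qed.

End RealFubini.

Section BoundedFubini.
Context d1 d2 (T1 : measurableType d1) (T2 : measurableType d2) (R : realType).
Variables (P1 : probability T1 R) (P2 : probability T2 R) (f : T1 * T2 -> R).
Variable M : R.
Hypothesis mf : measurable_fun setT f.
Hypothesis fM : forall z, `|f z| <= M.

Let i0 : (P1 \x P2)%E.-integrable setT (EFin \o f).
Proof. exact: (@integrable_bounded _ _ _ (P1 \x P2)%E f M). Qed.

Let i1 x : P2.-integrable setT (EFin \o (fun y => f (x, y))).
Proof.
apply: (@integrable_bounded _ _ _ P2 _ M) => [|y]; last exact: fM.
exact: measurableT_comp.
Qed.

Let i2 y : P1.-integrable setT (EFin \o (fun x => f (x, y))).
Proof.
apply: (@integrable_bounded _ _ _ P1 _ M) => [|x]; last exact: fM.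
exact: measurableT_comp.
Qed.

Lemma bounded_Rintegral_prod :
  \int[(P1 \x P2)%E]_z f z = \int[P1]_x \int[P2]_y f (x, y).
Proof. exact: (Rintegral_prod1 i0 i1). Qed.

Lemma bounded_RFubini :
  \int[P1]_x \int[P2]_y f (x, y) = \int[P2]_y \int[P1]_x f (x, y).
Proof. exact: (RFubini i0 i1 i2). Qed.

Lemma bounded_measurable_Rintegral :
  measurable_fun setT (fun x => \int[P2]_y f (x, y)).
Proof. exact: (measurable_Rintegral1 i0 i1). Qed.

End BoundedFubini.

Lemma measurable_normal_pdf2 d (T : measurableType d) (R : realType) (s : R)
    (f g : T -> R) : s != 0 ->
  measurable_fun setT f -> measurable_fun setT g ->
  measurable_fun setT (fun w => normal_pdf (f w) s (g w)).
Proof.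
move=> s0 mf mg; rewrite (_ : (fun w => _) = (fun w =>
   normal_peak s * expR (- (g w - f w) ^+ 2 / (s ^+ 2 *+ 2)))); last first.
  by apply/funext => w; rewrite normal_pdfE.
apply: measurable_funM => //; apply: measurableT_comp => //.
apply: measurable_funM => //; apply: measurableT_comp => //.
by apply: measurable_funX; exact: measurable_funB.
Qed.

(** * Gaussian smoothing of a weighted law *)

Section GaussianSmoothing.
Context d (T : measurableType d) (R : realType) (P : probability T R).
Variables (W U : T -> R) (M : R).
Hypotheses (mW : measurable_fun setT W) (mU : measurable_fun setT U).
Hypothesis WM : forall w, `|W w| <= M.
Variables (s : R) (k : R -> R) (K : R).
Hypotheses (s0 : s != 0) (mk : measurable_fun setT k) (kK : forall x, `|k x| <= K).
Notation mu := (@lebesgue_measure R).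

(** The density of the law of [U], weighted by [W] and convolved with the centered normal law of
    deviation [s]. *)
Definition smoothed_density (y : R) : R :=
  \int[P]_w (W w * normal_pdf (U w) s y).

(* The normal density is itself a cosine transform of the normal law, so the
   smoothed density only depends on the integrals of [W * cos (c + t * U)]. *)
Lemma smoothed_densityE (y : R) : smoothed_density y =
  normal_peak s * \int[normal_prob 0 1]_z
     \int[P]_w (W w * cos (y / s * z + (- z / s) * U w)).
Proof.
pose f (z : T * R) := W z.1 * cos (y / s * z.2 + (- z.2 / s) * U z.1).
have mf : measurable_fun setT f.
  apply: measurable_funM; first exact: measurableT_comp.
  apply: measurable_cos_comp; apply: measurable_funD.
    exact: measurable_funM.
  apply: measurable_funM; last exact: measurableT_comp.
  by apply: measurable_funM => //; exact: measurableT_comp.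
have fM z : `|f z| <= M.
  rewrite normrM -[M]mulr1; apply: ler_pM => //; exact: normr_cos_le1.
have fubini := bounded_RFubini P (normal_prob 0 1) mf fM.
have mI := bounded_measurable_Rintegral P (normal_prob 0 1) mf fM.
rewrite -[X in _ * X]fubini -RintegralZl//; last first.
  apply: (@integrable_bounded _ _ _ P _ M) => // w.
  apply: (@normr_Rintegral_le _ _ _ (normal_prob 0 1)) => //.
  exact: measurableT_comp.
apply: eq_Rintegral => w _; rewrite /f/=.
have E := @Rintegral_normal_cos R 0 1 (oner_neq0 _) 0 ((y - U w) / s).
rewrite RintegralZl//; last first.
  apply: (@integrable_bounded _ _ _ (normal_prob 0 1) (fun z => cos _) 1).
    apply: measurable_cos_comp; apply: measurable_funD.
      exact: measurable_funM.
    by do 2 apply: measurable_funM => //.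
  by move=> z; exact: normr_cos_le1.
rewrite mulrCA; congr (_ * _).
rewrite (_ : \int[normal_prob 0 1]_z _ =
  \int[normal_prob 0 1]_z cos (0 + (y - U w) / s * (z - 0))); last first.
  by apply: eq_Rintegral => z _; congr cos; field.
rewrite E cos0 mul1r normal_pdfE//; congr (_ * _).
by rewrite /normal_fun; congr expR; field.
Qed.

Let f (z : T * R) := W z.1 * (k z.2 * normal_pdf (U z.1) s z.2).

Let mf : measurable_fun setT f.
Proof.
apply: measurable_funM; first exact: measurableT_comp.
apply: measurable_funM; first exact: measurableT_comp.
by apply: measurable_normal_pdf2 => //; exact: measurableT_comp.
Qed.

Let fle z : `|f z| <= M * K * normal_pdf (U z.1) s z.2.
Proof.
rewrite !normrM (ger0_norm (normal_pdf_ge0 _ _ _)) mulrA.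
apply: ler_wpM2r; first exact: normal_pdf_ge0.
exact: ler_pM.
Qed.

Let ipdf w : mu.-integrable setT
  (EFin \o (fun y => M * K * normal_pdf (U w) s y)).
Proof. by apply: integrable_scaleR; exact: integrable_normal_pdf. Qed.

Let if1 w : mu.-integrable setT (EFin \o (fun y => f (w, y))).
Proof.
apply: (integrable_le _ _ (ipdf w)) => [|y]; last exact: fle (w, y).
exact: measurableT_comp.
Qed.

Let if2 y : P.-integrable setT (EFin \o (fun w => f (w, y))).
Proof.
have K0 : 0 <= K by exact: le_trans (kK 0).
apply: (@integrable_bounded _ _ _ P _ (`|M * K| * normal_peak s)) => [|w].
  exact: measurableT_comp.
apply: (le_trans (fle _)) => /=; apply: ler_pM => //.
- by apply: mulr_ge0 => //; exact: le_trans (WM w).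
- exact: normal_pdf_ge0.
- exact: ler_norm.
- exact: normal_pdf_ub.
Qed.

Let if0 : (P \x mu)%E.-integrable setT (EFin \o f).
Proof.
apply/integrable12ltyP; first exact: measurable_EFin.
apply: (@le_lt_trans _ _ (\int[P]_w `|(M * K)%:E|)%E).
  apply: ge0_le_integral => //.
  - by move=> w _; exact: integral_ge0.
  - apply: (@measurable_fun_fubini_tonelli_F _ _ _ _ _ mu (fun z => `|(f z)%:E|)%E) => //.
    by apply: measurableT_comp => //; exact: measurable_EFin.
  - move=> w _.
    have h := @integral_normal_pdf R (U w) s.
    apply: (@le_trans _ _ (\int[mu]_y ((M * K)%:E * (normal_pdf (U w) s y)%:E))%E).
      apply: ge0_le_integral => //.
      + apply: measurableT_comp => //; apply: measurable_EFin.
        exact: measurableT_comp.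
      + apply: (measurable_EFin (f := fun y => M * K * normal_pdf (U w) s y)).
        by apply: measurable_funM => //; exact: measurable_normal_pdf.
      + by move=> y _; rewrite lee_fin; exact: fle (w, y).
    rewrite integralZl//; last exact: integrable_normal_pdf.
    by rewrite h mule1 lee_fin ler_norm.
by have /integrableP[] := finite_measure_integrable_cst P (M * K) measurableT.
Qed.

Let Rintegral_smoothing_kernel w :
  W w * \int[normal_prob (U w) s]_y k y = \int[mu]_y f (w, y).
Proof.
have ik := @integrable_bounded _ _ _ (normal_prob (U w) s) k K mk kK.
rewrite Rintegral_normal_prob// -RintegralZl//.
exact/(integrable_normal_prob (U w) s mk).
Qed.

Lemma measurable_smoothing :
  measurable_fun setT (fun w => W w * \int[normal_prob (U w) s]_y k y).
Proof.
rewrite (funext Rintegral_smoothing_kernel).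
exact: (measurable_Rintegral1 if0 if1).
Qed.

(** Fubini between [P] and Lebesgue measure. Combined with [smoothed_densityE], it shows that
    smoothed integrals depend on the pair ([W], [U]) only through the integrals of W cos(c + t
    U). *)
Lemma Rintegral_smoothing :
  \int[P]_w (W w * \int[normal_prob (U w) s]_y k y) =
  \int[mu]_y (k y * smoothed_density y).
Proof.
under eq_Rintegral do rewrite Rintegral_smoothing_kernel.
rewrite (RFubini if0 if1 if2); apply: eq_Rintegral => y _.
rewrite /smoothed_density -RintegralZl//.
  by apply: eq_Rintegral => w _; rewrite /f/= mulrCA.
apply: (@integrable_bounded _ _ _ P _ (M * normal_peak s)) => [|w].
  apply: measurable_funM => //.
  exact: measurable_normal_pdf2.
rewrite normrM (ger0_norm (normal_pdf_ge0 _ _ _)); apply: ler_pM => //.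
  exact: normal_pdf_ge0.
exact: normal_pdf_ub.
Qed.

End GaussianSmoothing.

(** A Chebyshev argument: the variance 1/(n+1)^2 tends to 0, and [k] deviates from [k u] by little
    near [u] and by at most 2 K elsewhere. *)
Lemma cvg_normal_prob (R : realType) (k : R -> R) (K u : R) :
  continuous k -> (forall x, `|k x| <= K) ->
  \int[normal_prob u n.+1%:R^-1]_y k y @[n --> \oo] --> k u.
Proof.
move=> ck kK; have mk : measurable_fun setT k by exact: continuous_measurable_fun.
have K0 : 0 <= K by exact: le_trans (kK 0).
apply/cvgrPdist_le => e e0.
have e20 : 0 < e / 2 by rewrite divr_gt0.
have /cvgrPdist_lt/(_ _ e20)[dl /= dl0 kdl] := ck u.
have q0 : 0 <= 2 * K / dl ^+ 2.
  by apply: divr_ge0; [exact: mulr_ge0|exact: sqr_ge0].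
(* The quadratic term exceeds 2 K as soon as |y - u| >= [dl], so one bound covers both regions and
   can be integrated using the variance alone. *)
have bound (y : R) : `|k y - k u| <= e / 2 + 2 * K / dl ^+ 2 * (y - u) ^+ 2.
  have [yu|yu] := ltP `|u - y| dl.
    rewrite distrC; apply: (le_trans (ltW (kdl y yu))); rewrite lerDl.
    by apply: mulr_ge0 => //; exact: sqr_ge0.
  have h1 : `|k y - k u| <= 2 * K.
    by apply: (le_trans (ler_normB _ _)); have := kK y; have := kK u; lra.
  apply: (le_trans h1).
  have h2 : dl ^+ 2 <= (y - u) ^+ 2.
    rewrite -[leRHS]ger0_norm ?sqr_ge0// normrX distrC.
    by rewrite lerXn2r ?nnegrE// ltW.
  have h3 : 2 * K <= 2 * K / dl ^+ 2 * (y - u) ^+ 2.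
    rewrite -mulrA ler_peMr ?mulr_ge0// mulrC ler_pdivlMr ?mul1r//.
    by rewrite exprn_gt0.
  by apply: (le_trans h3); rewrite lerDr ltW// divr_gt0.
have : 2 * K / dl ^+ 2 * n.+1%:R^-1 @[n --> \oo] --> (2 * K / dl ^+ 2 * 0 : R).
  by apply: cvgM; [exact: cvg_cst|exact: cvg_harmonic].
rewrite mulr0 => /cvgrPdist_le/(_ _ e20).
apply: filterS => n; rewrite sub0r normrN => hn.
have s0 : n.+1%:R^-1 != 0 :> R by rewrite invr_neq0.
set N := normal_prob u n.+1%:R^-1.
have ik : N.-integrable setT (EFin \o k) by exact: (@integrable_bounded _ _ _ N k K).
have ic : N.-integrable setT (EFin \o cst (k u)).
  exact: (finite_measure_integrable_cst N (k u) measurableT).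
have isq : N.-integrable setT (EFin \o (fun y => 2 * K / dl ^+ 2 * (y - u) ^+ 2)).
  apply: integrable_scaleR; apply: (@integrable_poly_normal _ _ _ s0 _ 1).
    by apply: measurable_funX; exact: measurable_funB.
  move=> x; rewrite mul1r ger0_norm ?sqr_ge0// (exprM _ 2 2).
  by have := sqr_ge0 ((x - u) ^+ 2 - 1); rewrite !expr2; nra.
have ie : N.-integrable setT (EFin \o cst (e / 2)).
  exact: (finite_measure_integrable_cst N (e / 2) measurableT).
have -> : k u - \int[N]_y k y = - \int[N]_y (k y - k u).
  by rewrite RintegralB// (Rintegral_prob_cst N (k u)) opprB.
rewrite normrN; apply: (le_trans (le_normr_Rintegral _ _)) => //.
  exact: integrable_subR.
apply: (@le_trans _ _ (\int[N]_y (e / 2 + 2 * K / dl ^+ 2 * (y - u) ^+ 2))).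
  apply: le_Rintegral => //.
  - exact: (integrable_abse (integrable_subR ik ic)).
  - exact: (integrable_addR ie isq).
rewrite RintegralD// (Rintegral_prob_cst N (e / 2)) RintegralZl//; last first.
  apply: (@integrable_poly_normal _ _ _ s0 _ 1).
    by apply: measurable_funX; exact: measurable_funB.
  move=> x; rewrite mul1r ger0_norm ?sqr_ge0// (exprM _ 2 2).
  by have := sqr_ge0 ((x - u) ^+ 2 - 1); rewrite !expr2; nra.
rewrite (Rintegral_normal_variance u s0).
have n0 : 0 <= n.+1%:R^-1 :> R by rewrite invr_ge0.
have : n.+1%:R^-1 ^+ 2 <= n.+1%:R^-1 :> R.
  by rewrite expr2 ler_piMr// invf_le1// ler1n.
have := hn; rewrite (ger0_norm (mulr_ge0 q0 n0)) => h1 h2.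
by rewrite [leRHS]splitr lerD2l; exact: le_trans (ler_wpM2l q0 h2) h1.
Qed.

(** * Uniqueness of laws from their cosine integrals *)

Section Levy.
Context d (T : measurableType d) (R : realType) (P : probability T R).
Context d' (T' : measurableType d') (P' : probability T' R).

(* The weight [W] allows an induction over the coordinates of a vector: at each
   step the remaining coordinates are absorbed in [W]. *)
Lemma levy_weighted (W U : T -> R) (W' U' : T' -> R) (M : R) :
  measurable_fun setT W -> measurable_fun setT U -> (forall w, `|W w| <= M) ->
  measurable_fun setT W' -> measurable_fun setT U' -> (forall w, `|W' w| <= M) ->
  (forall c t, \int[P]_w (W w * cos (c + t * U w)) =
               \int[P']_w (W' w * cos (c + t * U' w))) ->
  forall (k : R -> R) (K : R), continuous k -> (forall x, `|k x| <= K) ->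
  \int[P]_w (W w * k (U w)) = \int[P']_w (W' w * k (U' w)).
Proof.
move=> mW mU WM mW' mU' WM' E k K ck kK.
have mk : measurable_fun setT k by exact: continuous_measurable_fun.
have s0 n : n.+1%:R^-1 != 0 :> R by rewrite invr_neq0.
have cv d0 (T0 : measurableType d0) (P0 : probability T0 R) (W0 U0 : T0 -> R) :
    measurable_fun setT W0 -> measurable_fun setT U0 -> (forall w, `|W0 w| <= M) ->
    \int[P0]_w (W0 w * \int[normal_prob (U0 w) n.+1%:R^-1]_y k y) @[n --> \oo] -->
    \int[P0]_w (W0 w * k (U0 w)).
  move=> mW0 mU0 WM0.
  have [] // := @Rdominated_cvg _ _ _ P0
    (fun n w => W0 w * \int[normal_prob (U0 w) n.+1%:R^-1]_y k y)
    (fun w => W0 w * k (U0 w)) (cst (M * K)).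
  - by move=> n; exact: (measurable_smoothing P0 mW0 mU0 WM0 (s0 n) mk kK).
  - by move=> w; apply: cvgM; [exact: cvg_cst|exact: cvg_normal_prob].
  - exact: finite_measure_integrable_cst.
  - move=> n w; rewrite normrM; apply: ler_pM => //.
    exact: (@normr_Rintegral_le _ _ _ (normal_prob (U0 w) n.+1%:R^-1)).
(* Both sides are limits of their smoothed versions, and these agree for each n because their
   smoothed densities are determined by the cosine integrals. *)
apply: (cvg_unique _ (cv _ _ P W U mW mU WM)) => //.
rewrite (_ : (fun n => _) =
   (fun n => \int[P']_w (W' w * \int[normal_prob (U' w) n.+1%:R^-1]_y k y))).
  exact: cv.
apply/funext => n.
rewrite (Rintegral_smoothing P mW mU WM (s0 n) mk kK).
rewrite (Rintegral_smoothing P' mW' mU' WM' (s0 n) mk kK).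
apply: eq_Rintegral => y _; congr (_ * _).
rewrite (smoothed_densityE P mW mU WM (s0 n)).
rewrite (smoothed_densityE P' mW' mU' WM' (s0 n)).
congr (_ * _).
by apply: eq_Rintegral => z _; exact: E.
Qed.

End Levy.

Section SameLaw.
Context d (T : measurableType d) (R : realType) (P : probability T R).
Context d' (T' : measurableType d') (P' : probability T' R).
Variables (S : T -> R) (S' : T' -> R).
Hypotheses (mS : measurable_fun setT S) (mS' : measurable_fun setT S').
Hypothesis lawE : forall A : set R, measurable A -> P (S @^-1` A) = P' (S' @^-1` A).

Lemma same_law_integrable (f : R -> R) : measurable_fun setT f ->
  P.-integrable setT (EFin \o (fun w => f (S w))) ->
  P'.-integrable setT (EFin \o (fun w => f (S' w))).
Proof.
pose HS := isMeasurableFun.Build _ _ _ _ _ mS.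
pose pS : {mfun T >-> R} := HB.pack S HS.
pose HS' := isMeasurableFun.Build _ _ _ _ _ mS'.
pose pS' : {mfun T' >-> R} := HB.pack S' HS'.
move=> mf /integrableP[_ h]; apply/integrableP; split.
  by apply: measurable_EFin; exact: measurableT_comp.
have mf' : measurable_fun setT (fun x => `|(f x)%:E|%E).
  by apply: measurableT_comp => //; exact: measurable_EFin.
rewrite -(@ge0_integral_distribution _ _ _ _ _ P' pS' (fun x => `|(f x)%:E|%E))//.
rewrite (@eq_measure_integral _ _ _ _ (distribution P pS)); last first.
  by move=> A mA _; exact: (esym (lawE mA)).
by rewrite ge0_integral_distribution.
Qed.

Lemma same_law_Rintegral (f : R -> R) : measurable_fun setT f ->
  P.-integrable setT (EFin \o (fun w => f (S w))) ->
  \int[P]_w f (S w) = \int[P']_w f (S' w).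
Proof.
pose HS := isMeasurableFun.Build _ _ _ _ _ mS.
pose pS : {mfun T >-> R} := HB.pack S HS.
pose HS' := isMeasurableFun.Build _ _ _ _ _ mS'.
pose pS' : {mfun T' >-> R} := HB.pack S' HS'.
move=> mf intf; congr fine.
have mf' : measurable_fun setT (EFin \o f) by exact: measurable_EFin.
rewrite -(@integral_distribution _ _ _ _ _ P pS (EFin \o f))//.
rewrite -(@integral_distribution _ _ _ _ _ P' pS' (EFin \o f))//; last first.
  exact: same_law_integrable.
apply: eq_measure_integral => A mA _.
exact: lawE.
Qed.

End SameLaw.

Section EqualLaws.
Context d (T : measurableType d) (R : realType) (P : probability T R).
Context d' (T' : measurableType d') (P' : probability T' R).
Variables (S : T -> R) (S' : T' -> R).
Hypotheses (mS : measurable_fun setT S) (mS' : measurable_fun setT S').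
Hypothesis cosE : forall c t,
  \int[P]_w cos (c + t * S w) = \int[P']_w cos (c + t * S' w).

Lemma Rintegral_law_bounded_continuous (k : R -> R) (K : R) :
  continuous k -> (forall x, `|k x| <= K) ->
  \int[P]_w k (S w) = \int[P']_w k (S' w).
Proof.
move=> ck kK.
have h := @levy_weighted _ T R P _ T' P' (cst 1) S (cst 1) S' 1.
have : \int[P]_w (cst 1 w * k (S w)) = \int[P']_w (cst 1 w * k (S' w)).
  apply: h ck kK => //; try by move=> w; rewrite normr1.
  move=> c t.
  under eq_Rintegral do rewrite mul1r.
  by under [RHS]eq_Rintegral do rewrite mul1r.
under eq_Rintegral do rewrite mul1r.
by under [X in _ = X -> _]eq_Rintegral do rewrite mul1r.
Qed.

Lemma law_eq_ray (a : R) : P (S @^-1` `]a, +oo[) = P' (S' @^-1` `]a, +oo[).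
Proof.
(* (x - a) + |x - a| is twice the positive part of x - a, so [k n] vanishes up to and including [a]
   and tends to 1 beyond: the open ray is a pointwise limit of bounded continuous functions. *)
pose k n x := 1 - expR (- (n.+1%:R * ((x - a) + `|x - a|))) : R.
have k1 n x : `|k n x| <= 1.
  have h : 0 <= n.+1%:R * ((x - a) + `|x - a|).
    by apply: mulr_ge0 => //; have := ler_norm (- (x - a)); rewrite normrN; lra.
  rewrite /k ger0_norm; first by rewrite gerBl expR_ge0.
  by rewrite subr_ge0 -[leRHS]expR0 ler_expR oppr_le0.
have ck n : continuous (k n).
  move=> x; apply: (@cvgB _ R^o); first exact: cvg_cst.
  apply: (cvg_comp _ expR); last exact: continuous_expR.
  apply: (@cvgN _ R^o); apply: cvgM; first exact: cvg_cst.
  have c1 : y - a @[y --> x] --> x - a.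
    by apply: (@cvgB _ R^o); [exact: cvg_id|exact: cvg_cst].
  by apply: (@cvgD _ R^o) => //; exact: cvg_norm.
have cvk x : k ^~ x @ \oo --> (\1_(`]a, +oo[%classic : set R) x : R).
  rewrite indicE; have [xa|xa] := ltP a x; last first.
    rewrite memNset; last by rewrite /= in_itv/= andbT; apply/negP; rewrite -leNgt.
    apply: cvg_near_cst; apply: nearW => n.
    by rewrite /k ler0_norm ?subr_le0// addrN mulr0 oppr0 expR0 subrr.
  rewrite mem_set; last by rewrite /= in_itv/= andbT.
  rewrite -[X in _ --> X]subr0; apply: (@cvgB _ R^o); first exact: cvg_cst.
  have xa0 : 0 < x - a by rewrite subr_gt0.
  apply: (@cvgr0_harmonic_le _ _ (2 * (x - a))^-1) => n.
  rewrite ger0_norm ?expR_ge0// gtr0_norm// expRN -invfM.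
  have p0 : 0 < 2 * (x - a) * n.+1%:R by apply: mulr_gt0 => //; exact: mulr_gt0.
  rewrite lef_pV2 ?posrE ?expR_gt0//.
  have -> : n.+1%:R * (x - a + (x - a)) = 2 * (x - a) * n.+1%:R by ring.
  by apply: le_trans (expR_ge1Dx _); rewrite lerDr.
have key d0 (T0 : measurableType d0) (P0 : probability T0 R) (S0 : T0 -> R) :
    measurable_fun setT S0 ->
    \int[P0]_w k n (S0 w) @[n --> \oo] --> fine (P0 (S0 @^-1` `]a, +oo[)).
  move=> mS0.
  have mA : measurable (S0 @^-1` `]a, +oo[).
    by rewrite -[X in measurable X]setTI; exact: mS0.
  have -> : fine (P0 (S0 @^-1` `]a, +oo[)) =
      \int[P0]_w \1_(`]a, +oo[%classic : set R) (S0 w).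
    congr fine; rewrite -[X in P0 X]setIT -(integral_indic P0 measurableT mA).
    by apply: eq_integral => w _; rewrite !indicE.
  have [||||] // := @Rdominated_cvg _ _ _ P0 (fun n w => k n (S0 w))
    (fun w => \1_(`]a, +oo[%classic : set R) (S0 w)) (cst 1).
  - move=> n; apply: measurableT_comp => //.
    exact: continuous_measurable_fun (ck n).
  - exact: finite_measure_integrable_cst.
have h1 := key _ _ P _ mS; have h2 := key _ _ P' _ mS'.
have E : fine (P (S @^-1` `]a, +oo[)) = fine (P' (S' @^-1` `]a, +oo[)).
  apply: (cvg_unique _ h1) => //.
  rewrite (_ : (fun n => _) = (fun n => \int[P']_w k n (S' w)))//.
  by apply/funext => n; exact: Rintegral_law_bounded_continuous (ck n) (k1 n).
rewrite -[LHS]fineK; last first.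
  by apply: fin_num_measure; rewrite -[X in measurable X]setTI; exact: mS.
rewrite E fineK//.
by apply: fin_num_measure; rewrite -[X in measurable X]setTI; exact: mS'.
Qed.

Lemma law_eq (A : set R) : measurable A -> P (S @^-1` A) = P' (S' @^-1` A).
Proof.
pose HS := isMeasurableFun.Build _ _ _ _ _ mS.
pose pS : {mfun T >-> R} := HB.pack S HS.
pose HS' := isMeasurableFun.Build _ _ _ _ _ mS'.
pose pS' : {mfun T' >-> R} := HB.pack S' HS'.
move=> mA.
apply: (@measure_unique _ R _ (@RGenOInfty.G R) (fun n => `](- n%:R), +oo[%classic) _ _ _ _
  (distribution P pS) (distribution P' pS')) => //.
- exact: RGenOInfty.measurableE.
- move=> _ _ [x ->] [y ->]; exists (Num.max x y).
  apply/seteqP; split => z /=; rewrite !in_itv/= !andbT gt_max.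
    by move=> [-> ->].
  by move=> /andP[].
- by move=> n; eexists.
- rewrite -subTset => x _ /=.
  have [n _ h] := nbhs_infty_ger (1 - x).
  exists n => //=; rewrite in_itv/= andbT.
  by have := h n (leqnn n); rewrite /=; lra.
- by move=> _ [x ->]; exact: law_eq_ray.
- move=> n; apply: (le_lt_trans (probability_le1 _ _)); last exact: ltry.
  exact: measurable_itv.
Qed.

Definition law_integrable := same_law_integrable mS mS' law_eq.

Definition Rintegral_law := same_law_Rintegral mS mS' law_eq.

End EqualLaws.

Section VectorLaw.
Context d (T : measurableType d) (R : realType) (P : probability T R).
Context d' (T' : measurableType d') (P' : probability T' R).

Let cosD2 (a b : R) : cos a * cos b = (cos (a + b) + cos (a - b)) / 2.
Proof. by rewrite cosB cosD; field. Qed.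

Let sin_cos (a : R) : sin a = cos (a - pi / 2).
Proof. by rewrite cosB cos_pihalf sin_pihalf; ring. Qed.

(** The addition formula splits off the weight cos(c + G), or its shift by a quarter period for the
    sine part, from a bounded continuous function of [U]; [levy_weighted] then applies. Its
    hypothesis follows from the product-to-sum formula, which only shifts the phase and flips the
    sign of t. *)
Lemma cos_law_comp (G U : T -> R) (G' U' : T' -> R) :
  measurable_fun setT G -> measurable_fun setT U ->
  measurable_fun setT G' -> measurable_fun setT U' ->
  (forall c t, \int[P]_w cos (c + G w + t * U w) =
               \int[P']_w cos (c + G' w + t * U' w)) ->
  forall (h : R -> R) c, continuous h ->
  \int[P]_w cos (c + G w + h (U w)) = \int[P']_w cos (c + G' w + h (U' w)).
Proof.
move=> mG mU mG' mU' E h c ch.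
have mcG a : measurable_fun setT (fun w => cos (a + G w)).
  by apply: measurable_cos_comp; exact: measurable_funD.
have mcG' a : measurable_fun setT (fun w => cos (a + G' w)).
  by apply: measurable_cos_comp; exact: measurable_funD.
have key a (k : R -> R) : continuous k -> (forall x, `|k x| <= 1) ->
    \int[P]_w (cos (a + G w) * k (U w)) = \int[P']_w (cos (a + G' w) * k (U' w)).
  move=> ck k1; apply: (@levy_weighted _ _ _ P _ _ P' _ _ _ _ 1) ck k1 => //;
    try by move=> w; exact: normr_cos_le1.
  move=> c0 t.
  have split_cos d0 (T0 : measurableType d0) (P0 : probability T0 R) (G0 U0 : T0 -> R) :
     measurable_fun setT G0 -> measurable_fun setT U0 ->
     \int[P0]_w (cos (a + G0 w) * cos (c0 + t * U0 w)) =
     2^-1 * (\int[P0]_w cos (a + c0 + G0 w + t * U0 w) +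
             \int[P0]_w cos (a - c0 + G0 w + (- t) * U0 w)).
    move=> mG0 mU0.
    have i1 x y : P0.-integrable setT (EFin \o (fun w => cos (x + G0 w + y * U0 w))).
      apply: (@integrable_bounded _ _ _ P0 _ 1) => [|w]; last exact: normr_cos_le1.
      apply: measurable_cos_comp; apply: measurable_funD; first exact: measurable_funD.
      exact: measurable_funM.
    rewrite -RintegralD// -RintegralZl//; last exact: integrable_addR.
    apply: eq_Rintegral => w _; rewrite cosD2 mulrC; congr (_ * (cos _ + cos _)); ring.
  by rewrite !split_cos// !E.
have ccos : continuous (fun x => cos (h x)).
  by move=> x; apply: (cvg_comp h cos); [exact: ch|exact: continuous_cos].
have csin : continuous (fun x => sin (h x)).
  by move=> x; apply: (cvg_comp h sin); [exact: ch|exact: continuous_sin].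
have split_cos d0 (T0 : measurableType d0) (P0 : probability T0 R) (G0 U0 : T0 -> R) :
   measurable_fun setT G0 -> measurable_fun setT U0 ->
   \int[P0]_w cos (c + G0 w + h (U0 w)) =
   \int[P0]_w (cos (c + G0 w) * cos (h (U0 w))) -
   \int[P0]_w (cos (c - pi / 2 + G0 w) * sin (h (U0 w))).
  move=> mG0 mU0.
  have mh (k : R -> R) : continuous k -> measurable_fun setT (fun w => k (U0 w)).
    by move=> ck; apply: measurableT_comp mU0; exact: continuous_measurable_fun.
  have i1 x (k : R -> R) : continuous k -> (forall x, `|k x| <= 1) ->
      P0.-integrable setT (EFin \o (fun w => cos (x + G0 w) * k (U0 w))).
    move=> ck k1.
    apply: (@integrable_bounded _ _ _ P0 _ 1) => [|w].
      apply: measurable_funM; last exact: mh.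
      by apply: measurable_cos_comp; exact: measurable_funD.
    rewrite normrM -[1]mulr1; apply: ler_pM => //; exact: normr_cos_le1.
  rewrite -RintegralB//; last 2 first.
  - exact: (i1 c _ ccos (fun x => normr_cos_le1 (h x))).
  - exact: (i1 (c - pi / 2) _ csin (fun x => normr_sin_le1 (h x))).
  apply: eq_Rintegral => w _; rewrite cosD sin_cos.
  by congr (_ - cos _ * _); ring.
rewrite !split_cos//; congr (_ - _).
  exact: (key c _ ccos (fun x => normr_cos_le1 (h x))).
exact: (key (c - pi / 2) _ csin (fun x => normr_sin_le1 (h x))).
Qed.

Variables (I : finType) (U : I -> T -> R) (U' : I -> T' -> R).
Hypotheses (mU : forall i, measurable_fun setT (U i))
           (mU' : forall i, measurable_fun setT (U' i)).
Hypothesis cosE : forall (c : R) (th : I -> R),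
  \int[P]_w cos (c + \sum_i th i * U i w) =
  \int[P']_w cos (c + \sum_i th i * U' i w).

(* The linear functions of the coordinates are replaced by the [h i] one
   coordinate at a time. *)
Lemma cos_vector_law (h : I -> R -> R) : (forall i, continuous (h i)) ->
  forall c, \int[P]_w cos (c + \sum_i h i (U i w)) =
            \int[P']_w cos (c + \sum_i h i (U' i w)).
Proof.
move=> ch.
have key (r : seq I) c (th : I -> R) :
  \int[P]_w cos (c + (\sum_(i <- r) h i (U i w) + \sum_i th i * U i w)) =
  \int[P']_w cos (c + (\sum_(i <- r) h i (U' i w) + \sum_i th i * U' i w)).
  elim: r c th => [|j r IH] c th.
    under eq_Rintegral do rewrite big_nil add0r.
    by under [RHS]eq_Rintegral do rewrite big_nil add0r.
  have cons_sum d0 (T0 : measurableType d0) (P0 : probability T0 R) (V : I -> T0 -> R) :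
    \int[P0]_w cos (c + (\sum_(i <- j :: r) h i (V i w) + \sum_i th i * V i w)) =
    \int[P0]_w cos (c + (\sum_(i <- r) h i (V i w) + \sum_i th i * V i w) + h j (V j w)).
    by apply: eq_Rintegral => w _; rewrite big_cons; congr cos; ring.
  rewrite !cons_sum; apply: cos_law_comp => //.
  - by apply: measurable_funD; apply: measurable_sum => i;
      [apply: measurableT_comp => //; exact: continuous_measurable_fun|exact: measurable_funM].
  - by apply: measurable_funD; apply: measurable_sum => i;
      [apply: measurableT_comp => //; exact: continuous_measurable_fun|exact: measurable_funM].
  - move=> a t.
    (* The extra linear term in coordinate [j] is absorbed into [th]. This is why [key] carries a
       linear part over all of [I], with [th] left arbitrary by the induction. *)
    have shift d0 (T0 : measurableType d0) (P0 : probability T0 R) (V : I -> T0 -> R) :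
      \int[P0]_w cos (a + (\sum_(i <- r) h i (V i w) + \sum_i th i * V i w) + t * V j w) =
      \int[P0]_w cos (a + (\sum_(i <- r) h i (V i w) +
         \sum_i (th i + (if i == j then t else 0)) * V i w)).
      apply: eq_Rintegral => w _; congr cos; rewrite -!addrA; congr (_ + (_ + _)).
      under [RHS]eq_bigr do rewrite mulrDl.
      rewrite big_split/=; congr (_ + _).
      rewrite (bigD1 j)//= eqxx big1 ?addr0// => i /negPf ->.
      by rewrite mul0r.
    by rewrite !shift.
move=> c; have := key (index_enum I) c (fun=> 0).
have z d0 (T0 : measurableType d0) (P0 : probability T0 R) (V : I -> T0 -> R) :
  \int[P0]_w cos (c + (\sum_i h i (V i w) + \sum_i 0 * V i w)) =
  \int[P0]_w cos (c + \sum_i h i (V i w)).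
  by apply: eq_Rintegral => w _; rewrite [X in _ + (_ + X)]big1 ?addr0// => i _; rewrite mul0r.
by rewrite !z.
Qed.

End VectorLaw.

(** * Log-sum-exp *)

Section Taylor.
Context (R : realType).
Implicit Types x y : R.

(** The mean value theorem from 0 to [y]. The hypotheses are restricted to |x| <= |y| so that
    functions such as ln(1 + x) are admissible. *)
Lemma normr_le_derive (f df : R -> R) (y B : R) :
  (forall x, `|x| <= `|y| -> is_derive x (1 : R) f (df x)) -> f 0 = 0 ->
  (forall x, `|x| <= `|y| -> `|df x| <= B) -> `|f y| <= B * `|y|.
Proof.
move=> dF f0 dfB.
have cont (a b : R) : (forall x, x \in `[a, b] -> `|x| <= `|y|) ->
    {within `[a, b], continuous f}.
  move=> ab; apply: derivable_within_continuous => x xab.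
  exact/ex_derive/dF/ab.
have [y0|y0] := leP 0 y.
  have sub x : x \in `[0, y] -> `|x| <= `|y|.
    by rewrite in_itv/= => /andP[x0 xy]; rewrite !ger0_norm.
  have [x xy] := @MVT_segment _ f df 0 y y0
    (fun x xy => dF x (sub x (subset_itv_oo_cc xy))) (cont _ _ sub).
  by rewrite f0 !subr0 => ->; rewrite normrM ler_wpM2r// dfB// sub.
have sub x : x \in `[y, 0] -> `|x| <= `|y|.
  by rewrite in_itv/= => /andP[yx x0]; rewrite (ler0_norm x0) (ltr0_norm y0) lerN2.
have [x xy] := @MVT_segment _ f df y 0 (ltW y0)
  (fun x xy => dF x (sub x (subset_itv_oo_cc xy))) (cont _ _ sub).
rewrite f0 !sub0r => /(congr1 -%R); rewrite opprK mulrN opprK => ->.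
by rewrite normrM ler_wpM2r// dfB// sub.
Qed.

(** A crude bound e <= 4, obtained by squaring exp(-1/2) >= 1 - 1/2. *)
Lemma expR_le4 x : `|x| <= 1 -> expR x <= 4.
Proof.
move=> x1; have h : expR (- (1 / 2)) >= 1 / 2 :> R.
  by apply: le_trans (expR_ge1Dx _); lra.
have h1 : expR (- 1) >= 1 / 4 :> R.
  have -> : - 1 = - (1 / 2) + - (1 / 2) :> R by lra.
  rewrite expRD; have -> : 1 / 4 = (1 / 2) * (1 / 2) :> R by lra.
  by apply: ler_pM => //; lra.
apply: (@le_trans _ _ (expR 1)); first by rewrite ler_expR (le_trans (ler_norm x)).
have -> : expR 1 = (expR (- 1))^-1 :> R by rewrite expRN invrK.
have -> : 4 = (1 / 4)^-1 :> R by field.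
by rewrite lef_pV2 ?posrE ?expR_gt0//; lra.
Qed.

(** Each Taylor remainder of exp is the derivative of the next one, so three uses of the mean value
    bound propagate the constant 4 without integrating. *)
Lemma expR_taylor2 y : `|y| <= 1 ->
  `|expR y - 1 - y - y ^+ 2 / 2| <= 4 * `|y| ^+ 3.
Proof.
move=> y1.
have e1 x : `|x| <= 1 -> `|expR x - 1| <= 4 * `|x|.
  move=> x1; apply: (@normr_le_derive (fun x => expR x - 1) expR).
  - by move=> z _; apply: is_derive_eq; rewrite subr0 ?mulr1.
  - by rewrite expR0 subrr.
  - move=> z zx; rewrite ger0_norm ?expR_ge0//; apply: expR_le4.
    exact: le_trans x1.
have e2 x : `|x| <= 1 -> `|expR x - 1 - x| <= 4 * `|x| * `|x|.
  move=> x1; apply: (@normr_le_derive (fun x => expR x - 1 - x) (fun x => expR x - 1)).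
  - by move=> z _; apply: is_derive_eq; rewrite subr0 ?mulr1.
  - by rewrite expR0 subrr subr0.
  - move=> z zx; apply: (le_trans (e1 _ (le_trans zx x1))).
    by rewrite ler_wpM2l.
rewrite (_ : 4 * `|y| ^+ 3 = 4 * `|y| * `|y| * `|y|); last by ring.
apply: (@normr_le_derive (fun y => expR y - 1 - y - y ^+ 2 / 2)
   (fun x => expR x - 1 - x)).
- by move=> z _; apply: is_derive_eq; rewrite /GRing.scale/=; field.
- by rewrite expR0 expr0n/= mul0r subrr !subr0.
- move=> z zy; apply: (le_trans (e2 _ (le_trans zy y1))).
  by rewrite -!mulrA ler_wpM2l// ler_pM.
Qed.

(** The remainder has derivative x^2 / (1 + x), and 1 + x >= 1/2 on the range considered. *)
Lemma ln1D_taylor2 (s : R) : `|s| <= 1 / 2 ->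
  `|ln (1 + s) - s + s ^+ 2 / 2| <= 2 * `|s| ^+ 3.
Proof.
move=> s1.
rewrite (_ : 2 * `|s| ^+ 3 = 2 * `|s| ^+ 2 * `|s|); last by ring.
have pos z : `|z| <= `|s| -> 1 / 2 <= 1 + z.
  by move=> zs; have := ler_norm (- z); rewrite normrN; lra.
apply: (@normr_le_derive (fun s => ln (1 + s) - s + s ^+ 2 / 2)
   (fun x => x ^+ 2 / (1 + x))).
- move=> z zs; have p := pos z zs.
  have z0 : 0 < 1 + z by lra.
  have d1 : is_derive z (1 : R) (fun x => 1 + x) 1.
    by apply: is_derive_eq; rewrite add0r mulr1.
  have d2 := is_derive1_ln z0.
  have d3 : is_derive z (1 : R) (fun x => ln (1 + x)) ((1 + z)^-1).
    have := @is_derive1_comp R (@ln R) (fun x => 1 + x) z _ _ d2 d1.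
    by rewrite mulr1.
  apply: is_derive_eq; rewrite /GRing.scale/=; field.
  by rewrite gt_eqF.
- by rewrite addr0 ln1 expr0n/= mul0r subrr addr0.
- move=> z zs; have p := pos z zs.
  have z0 : 0 < 1 + z by lra.
  rewrite normrM normfV (gtr0_norm z0) normrX ler_pdivrMr//.
  have : `|z| ^+ 2 <= `|s| ^+ 2 by rewrite lerXn2r ?nnegrE.
  have := sqr_ge0 `|s|; nra.
Qed.

End Taylor.

Section LogSumExp.
Context (R : realType) (I : finType).
Implicit Types (p x y : I -> R).

Definition lse x : R := ln (\sum_i expR (x i)).

Lemma ln_wsum_expR_bound p y (M : R) : (forall i, 0 <= p i) -> \sum_i p i = 1 ->
  (forall i, `|y i| <= M) -> `|ln (\sum_i p i * expR (y i))| <= M.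
Proof.
move=> p0 p1 yM.
have l : expR (- M) <= \sum_i p i * expR (y i).
  rewrite -[leLHS]mul1r -p1 mulr_suml; apply: ler_sum => i _.
  apply: ler_wpM2l => //; rewrite ler_expR.
  by have := ler_norm (- y i); rewrite normrN; have := yM i; lra.
have u : \sum_i p i * expR (y i) <= expR M.
  rewrite -[leRHS]mul1r -p1 mulr_suml; apply: ler_sum => i _.
  apply: ler_wpM2l => //; rewrite ler_expR.
  exact: (le_trans (ler_norm _)).
have s0 : 0 < \sum_i p i * expR (y i) by exact: lt_le_trans (expR_gt0 _) l.
rewrite ler_norml; apply/andP; split.
  by rewrite -[leLHS]expRK ler_ln ?posrE ?expR_gt0.
by rewrite -[leRHS]expRK ler_ln ?posrE ?expR_gt0.
Qed.

Lemma wmean_bound p y (M : R) : (forall i, 0 <= p i) -> \sum_i p i = 1 ->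
  (forall i, `|y i| <= M) -> `|\sum_i p i * y i| <= M.
Proof.
move=> p0 p1 yM; apply: (le_trans (ler_norm_sum _ _ _)).
rewrite -[leRHS]mul1r -p1 mulr_suml; apply: ler_sum => i _.
by rewrite normrM (ger0_norm (p0 i)) ler_wpM2l.
Qed.

(** The bound must hold for all [M], since Gaussian increments are unbounded. For M > 1/8 each term
    is estimated separately; for M <= 1/8 the expansions of exp and ln are composed. *)
Lemma ln_wsum_expR_taylor_max p y (M : R) : (forall i, 0 <= p i) -> \sum_i p i = 1 ->
  (forall i, `|y i| <= M) ->
  `|ln (\sum_i p i * expR (y i)) - \sum_i p i * y i -
    (\sum_i p i * y i ^+ 2 - (\sum_i p i * y i) ^+ 2) / 2| <= 136 * M ^+ 3.
Proof.
move=> p0 p1 yM.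
have mM := wmean_bound p0 p1 yM.
have M0 : 0 <= M by apply: le_trans mM.
have qM : `|\sum_i p i * y i ^+ 2| <= M ^+ 2.
  apply: wmean_bound => // i; rewrite normrX lerXn2r ?nnegrE//.
have lM := ln_wsum_expR_bound p0 p1 yM.
set m := \sum_i p i * y i in mM *; set q := \sum_i p i * y i ^+ 2 in qM *.
have [Ms|Mb] := leP M (1 / 8); last first.
  set L := ln _ in lM *.
  have m2 : `|m ^+ 2| <= M ^+ 2 by rewrite normrX lerXn2r ?nnegrE.
  (* Origin of 136: when M > 1/8, M <= 64 M^3 and M^2 <= 8 M^3, so 2 M + M^2 <= (128 + 8) M^3. *)
  apply: (@le_trans _ _ (2 * M + M ^+ 2)).
    move: lM mM qM m2; rewrite !ler_norml => /andP[? ?] /andP[? ?] /andP[? ?] /andP[? ?].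
    by apply/andP; split; lra.
  have a1 : M / 8 <= M ^+ 2 by rewrite expr2; nra.
  have a2 : M ^+ 2 / 8 <= M ^+ 3.
    by rewrite (_ : M ^+ 3 = M * M ^+ 2); [have := sqr_ge0 M; nra|ring].
  by lra.
pose r i := expR (y i) - 1 - y i - y i ^+ 2 / 2.
have rM : `|\sum_i p i * r i| <= 4 * M ^+ 3.
  apply: wmean_bound => // i.
  have y1 : `|y i| <= 1 by apply: (le_trans (yM i)); lra.
  apply: (le_trans (expR_taylor2 y1)); rewrite ler_wpM2l//.
  by rewrite lerXn2r ?nnegrE.
set rho := \sum_i p i * r i in rM.
pose s := m + q / 2 + rho.
have -> : \sum_i p i * expR (y i) = 1 + s.
  transitivity (\sum_i (p i + (p i * y i + p i * y i ^+ 2 / 2 + p i * r i))).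
    by apply: eq_bigr => i _; rewrite /r; field.
  by rewrite !big_split/= p1 -mulr_suml.
have M3 : M ^+ 3 <= M ^+ 2 / 8.
  by rewrite (_ : M ^+ 3 = M * M ^+ 2); [have := sqr_ge0 M; nra|ring].
have M2 : M ^+ 2 <= M / 8 by rewrite expr2; nra.
have M20 : 0 <= M ^+ 2 by exact: sqr_ge0.
have M30 : 0 <= M ^+ 3 by exact: exprn_ge0.
have sM : `|s| <= 9 / 8 * M.
  rewrite /s; apply: (le_trans (ler_normD _ _)).
  have := ler_normD m (q / 2); rewrite [X in _ <= _ + X -> _]normrM [X in _ <= _ + _ * X -> _]ger0_norm; last by lra.
  by lra.
have smM : `|s - m| <= M ^+ 2.
  have -> : s - m = q / 2 + rho by rewrite /s; ring.
  apply: (le_trans (ler_normD _ _)).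
  rewrite normrM [X in _ * X + _]ger0_norm; last by lra.
  by lra.
have s12 : `|s| <= 1 / 2 by lra.
have lnT := ln1D_taylor2 s12.
have s3 : `|s| ^+ 3 <= 2 * M ^+ 3.
  apply: (@le_trans _ _ ((9 / 8 * M) ^+ 3)); first by rewrite lerXn2r ?nnegrE// mulr_ge0.
  by rewrite exprMn; lra.
have s2 : `|s ^+ 2 - m ^+ 2| <= 3 * M ^+ 3.
  rewrite subr_sqr normrM.
  apply: (@le_trans _ _ (M ^+ 2 * (3 * M))); last by rewrite exprS; lra.
  apply: ler_pM => //; apply: (le_trans (ler_normD _ _)); lra.
(* The remainder splits into the error of ln at 1 + s, the averaged error [rho] of exp, and the cost
   of replacing s^2 by m^2; each is of order M^3. *)
have -> : ln (1 + s) - m - (q - m ^+ 2) / 2 =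
   (ln (1 + s) - s + s ^+ 2 / 2) + rho - (s ^+ 2 - m ^+ 2) / 2.
  by rewrite /s; field.
apply: (le_trans (ler_normB _ _)).
rewrite [X in _ + X]normrM [X in _ + _ * X]ger0_norm; last by lra.
have := ler_normD (ln (1 + s) - s + s ^+ 2 / 2) rho.
by lra.
Qed.

(** Half the variance of [y] under [p] is a quarter of the double sum of squared differences; in
    this form only increments enter. The maximum of |y i|^3 is relaxed to the sum, whose expectation
    is a sum of third moments. *)
Lemma ln_wsum_expR_taylor p y : (forall i, 0 <= p i) -> \sum_i p i = 1 ->
  `|ln (\sum_i p i * expR (y i)) - \sum_i p i * y i -
    (\sum_i \sum_j p i * p j * (y i - y j) ^+ 2) / 4| <=
  136 * \sum_i `|y i| ^+ 3.
Proof.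
move=> p0 p1.
have [i0] : exists i : I, true.
  apply/existsP; apply: contraT => /existsPn h.
  by move: p1; rewrite big1 => [/esym/eqP|i _]; [rewrite oner_eq0|have := h i].
move=> _.
pose k := [arg max_(i > i0) `|y i|]%O.
have kmax i : `|y i| <= `|y k|.
  by rewrite /k; case: arg_maxP => // j _; apply.
have -> : (\sum_i \sum_j p i * p j * (y i - y j) ^+ 2) / 4 =
   (\sum_i p i * y i ^+ 2 - (\sum_i p i * y i) ^+ 2) / 2.
  have E i : \sum_j p i * p j * (y i - y j) ^+ 2 =
     p i * y i ^+ 2 - 2 * (p i * y i) * (\sum_j p j * y j) +
     p i * \sum_j p j * y j ^+ 2.
    transitivity (\sum_j (p i * y i ^+ 2 * p j - 2 * (p i * y i) * (p j * y j) +
       p i * (p j * y j ^+ 2))).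
      by apply: eq_bigr => j _; ring.
    by rewrite big_split/= sumrB -!mulr_sumr p1 mulr1.
  rewrite (eq_bigr _ (fun i _ => E i)) big_split/= sumrB -!mulr_suml p1 mul1r.
  by rewrite -mulr_sumr; field.
apply: (le_trans (ln_wsum_expR_taylor_max p0 p1 kmax)).
by rewrite ler_wpM2l// (bigD1 k)//= lerDl sumr_ge0.
Qed.

Lemma lse_gt0 x (i0 : I) : 0 < \sum_i expR (x i).
Proof.
rewrite (bigD1 i0)//= ltr_pwDl ?expR_gt0// sumr_ge0// => i _; exact: expR_ge0.
Qed.

Lemma le_lse x i : x i <= lse x.
Proof.
rewrite /lse -[leLHS]expRK ler_ln ?posrE ?expR_gt0//; last exact: lse_gt0 i.
by rewrite (bigD1 i)//= lerDl sumr_ge0// => j _; exact: expR_ge0.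
Qed.

Lemma lse_le x (M : R) (i0 : I) : (forall i, x i <= M) -> lse x <= ln #|I|%:R + M.
Proof.
move=> xM; have I0 : 0 < #|I|%:R :> R by rewrite ltr0n; apply/card_gt0P; exists i0.
rewrite /lse -[X in _ + X]expRK -lnM ?posrE ?expR_gt0//.
rewrite ler_ln ?posrE ?mulr_gt0 ?expR_gt0//; last exact: lse_gt0 i0.
rewrite mulr_natl -sumr_const; apply: ler_sum => i _.
by rewrite ler_expR.
Qed.

Lemma normr_lse_le x (i0 : I) : `|lse x| <= ln #|I|%:R + \sum_i `|x i|.
Proof.
have h i : `|x i| <= \sum_i `|x i| by rewrite (bigD1 i)//= lerDl sumr_ge0.
have I1 : 1 <= #|I|%:R :> R by rewrite ler1n; apply/card_gt0P; exists i0.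
rewrite ler_norml; apply/andP; split; last first.
  by apply: lse_le => // i; exact: le_trans (ler_norm _) (h i).
apply: le_trans (le_lse x i0).
have := ler_norm (- x i0); rewrite normrN => a; have b := h i0.
by have := ln_ge0 I1; lra.
Qed.

(** Factoring out the exponentials of [x] reduces an expansion of [lse] at any base point to a
    weighted sum whose weights total 1. *)
Lemma lseD x y (i0 : I) : lse (fun i => x i + y i) =
  lse x + ln (\sum_i (expR (x i) / \sum_j expR (x j)) * expR (y i)).
Proof.
have s0 := lse_gt0 x i0.
rewrite /lse -lnM ?posrE//; last first.
  rewrite (bigD1 i0)//= ltr_pwDl// ?sumr_ge0// => [|i _].
    by rewrite mulr_gt0 ?divr_gt0 ?expR_gt0.
  by rewrite mulr_ge0 ?divr_ge0 ?expR_ge0// ltW.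
rewrite mulr_sumr; congr ln; apply: eq_bigr => i _.
by rewrite expRD mulrA mulrCA divff ?mulr1// gt_eqF.
Qed.

End LogSumExp.

Lemma ler_harmonic (R : realType) (a b C : R) :
  (forall n : nat, a <= b + C * n.+1%:R^-1) -> a <= b.
Proof.
move=> h.
have cv : b + C * n.+1%:R^-1 @[n --> \oo] --> b.
  rewrite -[X in _ --> X]addr0; apply: cvgD; first exact: cvg_cst.
  by rewrite -(mulr0 C); apply: cvgM; [exact: cvg_cst|exact: cvg_harmonic].
by apply: (ler_cvg_to (cvg_cst a) cv); exact: nearW.
Qed.

(** * Moments of a variable known only through its cosine transform *)

Section CosLaw.
Context d (T : measurableType d) (R : realType) (P : probability T R).
Variables (S : T -> R) (v : R).
Hypothesis mS : measurable_fun setT S.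
Hypothesis cosS : forall c t,
  \int[P]_w cos (c + t * S w) = cos c * expR (- (t ^+ 2 * v / 2)).
Notation N := (normal_prob (0 : R) 1).

(** A cosine integral is at most 1, so exp(-v/2) <= 1 at t = 1; thus [v] has a genuine square
    root. *)
Lemma cos_law_ge0 : 0 <= v.
Proof.
have := cosS 0 1; rewrite cos0 mul1r expr1n mul1r => h.
have : expR (- (v / 2)) <= 1.
  rewrite -h; apply: le_trans (ler_norm _) _.
  apply: (@normr_Rintegral_le _ _ _ P) => [|w]; last exact: normr_cos_le1.
  apply: measurable_cos_comp; apply: measurable_funD => //; exact: measurable_funM.
by rewrite -[leRHS]expR0 ler_expR; lra.
Qed.

Let sv := Num.sqrt v.
Let sv2 : sv ^+ 2 = v. Proof. by rewrite sqr_sqrtr// cos_law_ge0. Qed.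
Let msv : measurable_fun setT (fun x : R => sv * x).
Proof. exact: measurable_funM. Qed.

(** The reference variable is a multiple of a standard normal one rather than a normal law of
    deviation [sv], so the degenerate case v = 0 needs no separate treatment. *)
Let cosN c t : \int[N]_x cos (c + t * (sv * x)) = \int[P]_w cos (c + t * S w).
Proof.
rewrite cosS -sv2; have := @Rintegral_normal_cos R 0 1 (oner_neq0 _) c (t * sv).
rewrite expr1n mul1r exprMn => <-.
by apply: eq_Rintegral => x _; rewrite subr0 mulrA.
Qed.

Let intN (f : R -> R) (C : R) : measurable_fun setT f ->
  (forall x, `|f x| <= C * (1 + x ^+ 4)) ->
  N.-integrable setT (EFin \o (fun x => f (sv * x))).
Proof.
move=> mf fC.
have C0 : 0 <= C by have := fC 0; rewrite expr0n/= addr0 mulr1; exact: le_trans.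
apply: (@integrable_poly_normal _ _ _ (oner_neq0 _) _ (C * (1 + v ^+ 2))).
  exact: measurableT_comp.
move=> x; apply: (le_trans (fC _)); rewrite -mulrA ler_wpM2l//.
rewrite exprMn (exprM sv 2 2) sv2 subr0.
by have := sqr_ge0 v; have : 0 <= x ^+ 4 by [rewrite (exprM _ 2 2) sqr_ge0]; nra.
Qed.

Lemma cos_law_integrable (f : R -> R) (C : R) : measurable_fun setT f ->
  (forall x, `|f x| <= C * (1 + x ^+ 4)) ->
  P.-integrable setT (EFin \o (fun w => f (S w))).
Proof.
move=> mf fC.
exact: (@law_integrable _ _ _ N _ _ P _ S msv mS cosN f mf (intN mf fC)).
Qed.

Let cos_law_Rintegral (f : R -> R) (C : R) : measurable_fun setT f ->
  (forall x, `|f x| <= C * (1 + x ^+ 4)) ->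
  \int[P]_w f (S w) = \int[N]_x f (sv * x).
Proof.
move=> mf fC; apply/esym.
exact: (@Rintegral_law _ _ _ N _ _ P _ S msv mS cosN f mf (intN mf fC)).
Qed.

Let poly1 (x : R) : `|x| <= 1 * (1 + x ^+ 4).
Proof.
rewrite mul1r -(ger0_norm (_ : 0 <= x ^+ 4)); last by rewrite (exprM _ 2 2) sqr_ge0.
rewrite normrX; set u := `|x|; have u0 : 0 <= u by exact: normr_ge0.
have a := sqr_ge0 (u - 1); have b := sqr_ge0 (u ^+ 2 - 1).
have -> : u ^+ 4 = (u ^+ 2) ^+ 2 by ring.
move: a b; rewrite !expr2; nra.
Qed.

Let poly2 (x : R) : `|x ^+ 2| <= 1 * (1 + x ^+ 4).
Proof.
rewrite mul1r ger0_norm ?sqr_ge0// (exprM _ 2 2).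
by have := sqr_ge0 (x ^+ 2 - 1); rewrite !expr2; nra.
Qed.

Let poly3 (x : R) : `| `|x| ^+ 3| <= 1 * (1 + x ^+ 4).
Proof.
rewrite mul1r normrX normr_id -(ger0_norm (_ : 0 <= x ^+ 4)); last first.
  by rewrite (exprM _ 2 2) sqr_ge0.
rewrite normrX; set u := `|x|; have u0 : 0 <= u by exact: normr_ge0.
have a := sqr_ge0 (u - 1); have b := sqr_ge0 (u ^+ 2 - u).
have -> : u ^+ 4 = (u ^+ 2) ^+ 2 by ring.
have -> : u ^+ 3 = u ^+ 2 * u by ring.
move: a b; rewrite !expr2; nra.
Qed.

Lemma cos_law_integrable1 : P.-integrable setT (EFin \o S).
Proof. exact: (@cos_law_integrable (fun x => x) 1 (@measurable_id _ _ _) poly1). Qed.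

Lemma cos_law_integrable2 : P.-integrable setT (EFin \o (fun w => S w ^+ 2)).
Proof.
apply: (@cos_law_integrable (fun x => x ^+ 2) 1 _ poly2).
exact: measurable_funX.
Qed.

Lemma cos_law_integrable3 : P.-integrable setT (EFin \o (fun w => `|S w| ^+ 3)).
Proof.
apply: (@cos_law_integrable (fun x => `|x| ^+ 3) 1 _ poly3).
by apply: measurable_funX; exact: (measurableT_comp (@normr_measurable R setT) (@measurable_id _ _ setT)).
Qed.

Lemma cos_law_mean : \int[P]_w S w = 0.
Proof.
rewrite (@cos_law_Rintegral (fun x => x) 1 (@measurable_id _ _ _) poly1).
have := @Rintegral_normal_mean R 0 1 (oner_neq0 _) => h.
rewrite RintegralZl//.
  rewrite (_ : \int[N]_x x = 0) ?mulr0// -[RHS]h.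
  by apply: eq_Rintegral => x _; rewrite subr0.
have := @integrable_normal_sub R 0 1 (oner_neq0 _).
by apply: eq_integrable => // x _ /=; rewrite subr0.
Qed.

Lemma cos_law_variance : \int[P]_w (S w ^+ 2) = v.
Proof.
rewrite (@cos_law_Rintegral (fun x => x ^+ 2) 1 _ poly2); last exact: measurable_funX.
have := @Rintegral_normal_variance R 0 1 (oner_neq0 _) => h.
under eq_Rintegral do rewrite exprMn sv2.
rewrite RintegralZl//.
  rewrite (_ : \int[N]_x (x ^+ 2) = 1) ?mulr1// -[RHS](expr1n _ 2) -[RHS]h.
  by apply: eq_Rintegral => x _; rewrite subr0.
apply: (@integrable_poly_normal _ _ _ (oner_neq0 _) _ 1).
  exact: measurable_funX.
by move=> x; rewrite subr0; exact: poly2.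
Qed.

End CosLaw.

(** * The Sudakov-Fernique inequality *)

Section QuadraticForm.
Context (R : realType) (I : finType).
Implicit Types (K L : I -> I -> R) (th : I -> R).

Definition qform K th : R := \sum_i \sum_j th i * th j * K i j.

Lemma qformZ K th t : qform K (fun i => t * th i) = t ^+ 2 * qform K th.
Proof.
rewrite mulr_sumr; apply: eq_bigr => i _; rewrite mulr_sumr.
by apply: eq_bigr => j _; ring.
Qed.

Lemma qformD K L a b th :
  qform (fun i j => a * K i j + b * L i j) th = a * qform K th + b * qform L th.
Proof.
rewrite !mulr_sumr -big_split; apply: eq_bigr => i _.
by rewrite !mulr_sumr -big_split; apply: eq_bigr => j _ /=; ring.
Qed.

Lemma sum_delta (f : I -> R) k : \sum_i (i == k)%:R * f i = f k.
Proof.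
by rewrite (bigD1 k)//= eqxx mul1r big1 ?addr0// => i /negPf ->; rewrite mul0r.
Qed.

Lemma qform_delta K k : qform K (fun i => (i == k)%:R) = K k k.
Proof.
rewrite /qform -[RHS](sum_delta (fun i => K i k)); apply: eq_bigr => i _.
rewrite -(sum_delta (fun j => (i == k)%:R * K i j)).
by apply: eq_bigr => j _; ring.
Qed.

Definition incr_var K k l := K k k + K l l - K k l - K l k.

Lemma qform_deltaB K k l :
  qform K (fun i => (i == k)%:R - (i == l)%:R) = incr_var K k l.
Proof.
have E a b : \sum_i \sum_j (i == a)%:R * (j == b)%:R * K i j = K a b.
  rewrite -[RHS](sum_delta (fun i => K i b)); apply: eq_bigr => i _.
  rewrite -(sum_delta (fun j => (i == a)%:R * K i j)).
  by apply: eq_bigr => j _; ring.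
rewrite /incr_var -(E k k) -(E l l) -(E k l) -(E l k) -!sumrN -!big_split.
apply: eq_bigr => i _; rewrite -!sumrN -!big_split.
by apply: eq_bigr => j _ /=; ring.
Qed.

End QuadraticForm.

(* Gaussian vectors are handled through their characteristic function; the
   phase [c] makes one real identity carry both its real and imaginary part. *)
Definition gaussian_cf d (T : measurableType d) (R : realType)
    (P : probability T R) (I : finType) (X : I -> T -> R) (K : I -> I -> R) :=
  (forall i, measurable_fun setT (X i)) /\
  forall c th, \int[P]_w cos (c + \sum_i th i * X i w) =
    cos c * expR (- (qform K th / 2)).

(** The gradient of [lse] at [W]. *)
Definition gibbs (R : realType) (I : finType) (W : I -> R) (i : I) : R :=
  expR (W i) / \sum_j expR (W j).

Section GaussianCf.
Context d (T : measurableType d) (R : realType) (P : probability T R).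
Variables (I : finType) (X : I -> T -> R) (K : I -> I -> R).
Hypothesis gX : gaussian_cf P X K.

Let mX i : measurable_fun setT (X i). Proof. exact: gX.1. Qed.

Lemma gaussian_cf_linear th c t :
  \int[P]_w cos (c + t * \sum_i th i * X i w) =
  cos c * expR (- (t ^+ 2 * qform K th / 2)).
Proof.
rewrite -qformZ -gX.2; apply: eq_Rintegral => w _; rewrite mulr_sumr.
by congr (cos (_ + _)); apply: eq_bigr => i _; rewrite mulrA.
Qed.

Lemma measurable_linear th : measurable_fun setT (fun w => \sum_i th i * X i w).
Proof. by apply: measurable_sum => i; exact: measurable_funM. Qed.

Let cf1 k c t : \int[P]_w cos (c + t * X k w) =
  cos c * expR (- (t ^+ 2 * K k k / 2)).
Proof.
rewrite -qform_delta -gaussian_cf_linear; apply: eq_Rintegral => w _.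
by rewrite sum_delta.
Qed.

Let cf2 k l c t : \int[P]_w cos (c + t * (X k w - X l w)) =
  cos c * expR (- (t ^+ 2 * incr_var K k l / 2)).
Proof.
rewrite -qform_deltaB -gaussian_cf_linear; apply: eq_Rintegral => w _.
congr (cos (_ + _ * _)).
rewrite -(sum_delta (X^~ w) k) -(sum_delta (X^~ w) l) -sumrB.
by apply: eq_bigr => i _; rewrite mulrBl.
Qed.

Lemma gaussian_cf_integrable i : P.-integrable setT (EFin \o X i).
Proof. exact: cos_law_integrable1 (mX i) (cf1 i). Qed.

Lemma gaussian_cf_integrable3 i : P.-integrable setT (EFin \o (fun w => `|X i w| ^+ 3)).
Proof. exact: cos_law_integrable3 (mX i) (cf1 i). Qed.

Lemma gaussian_cf_mean i : \int[P]_w X i w = 0.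
Proof. exact: cos_law_mean (mX i) (cf1 i). Qed.

Let mXB i j : measurable_fun setT (fun w => X i w - X j w).
Proof. exact: measurable_funB. Qed.

Lemma gaussian_cf_integrable_incr i j :
  P.-integrable setT (EFin \o (fun w => (X i w - X j w) ^+ 2)).
Proof. exact: (cos_law_integrable2 (mXB i j) (cf2 i j)). Qed.

Lemma gaussian_cf_incr i j : \int[P]_w ((X i w - X j w) ^+ 2) = incr_var K i j.
Proof. exact: (cos_law_variance (mXB i j) (cf2 i j)). Qed.

Lemma gaussian_cf_integrable_lse (y : I -> R) (a : R) : (0 < #|I|)%N ->
  P.-integrable setT (EFin \o (fun w => lse (fun i => y i + a * X i w))).
Proof.
move=> /card_gt0P[i0 _].
apply: (@integrable_le _ _ _ P _ (fun w => (ln #|I|%:R + \sum_i `|y i|) +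
   \sum_i `|a| * `|X i w|)).
- apply: measurableT_comp; first exact: measurable_ln.
  apply: measurable_sum => i; apply: measurableT_comp => //.
  by apply: measurable_funD => //; exact: measurable_funM.
- move=> w; apply: (le_trans (normr_lse_le _ i0)).
  rewrite -addrA lerD2l -big_split/=; apply: ler_sum => i _.
  by rewrite -normrM ler_normD.
- apply: integrable_addR.
    exact: (finite_measure_integrable_cst P _ measurableT).
  apply: integrable_sumR => i; apply: integrable_scaleR.
  exact: (integrable_abse (gaussian_cf_integrable i)).
Qed.

Lemma gaussian_cf_ext L : (forall i j, K i j = L i j) -> gaussian_cf P X L.
Proof.
move=> KL; split=> [|c th]; first exact: gX.1.
suff -> : qform L th = qform K th by exact: gX.2.
by apply: eq_bigr => i _; apply: eq_bigr => j _; rewrite KL.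
Qed.

(** The pointwise expansion is integrated: the linear term has mean zero, the squared differences
    become [incr_var], and scaling by sqrt h puts h^(3/2) in front of the third moments. *)
Lemma lse_gaussian_taylor (W : I -> R) (h : R) : (0 < #|I|)%N -> 0 <= h ->
  `|\int[P]_w lse (fun i => W i + Num.sqrt h * X i w) - lse W -
    h / 4 * \sum_i \sum_j gibbs W i * gibbs W j * incr_var K i j| <=
  136 * (h * Num.sqrt h) * \sum_i \int[P]_w (`|X i w| ^+ 3).
Proof.
move=> I0 h0; have /card_gt0P[i0 _] := I0.
set p := gibbs W.
have s0 := lse_gt0 W i0.
have p0 i : 0 <= p i by rewrite divr_ge0 ?expR_ge0// ltW.
have p1 : \sum_i p i = 1 by rewrite -mulr_suml divff// gt_eqF.
set sh := Num.sqrt h.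
have sh2 : sh ^+ 2 = h by rewrite sqr_sqrtr.
have sh0 : 0 <= sh by exact: sqrtr_ge0.
pose rem w := lse (fun i => W i + sh * X i w) - lse W -
  \sum_i p i * sh * X i w -
  \sum_i \sum_j (p i * p j * h / 4) * (X i w - X j w) ^+ 2.
have remE w : `|rem w| <= 136 * (h * sh) * \sum_i `|X i w| ^+ 3.
  have := @ln_wsum_expR_taylor R I p (fun i => sh * X i w) p0 p1.
  rewrite /rem (lseD _ _ i0) (addrC (lse W)) addrK.
  have -> : \sum_i p i * (sh * X i w) = \sum_i p i * sh * X i w.
    by apply: eq_bigr => i _; rewrite mulrA.
  have -> : (\sum_i \sum_j p i * p j * (sh * X i w - sh * X j w) ^+ 2) / 4 =
     \sum_i \sum_j (p i * p j * h / 4) * (X i w - X j w) ^+ 2.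
    rewrite mulr_suml; apply: eq_bigr => i _; rewrite mulr_suml.
    by apply: eq_bigr => j _; rewrite -sh2; ring.
  have -> : 136 * (\sum_i `|sh * X i w| ^+ 3) = 136 * (h * sh) * \sum_i `|X i w| ^+ 3.
    rewrite -mulrA; congr (_ * _); rewrite mulr_sumr; apply: eq_bigr => i _.
    by rewrite normrM exprMn (ger0_norm sh0) -sh2; ring.
  exact.
have i1 : P.-integrable setT (EFin \o (fun w => lse (fun i => W i + sh * X i w))).
  exact: gaussian_cf_integrable_lse.
have i2 : P.-integrable setT (EFin \o (fun w => \sum_i p i * sh * X i w)).
  apply: integrable_sumR => i; apply: integrable_scaleR.
  exact: gaussian_cf_integrable.
have i3' i : P.-integrable setT (EFin \o (fun w =>
    \sum_j (p i * p j * h / 4) * (X i w - X j w) ^+ 2)).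
  apply: integrable_sumR => j; apply: integrable_scaleR.
  exact: gaussian_cf_integrable_incr.
have i3 : P.-integrable setT (EFin \o (fun w =>
    \sum_i \sum_j (p i * p j * h / 4) * (X i w - X j w) ^+ 2)).
  exact: integrable_sumR.
have ic : P.-integrable setT (EFin \o cst (lse W)).
  exact: (finite_measure_integrable_cst P _ measurableT).
have ir : P.-integrable setT (EFin \o rem).
  by do 3 (apply: integrable_subR => //).
have E : \int[P]_w rem w = \int[P]_w lse (fun i => W i + sh * X i w) - lse W -
    h / 4 * \sum_i \sum_j p i * p j * incr_var K i j.
  rewrite /rem RintegralB//; last by do 2 (apply: integrable_subR => //).
  rewrite RintegralB//; last by apply: integrable_subR.
  rewrite RintegralB// (Rintegral_prob_cst P (lse W)).
  rewrite Rintegral_sum; last first.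
    by move=> i; apply: integrable_scaleR; exact: gaussian_cf_integrable.
  rewrite [X in _ - _ - X - _]big1 ?subr0; last first.
    move=> i _; rewrite RintegralZl ?gaussian_cf_mean ?mulr0//.
    exact: gaussian_cf_integrable.
  rewrite Rintegral_sum//; congr (_ - _).
  rewrite mulr_sumr; apply: eq_bigr => i _.
  rewrite Rintegral_sum; last first.
    by move=> j; apply: integrable_scaleR; exact: gaussian_cf_integrable_incr.
  rewrite mulr_sumr; apply: eq_bigr => j _.
  rewrite RintegralZl ?gaussian_cf_incr//; first by field.
  exact: gaussian_cf_integrable_incr.
rewrite -E; apply: (le_trans (le_normr_Rintegral _ ir)) => //.
have i4 i : P.-integrable setT (EFin \o (fun w => `|X i w| ^+ 3)).
  exact: gaussian_cf_integrable3.
rewrite -Rintegral_sum// -RintegralZl//; last exact: integrable_sumR.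
apply: le_Rintegral => //; first exact: (integrable_abse ir).
by apply: integrable_scaleR; exact: integrable_sumR.
Qed.

End GaussianCf.

Section GaussianCfProduct.
Context d (T : measurableType d) d' (T' : measurableType d') (R : realType).
Variables (P : probability T R) (Q : probability T' R).
Variables (I : finType) (X : I -> T -> R) (K : I -> I -> R).
Variables (Z : I -> T' -> R) (L : I -> I -> R).
Hypotheses (gX : gaussian_cf P X K) (gZ : gaussian_cf Q Z L).

(** The product measure provides independence. For a fixed first component the [X] part is a
    constant that merges into the phase of the transform of [Z]; this is where the arbitrary phase
    pays off. *)
Lemma gaussian_cf_prod (a b : R) :
  gaussian_cf (P \x Q)%E (fun i (w : T * T') => a * X i w.1 + b * Z i w.2)
    (fun i j => a ^+ 2 * K i j + b ^+ 2 * L i j).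
Proof.
have mXZ i : measurable_fun setT (fun w : T * T' => a * X i w.1 + b * Z i w.2).
  apply: measurable_funD; apply: measurable_funM => //; apply: measurableT_comp => //.
    exact: gX.1.
  exact: gZ.1.
split=> [//|c th].
have mf : measurable_fun setT (fun w : T * T' =>
    cos (c + \sum_i th i * (a * X i w.1 + b * Z i w.2))).
  apply: measurable_cos_comp; apply: measurable_funD => //.
  by apply: measurable_sum => i; exact: measurable_funM.
rewrite (@bounded_Rintegral_prod _ _ _ _ _ P Q _ 1 mf); last first.
  by move=> w; exact: normr_cos_le1.
transitivity (\int[P]_w (expR (- (qform L (fun i => b * th i) / 2)) *
    cos (c + \sum_i (a * th i) * X i w))).
  apply: eq_Rintegral => w _; rewrite mulrC -gZ.2.
  apply: eq_Rintegral => w' _; rewrite -addrA -big_split/=.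
  by congr (cos (_ + _)); apply: eq_bigr => i _; ring.
rewrite RintegralZl//; last first.
  apply: (@integrable_bounded _ _ _ P _ 1) => [|w]; last exact: normr_cos_le1.
  apply: measurable_cos_comp; apply: measurable_funD => //.
  exact: measurable_linear gX _.
by rewrite gX.2 mulrCA -expRD qformD !qformZ; congr (_ * expR _); field.
Qed.

Lemma gaussian_cf_Rintegral_prod (a b : R) : (0 < #|I|)%N ->
  \int[(P \x Q)%E]_w lse (fun i => a * X i w.1 + b * Z i w.2) =
  \int[P]_w \int[Q]_w' lse (fun i => a * X i w + b * Z i w').
Proof.
move=> I0; apply: (@Rintegral_prod1 _ _ _ _ _ P Q
  (fun w => lse (fun i => a * X i w.1 + b * Z i w.2))) => [|w].
  have := gaussian_cf_integrable_lse (gaussian_cf_prod a b) (fun=> 0) 1 I0.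
  apply: eq_integrable => // w _ /=.
  by congr (EFin (lse _)); apply/funext => i; rewrite mul1r add0r.
exact: (gaussian_cf_integrable_lse gZ (fun i => a * X i w) b I0).
Qed.

End GaussianCfProduct.

(** No multidimensional uniqueness theorem is needed: [cos_vector_law] with the functions t exp
    gives the cosine transform of the scalar sum of exponentials, so its one-dimensional law, and ln
    is applied afterwards. *)
Lemma gaussian_cf_lse_eq d (T : measurableType d) d' (T' : measurableType d')
    (R : realType) (P : probability T R) (Q : probability T' R) (I : finType)
    (X : I -> T -> R) (Z : I -> T' -> R) (K L : I -> I -> R) :
  (0 < #|I|)%N -> gaussian_cf P X K -> gaussian_cf Q Z L ->
  (forall i j, K i j = L i j) ->
  \int[P]_w lse (X ^~ w) = \int[Q]_w lse (Z ^~ w).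
Proof.
move=> I0 gX gZ KL; have gX' := gaussian_cf_ext gX KL.
have E c th : \int[P]_w cos (c + \sum_i th i * X i w) =
    \int[Q]_w cos (c + \sum_i th i * Z i w) by rewrite gX'.2 gZ.2.
have mS d0 (T0 : measurableType d0) (V : I -> T0 -> R) :
    (forall i, measurable_fun setT (V i)) ->
    measurable_fun setT (fun w => \sum_i expR (V i w)).
  by move=> mV; apply: measurable_sum => i; exact: measurableT_comp.
have cE c t : \int[P]_w cos (c + t * \sum_i expR (X i w)) =
    \int[Q]_w cos (c + t * \sum_i expR (Z i w)).
  have ch : forall i : I, continuous (fun x : R => t * expR x).
    by move=> _ x; apply: cvgM; [exact: cvg_cst|exact: continuous_expR].
  have := cos_vector_law gX.1 gZ.1 E ch c.
  under eq_Rintegral do rewrite -mulr_sumr.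
  by under [X in _ = X -> _]eq_Rintegral do rewrite -mulr_sumr.
apply: (@Rintegral_law _ _ _ P _ _ Q _ _ (mS _ _ _ gX.1) (mS _ _ _ gZ.1) cE (@ln R)).
  exact: measurable_ln.
have := gaussian_cf_integrable_lse gX (fun=> 0) 1 I0.
apply: eq_integrable => // w _ /=; congr (EFin (ln _)).
by apply: eq_bigr => i _; rewrite mul1r add0r.
Qed.

Lemma telescope_le (R : realType) (u : nat -> R) (C : R) (N : nat) :
  (forall k, (k < N)%N -> u k.+1 <= u k + C) -> u N <= u 0%N + N%:R * C.
Proof.
elim: N => [|N IH] step; first by rewrite mul0r addr0.
apply: (le_trans (step N (ltnSn N))).
have := IH (fun k kN => step k (ltnW kN)).
by rewrite -[N.+1%:R]natr1 mulrDl mul1r addrA lerD2r.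
Qed.

Section SudakovFernique.
Context d (T : measurableType d) d' (T' : measurableType d') (R : realType).
Variables (P : probability T R) (Q : probability T' R).
Variables (I : finType) (X : I -> T -> R) (K : I -> I -> R).
Variables (Z : I -> T' -> R) (L : I -> I -> R).
Hypotheses (gX : gaussian_cf P X K) (gZ : gaussian_cf Q Z L).
Hypothesis I0 : (0 < #|I|)%N.
Hypothesis KL : forall i j, incr_var K i j <= incr_var L i j.

Let m3 := \sum_i \int[P]_w (`|X i w| ^+ 3) + \sum_i \int[Q]_w (`|Z i w| ^+ 3).

(** An exchange at a deterministic base point. The Gibbs weights depend on [W] only, so they are the
    same in both expansions; being nonnegative, they carry [KL] over to the second-order terms. *)
Let lse_step (W : I -> R) (h : R) : 0 <= h ->
  \int[P]_w lse (fun i => W i + Num.sqrt h * X i w) <=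
  \int[Q]_w lse (fun i => W i + Num.sqrt h * Z i w) + 136 * (h * Num.sqrt h) * m3.
Proof.
move=> h0; have h1 := lse_gaussian_taylor gX W I0 h0.
have h2 := lse_gaussian_taylor gZ W I0 h0.
move: h1 h2; set p := gibbs W.
set a := \int[P]_w lse _; set b := \int[Q]_w lse _ => h1 h2.
have le_sum : \sum_i \sum_j p i * p j * incr_var K i j <=
    \sum_i \sum_j p i * p j * incr_var L i j.
  have p0 i : 0 <= p i.
    by rewrite divr_ge0 ?expR_ge0// sumr_ge0// => j _; exact: expR_ge0.
  by apply: ler_sum => i _; apply: ler_sum => j _; rewrite ler_wpM2l// mulr_ge0.
have le_h := ler_wpM2l (divr_ge0 h0 (ler0n R 4)) le_sum.
move: h1 h2; rewrite !ler_norml /m3 mulrDr => /andP[_ h1] /andP[h2 _].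
by move: h1 h2 le_h; set u := h / 4 * _; set v := h / 4 * _; lra.
Qed.

(** The base point is now random and independent of the exchanged portion; the deterministic step is
    integrated over it. The factor [1 *] matches the shape of [gaussian_cf_prod]. *)
Let prod_step d0 (T0 : measurableType d0) (P0 : probability T0 R)
    (W : I -> T0 -> R) (A : I -> I -> R) (h : R) : gaussian_cf P0 W A -> 0 <= h ->
  \int[(P0 \x P)%E]_w lse (fun i => 1 * W i w.1 + Num.sqrt h * X i w.2) <=
  \int[(P0 \x Q)%E]_w lse (fun i => 1 * W i w.1 + Num.sqrt h * Z i w.2) +
    136 * (h * Num.sqrt h) * m3.
Proof.
move=> gW h0.
rewrite (gaussian_cf_Rintegral_prod gW gX)// (gaussian_cf_Rintegral_prod gW gZ)//.
set C := 136 * _ * _.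
have int d1 (T1 : measurableType d1) (P1 : probability T1 R) V B :
    gaussian_cf P1 V B -> P0.-integrable setT (EFin \o (fun w =>
      \int[P1]_w' lse (fun i => 1 * W i w + Num.sqrt h * V i w'))).
  move=> gV.
  apply: (@integrable_Rintegral1 _ _ _ _ _ P0 P1
    (fun w => lse (fun i => 1 * W i w.1 + Num.sqrt h * V i w.2))) => [|w].
    have := gaussian_cf_integrable_lse (gaussian_cf_prod gW gV 1 (Num.sqrt h)) (fun=> 0) 1 I0.
    apply: eq_integrable => // w _ /=.
    by congr (EFin (lse _)); apply/funext => i; rewrite mul1r add0r.
  exact: (gaussian_cf_integrable_lse gV (fun i => 1 * W i w) (Num.sqrt h) I0).
have ic : P0.-integrable setT (EFin \o cst C).
  exact: (finite_measure_integrable_cst P0 _ measurableT).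
rewrite -(Rintegral_prob_cst P0 C) -RintegralD//; last exact: int gZ.
apply: le_Rintegral => //.
- exact: int gX.
- by apply: (@integrable_addR _ _ _ P0 _ (cst C)) => //; exact: int gZ.
- by move=> w _; exact: lse_step.
Qed.

Let interp (t : R) := \int[(P \x Q)%E]_w
  lse (fun i => Num.sqrt t * X i w.1 + Num.sqrt (1 - t) * Z i w.2).

(** Put W = sqrt t X + sqrt (1 - (t + h)) Z. In law, the family at t + h is W plus an independent
    sqrt h X, and the family at t is W plus an independent sqrt h Z; they differ by one exchange. *)
Let interp_step (t h : R) : 0 <= t -> 0 <= h -> t + h <= 1 ->
  interp (t + h) <= interp t + 136 * (h * Num.sqrt h) * m3.
Proof.
move=> t0 h0 th1.
have gW := gaussian_cf_prod gX gZ (Num.sqrt t) (Num.sqrt (1 - (t + h))).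
have := prod_step gW h0.
have gWX := gaussian_cf_prod gW gX 1 (Num.sqrt h).
have gWZ := gaussian_cf_prod gW gZ 1 (Num.sqrt h).
have gt s := gaussian_cf_prod gX gZ (Num.sqrt s) (Num.sqrt (1 - s)).
rewrite (gaussian_cf_lse_eq I0 gWX (gt (t + h))); last first.
  move=> i j; rewrite expr1n !sqr_sqrtr//; [ring|lra|lra].
rewrite (gaussian_cf_lse_eq I0 gWZ (gt t))//.
move=> i j; rewrite expr1n !sqr_sqrtr//; [ring|lra|lra].
Qed.

Lemma sudakov_fernique_lse :
  \int[P]_w lse (X ^~ w) <= \int[Q]_w lse (Z ^~ w).
Proof.
have -> : \int[P]_w lse (X ^~ w) = interp 1.
  apply: (gaussian_cf_lse_eq I0 gX (gaussian_cf_prod gX gZ _ _)) => i j.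
  by rewrite subrr sqrtr0 sqrtr1 expr1n expr0n/= mul0r mul1r addr0.
have -> : \int[Q]_w lse (Z ^~ w) = interp 0.
  apply: (gaussian_cf_lse_eq I0 gZ (gaussian_cf_prod gX gZ _ _)) => i j.
  by rewrite subr0 sqrtr0 sqrtr1 expr1n expr0n/= mul0r mul1r add0r.
apply: (@ler_harmonic _ _ _ (136 * m3)) => n.
set m := n.+1%:R : R; have m0 : 0 < m by rewrite ltr0n.
(* There are m^2 steps of size m^-2, each with an error proportional to h sqrt h = m^-3, so the
   total error is of order m^-1. *)
pose h := m^-1 ^+ 2.
have sh : Num.sqrt h = m^-1 by rewrite sqrtr_sqr gtr0_norm ?invr_gt0.
have h0 : 0 <= h by exact: sqr_ge0.
have hN : (n.+1 * n.+1)%:R * h = 1 by rewrite natrM -/m /h; field; rewrite gt_eqF.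
have step k : (k < n.+1 * n.+1)%N ->
    interp (k.+1%:R * h) <= interp (k%:R * h) + 136 * (h * m^-1) * m3.
  move=> kn; have kn1 : k%:R * h + h <= 1.
    rewrite -[leRHS]hN; have -> : k%:R * h + h = k.+1%:R * h by rewrite -natr1; ring.
    by apply: ler_wpM2r => //; rewrite ler_nat.
  have := interp_step (mulr_ge0 (ler0n _ k) h0) h0 kn1; rewrite sh.
  suff -> : k%:R * h + h = k.+1%:R * h by [].
  by rewrite -natr1; ring.
have := telescope_le (u := fun k => interp (k%:R * h)) step.
rewrite mul0r hN => /le_trans; apply.
suff -> : (n.+1 * n.+1)%:R * (136 * (h * m^-1) * m3) = 136 * m3 * m^-1 by [].
transitivity (((n.+1 * n.+1)%:R * h) * (136 * m3 * m^-1)); first by ring.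
by rewrite hN mul1r.
Qed.

End SudakovFernique.

Lemma gaussian_cf_scale d (T : measurableType d) (R : realType)
    (P : probability T R) (I : finType) (X : I -> T -> R) (K : I -> I -> R) (a : R) :
  gaussian_cf P X K ->
  gaussian_cf P (fun i w => a * X i w) (fun i j => a ^+ 2 * K i j).
Proof.
move=> gX; split=> [i|c th]; first by apply: measurable_funM => //; exact: gX.1.
have := gX.2 c (fun i => a * th i).
rewrite qformZ => h.
rewrite (_ : qform _ th = a ^+ 2 * qform K th); last first.
  rewrite mulr_sumr; apply: eq_bigr => i _; rewrite mulr_sumr.
  by apply: eq_bigr => j _; ring.
rewrite -h; apply: eq_Rintegral => w _.
by congr (cos (_ + _)); apply: eq_bigr => i _; ring.
Qed.

Lemma sudakov_fernique d (T : measurableType d) d' (T' : measurableType d')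
    (R : realType) (P : probability T R) (Q : probability T' R)
    (I : finType) (X : I -> T -> R) (K : I -> I -> R)
    (Z : I -> T' -> R) (L : I -> I -> R) (f : T -> R) (g : T' -> R) :
  gaussian_cf P X K -> gaussian_cf Q Z L ->
  (forall i j, incr_var K i j <= incr_var L i j) ->
  P.-integrable setT (EFin \o f) -> Q.-integrable setT (EFin \o g) ->
  (forall w, exists i, f w <= X i w) -> (forall w i, Z i w <= g w) ->
  \int[P]_w f w <= \int[Q]_w g w.
Proof.
(* [fX] yields an index only at a sample point; the sample space is nonempty because its probability
   is 1. *)
move=> gX gZ KL intf intg fX Zg.
have [T0|noT] := pselect (exists w : T, True); last first.
  have : P setT = 0%E.
    rewrite (_ : setT = set0) ?measure0//.
    by apply/seteqP; split => // w _; apply: noT; exists w.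
  by rewrite probability_setT => /eqP; rewrite onee_eq0.
have I0 : (0 < #|I|)%N.
  by case: T0 => w _; have [i _] := fX w; apply/card_gt0P; exists i.
have /card_gt0P[i0 _] := I0.
apply: (@ler_harmonic _ _ _ (ln #|I|%:R)) => n.
(* Both families are magnified by [a]: log-sum-exp exceeds the maximum by at most ln |I|, which
   becomes ln |I| / a after dividing back. *)
set a := n.+1%:R : R; have a0 : 0 < a by rewrite ltr0n.
have aKL i j : incr_var (fun i j => a ^+ 2 * K i j) i j <=
    incr_var (fun i j => a ^+ 2 * L i j) i j.
  have E (A : I -> I -> R) : incr_var (fun i j => a ^+ 2 * A i j) i j =
    a ^+ 2 * incr_var A i j by rewrite /incr_var; ring.
  by rewrite !E ler_wpM2l// sqr_ge0.
have sf := sudakov_fernique_lse (gaussian_cf_scale a gX) (gaussian_cf_scale a gZ) I0 aKL.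
have ilse d0 (T0' : measurableType d0) (P0 : probability T0' R) V B :
    gaussian_cf P0 V B ->
    P0.-integrable setT (EFin \o (fun w => lse (fun i : I => a * V i w))).
  move=> gV; have := gaussian_cf_integrable_lse gV (fun=> 0) a I0.
  apply: eq_integrable => // w _ /=.
  by congr (EFin (lse _)); apply/funext => i; rewrite add0r.
have h1 : a * \int[P]_w f w <= \int[P]_w lse (fun i => a * X i w).
  rewrite -RintegralZl//; apply: le_Rintegral => //.
  - exact: integrable_scaleR.
  - exact: ilse gX.
  - move=> w _; have [i fi] := fX w.
    by apply: le_trans (le_lse (fun i => a * X i w) i); rewrite ler_wpM2l// ltW.
have h2 : \int[Q]_w lse (fun i => a * Z i w) <= ln #|I|%:R + a * \int[Q]_w g w.
  have ic : Q.-integrable setT (EFin \o cst (ln #|I|%:R : R)).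
    exact: (finite_measure_integrable_cst Q _ measurableT).
  rewrite -RintegralZl// -[X in X + _](Rintegral_prob_cst Q) -RintegralD//; last first.
    exact: integrable_scaleR.
  apply: le_Rintegral => //.
  - exact: ilse gZ.
  - by apply: (@integrable_addR _ _ _ Q (cst _)) => //; exact: integrable_scaleR.
  - by move=> w _; apply: lse_le => // i; rewrite ler_wpM2l// ltW.
have h := le_trans h1 (le_trans sf h2).
rewrite -(ler_pM2l a0) mulrDr; apply: (le_trans h).
by rewrite addrC mulrCA divff ?gt_eqF// mulr1.
Qed.

(** * Gaussian families *)

Section Decoupling.
Import HBNNSimple.
Context d (T : measurableType d) (R : realType) (P : probability T R).
Variables (W X : T -> R) (M a : R).
Hypotheses (mW : measurable_fun setT W) (mX : measurable_fun setT X).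
Hypothesis WM : forall w, `|W w| <= M.
Hypothesis WX : forall A : set R, measurable A ->
  \int[P]_w (W w * \1_A (X w)) = a * \int[P]_w (\1_A (X w)).

Let mI (A : set R) : measurable A -> measurable_fun setT (fun w => \1_A (X w) : R).
Proof. by move=> mA; exact: measurableT_comp. Qed.

Let I1 (A : set R) (x : R) : `|\1_A x : R| <= 1.
Proof. by rewrite indicE; case: (_ \in _); rewrite ?normr1 ?normr0. Qed.

(** The hypothesis on indicators extends by linearity to simple functions, and to [k] by increasing
    approximation with dominated convergence. *)
Lemma decoupling_ge0 (k : R -> R) (C : R) : measurable_fun setT k ->
  (forall x, 0 <= k x <= C) ->
  \int[P]_w (W w * k (X w)) = a * \int[P]_w k (X w).
Proof.
move=> mk k0C.
have k0 x : 0 <= k x by case/andP: (k0C x).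
have kC x : k x <= C by case/andP: (k0C x).
have mkE : measurable_fun setT (EFin \o k) by exact: measurable_EFin.
pose h n : {nnsfun R >-> R} := nnsfun_approx measurableT mkE n.
have hk (x : R) : h n x @[n --> \oo] --> k x.
  have k0E : forall x, setT x -> (0 <= (EFin \o k) x)%E by move=> y _; rewrite lee_fin.
  have := @cvg_nnsfun_approx _ _ _ _ measurableT _ mkE k0E x Logic.I.
  by move=> /fine_cvgP[_].
have h_le n x : h n x <= k x.
  have := @nondecreasing_cvgn_le R (fun n => h n x).
  have nd : nondecreasing_seq (fun n => h n x : R).
    by move=> i j ij; have /lefP := nd_nnsfun_approx measurableT mkE ij; exact.
  move=> /(_ nd) => H; rewrite -(cvg_lim _ (hk x))//; apply: H.
  by apply/cvg_ex; exists (k x); exact: hk.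
have h_bd n x : `|h n x| <= C by rewrite ger0_norm// (le_trans (h_le n x)).
have mh n : measurable_fun setT (fun w => h n (X w)) by exact: measurableT_comp.
have hE n : \int[P]_w (W w * h n (X w)) = a * \int[P]_w h n (X w).
  under eq_Rintegral do rewrite fimfunEord mulr_sumr.
  under [in RHS]eq_Rintegral do rewrite fimfunEord.
  set s := fset_set _.
  have mA y : measurable (h n @^-1` [set y]) by exact: measurable_sfunP.
  have i1 y : P.-integrable setT (EFin \o (fun w => \1_(h n @^-1` [set y]) (X w) : R)).
    by apply: (@integrable_bounded _ _ _ P _ 1) => //; exact: mI.
  have i2 y : P.-integrable setT (EFin \o (fun w => W w * \1_(h n @^-1` [set y]) (X w))).
    apply: (@integrable_bounded _ _ _ P _ M) => [|w].
      by apply: measurable_funM => //; exact: mI.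
    by rewrite normrM -[M]mulr1; apply: ler_pM.
  rewrite Rintegral_sum; last first.
    move=> i; have := integrable_scaleR (nth 0 (finmap.enum_fset s) i) (i2 (nth 0 (finmap.enum_fset s) i)).
    by apply: eq_integrable => // w _ /=; rewrite mulrCA.
  rewrite Rintegral_sum; last by move=> i; exact: integrable_scaleR.
  rewrite mulr_sumr; apply: eq_bigr => i _.
  rewrite RintegralZl// mulrCA -WX// -RintegralZl//.
  by apply: eq_Rintegral => w _; rewrite mulrCA.
have [||||_ cv1] := @Rdominated_cvg _ _ _ P (fun n w => W w * h n (X w))
  (fun w => W w * k (X w)) (cst (M * C)).
- by move=> n; exact: measurable_funM.
- by move=> w; apply: cvgM; [exact: cvg_cst|exact: hk].
- exact: (finite_measure_integrable_cst P _ measurableT).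
- by move=> n w; rewrite normrM; apply: ler_pM.
have [||||_ cv2] := @Rdominated_cvg _ _ _ P (fun n w => h n (X w))
  (fun w => k (X w)) (cst C).
- by [].
- by move=> w; exact: hk.
- exact: (finite_measure_integrable_cst P _ measurableT).
- by move=> n w; exact: h_bd.
apply: (cvg_unique _ cv1) => //.
rewrite (funext hE); apply: cvgM; first exact: cvg_cst.
exact: cv2.
Qed.

(** The nonnegative case is applied to 1 + k and to the constant 1, and the two identities are
    subtracted. *)
Lemma decoupling (k : R -> R) : measurable_fun setT k -> (forall x, `|k x| <= 1) ->
  \int[P]_w (W w * k (X w)) = a * \int[P]_w k (X w).
Proof.
move=> mk k1.
have k02 (x : R) : 0 <= 1 + k x <= 2 by have := k1 x; rewrite ler_norml; lra.
have c02 (x : R) : 0 <= (1 : R) <= 2 by lra.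
have e1 := decoupling_ge0 (measurable_funD (@measurable_cst _ _ _ _ setT (1 : R)) mk) k02.
have e2 := decoupling_ge0 (@measurable_cst _ _ _ _ setT (1 : R)) c02.
have iW : P.-integrable setT (EFin \o (fun w => W w * 1)).
  apply: (@integrable_bounded _ _ _ P _ M) => [|w]; last by rewrite mulr1.
  exact: measurable_funM.
have mkX : measurable_fun setT (fun w => k (X w)) by exact: measurableT_comp.
have ik : P.-integrable setT (EFin \o (fun w => k (X w))).
  exact: (@integrable_bounded _ _ _ P _ 1).
have iWk : P.-integrable setT (EFin \o (fun w => W w * k (X w))).
  apply: (@integrable_bounded _ _ _ P _ M) => [|w]; first exact: measurable_funM.
  by rewrite normrM -[M]mulr1; apply: ler_pM.
have i1 : P.-integrable setT (EFin \o cst (1 : R)).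
  exact: (finite_measure_integrable_cst P _ measurableT).
move: e1; under eq_Rintegral do rewrite mulrDr.
rewrite RintegralD//.
have -> : \int[P]_x (1 + k (X x)) = \int[P]_x (cst 1 x) + \int[P]_x k (X x).
  by rewrite -RintegralD.
by rewrite mulrDr e2 => /addrI.
Qed.

End Decoupling.

Section IndependentGaussians.
Context d (T : measurableType d) (R : realType) (P : probability T R).
Variables (I : finType) (D : {set I}) (X : I -> {RV P >-> R}).
Hypotheses (indX : independent_RVs D X) (gX : forall i, standard_gaussian (X i)).

Let mX i : measurable_fun setT (X i). Proof. exact: measurable_funPT. Qed.

Lemma standard_gaussian_Rintegral i (f : R -> R) : measurable_fun setT f ->
  (forall x, `|f x| <= 1) ->
  \int[P]_w f (X i w) = \int[normal_prob 0 1]_x f x.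
Proof.
move=> mf f1.
pose N := normal_prob (0 : R) 1.
apply: (@same_law_Rintegral _ _ _ P _ _ N (X i) (fun x => x) (mX i) _ _ f mf) => [|A mA|].
- exact: (@measurable_id _ (measurableTypeR R) setT).
- exact: gX.
- apply: (@integrable_bounded _ _ _ P (fun w => f (X i w)) 1) => //.
  exact: measurableT_comp.
Qed.

Let cos_int i c t : \int[P]_w cos (c + t * X i w) = cos c * expR (- (t ^+ 2 / 2)).
Proof.
rewrite (@standard_gaussian_Rintegral i (fun x => cos (c + t * x))); last 2 first.
- by apply: measurable_cos_comp; apply: measurable_funD => //; exact: measurable_funM.
- by move=> x; exact: normr_cos_le1.
have := @Rintegral_normal_cos R 0 1 (oner_neq0 _) c t; rewrite expr1n mul1r => <-.
by apply: eq_Rintegral => x _; rewrite subr0.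
Qed.

Let event (J : {set I}) (A : I -> set R) : set T :=
  \bigcap_(i in [set` J]) (X i @^-1` A i).

Let mevent J A : (forall i, measurable (A i)) -> measurable (event J A).
Proof.
move=> mA; apply: fin_bigcap_measurable => [|i _]; first exact: finite_finset.
by rewrite -[X in measurable X]setTI; exact: mX.
Qed.

Let fine_event (J : {set I}) (A : I -> set R) : J \subset D -> (forall i, measurable (A i)) ->
  fine (P (event J A)) = \prod_(i in J) fine (P (X i @^-1` A i)).
Proof.
move=> JD mA; rewrite /event indX//.
have fin i : P (X i @^-1` A i) \is a fin_num.
  by apply: fin_num_measure; rewrite -[X in measurable X]setTI; exact: mX.
rewrite -[RHS]/(fine _%:E) -prodEFin; congr fine.
by apply: eq_bigr => i _; rewrite fineK.
Qed.

Let Rintegral_event (A : set R) i : measurable A ->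
  \int[P]_w (\1_A (X i w) : R) = fine (P (X i @^-1` A)).
Proof.
move=> mA; congr fine.
have mXA : measurable (X i @^-1` A) by rewrite -[X in measurable X]setTI; exact: mX.
rewrite -[X in P X]setIT -(integral_indic P measurableT mXA).
by apply: eq_integral => w _; rewrite !indicE.
Qed.

(** Independence speaks of events, so the induction mixes the two formats: coordinates in [r]
    already sit inside the cosine, those in [J] are still constrained by events. To move [j] inside,
    indicators of [X j] are merged into the event over [J] with [j] added, and [decoupling] then
    replaces them by cosine and sine. *)
Let event_cos (r : seq I) (th : I -> R) c (J : {set I}) (A : I -> set R) :
  uniq r -> {subset r <= D} -> J \subset D -> (forall i, i \in r -> i \notin J) ->
  (forall i, measurable (A i)) ->
  \int[P]_w (\1_(event J A) w * cos (c + \sum_(i <- r) th i * X i w)) =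
  cos c * expR (- ((\sum_(i <- r) th i ^+ 2) / 2)) * fine (P (event J A)).
Proof.
elim: r c J A => [|j r IH] c J A.
  move=> _ _ _ _ mA; rewrite big_nil mul0r oppr0 expR0 mulr1.
  under eq_Rintegral do rewrite big_nil addr0 mulrC.
  have mE := mevent J mA.
  rewrite RintegralZl//; last first.
    apply: (@integrable_bounded _ _ _ P _ 1); first exact: measurable_indic.
    by move=> w; rewrite indicE; case: (_ \in _); rewrite ?normr1 ?normr0.
  by rewrite /Rintegral integral_indic// setIT.
move=> /= /andP[jr ur] rD JD rJ mA.
have jD : j \in D by apply: rD; rewrite mem_head.
have jJ : j \notin J by apply: rJ; rewrite mem_head.
have rD' : {subset r <= D} by move=> i ir; apply: rD; rewrite inE ir orbT.
have rJ' i : i \in r -> i \notin J by move=> ir; apply: rJ; rewrite inE ir orbT.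
have JD' : j |: J \subset D.
  by apply/fintype.subsetP => i; rewrite !inE => /orP[/eqP->//|]; exact: (fintype.subsetP JD).
have rJ'' i : i \in r -> i \notin j |: J.
  move=> ir; rewrite !inE negb_or rJ'// andbT.
  by apply: contraNneq jr => <-.
pose W c' w : R := \1_(event J A) w * cos (c' + \sum_(i <- r) th i * X i w).
pose e := expR (- ((\sum_(i <- r) th i ^+ 2) / 2)) * fine (P (event J A)).
have mW c' : measurable_fun setT (W c').
  apply: measurable_funM; first exact: measurable_indic (mevent J mA).
  apply: measurable_cos_comp; apply: measurable_funD => //.
  by apply: measurable_sum => i; exact: measurable_funM.
have W1 c' w : `|W c' w| <= 1.
  rewrite normrM -[1]mulr1; apply: ler_pM => //; last exact: normr_cos_le1.
  by rewrite indicE; case: (_ \in _); rewrite ?normr1 ?normr0.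
have WX c' (B : set R) : measurable B ->
    \int[P]_w (W c' w * \1_B (X j w)) = cos c' * e * \int[P]_w (\1_B (X j w) : R).
  move=> mB.
  pose A' i := if i == j then B else A i.
  have mA' i : measurable (A' i) by rewrite /A'; case: ifP.
  have evE w : \1_(event J A) w * \1_B (X j w) = \1_(event (j |: J) A') w :> R.
    rewrite !indicE -natrM mulnb; congr (_%:R); congr nat_of_bool.
    apply/andP/idP => [[/set_mem h1 /set_mem h2]|/set_mem h].
      apply/mem_set => i /=; rewrite !inE /A' => /orP[/eqP->|iJ]; first by rewrite eqxx.
      by case: eqP => [->//|_]; apply: h1.
    split; apply/mem_set.
      move=> i /= iJ; have := h i; rewrite /= !inE iJ orbT /A' => /(_ isT).
      by case: eqP => // ij; move: iJ; rewrite ij (negPf jJ).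
    by have := h j; rewrite /= !inE eqxx /A' eqxx; apply.
  transitivity (\int[P]_w (\1_(event (j |: J) A') w *
      cos (c' + \sum_(i <- r) th i * X i w))).
    by apply: eq_Rintegral => w _; rewrite -evE mulrAC.
  rewrite IH// Rintegral_event// /e !fine_event// big_setU1//= /A' eqxx.
  rewrite [X in _ * (_ * X) = _](eq_bigr (fun i => fine (P (X i @^-1` A i)))); last first.
    by move=> i iJ; case: eqP => // ij; move: iJ; rewrite ij (negPf jJ).
  by rewrite -!mulrA; congr (_ * (_ * _)); rewrite mulrC.
have dec c' (k : R -> R) : measurable_fun setT k -> (forall x, `|k x| <= 1) ->
    \int[P]_w (W c' w * k (X j w)) = cos c' * e * \int[P]_w k (X j w).
  by move=> mk k1; exact: (decoupling (mW c') (mX j) (W1 c') (WX c') mk k1).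
have mct : measurable_fun setT (fun x : R => cos (th j * x)).
  by apply: measurable_cos_comp; exact: measurable_funM.
have mst : measurable_fun setT (fun x : R => sin (th j * x)).
  apply: measurableT_comp; last exact: measurable_funM.
  exact: continuous_measurable_fun (@continuous_sin R).
have i1 c' (k : R -> R) : measurable_fun setT k -> (forall x, `|k x| <= 1) ->
    P.-integrable setT (EFin \o (fun w => W c' w * k (X j w))).
  move=> mk k1; apply: (@integrable_bounded _ _ _ P _ 1) => [|w].
    by apply: measurable_funM => //; exact: measurableT_comp.
  by rewrite normrM -[1]mulr1; apply: ler_pM.
transitivity (\int[P]_w (W c w * cos (th j * X j w) -
    W (c - pi / 2) w * sin (th j * X j w))).
  apply: eq_Rintegral => w _; rewrite big_cons /W.
  set S := \sum_(i <- r) _.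
  have -> : cos (c - pi / 2 + S) = sin (c + S).
    have -> : c - pi / 2 + S = (c + S) - pi / 2 by ring.
    by rewrite cosB cos_pihalf sin_pihalf; ring.
  have -> : c + (th j * X j w + S) = (c + S) + th j * X j w by ring.
  by rewrite cosD; ring.
rewrite RintegralB//; last 2 first.
- exact: (i1 c _ mct (fun x => normr_cos_le1 _)).
- exact: (i1 (c - pi / 2) _ mst (fun x => normr_sin_le1 _)).
rewrite (dec c _ mct (fun x => normr_cos_le1 _)).
rewrite (dec (c - pi / 2) _ mst (fun x => normr_sin_le1 _)).
have -> : \int[P]_w cos (th j * X j w) = expR (- (th j ^+ 2 / 2)).
  have := cos_int j 0 (th j); rewrite cos0 mul1r => <-.
  by apply: eq_Rintegral => w _; rewrite add0r.
(* The sine is a cosine with phase a quarter period away, where the transform carries the factor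
   cos(pi/2) = 0. *)
have -> : \int[P]_w sin (th j * X j w) = 0.
  have := cos_int j (- (pi / 2)) (th j); rewrite cosN cos_pihalf mul0r => <-.
  apply: eq_Rintegral => w _.
  by rewrite addrC cosB cos_pihalf sin_pihalf; ring.
rewrite mulr0 subr0 big_cons mulrDl opprD expRD /e.
move: (expR _) (expR _) (fine _) => x y z; ring.
Qed.

Lemma independent_gaussian_cos (th : I -> R) c :
  \int[P]_w cos (c + \sum_(i in D) th i * X i w) =
  cos c * expR (- ((\sum_(i in D) th i ^+ 2) / 2)).
Proof.
have rD : {subset enum D <= D} by move=> i; rewrite mem_enum.
have r0 i : i \in enum D -> i \notin (finset.set0 : {set I}) by rewrite inE.
have E0 : event finset.set0 (fun=> setT) = setT.
  by apply/seteqP; split => // w _ i /=; rewrite inE.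
have := event_cos th c (enum_uniq _) rD (finset.sub0set D) r0 (fun i => measurableT).
rewrite E0 (_ : fine (P setT) = 1) ?mulr1; last first.
  exact: (congr1 fine (probability_setT P)).
rewrite big_enum => <-; apply: eq_Rintegral => w _.
by rewrite indicE in_setT mul1r big_enum.
Qed.

Lemma gaussian_cf_independent (J : finType) (A : J -> I -> R) :
  gaussian_cf P (fun v w => \sum_(i in D) A v i * X i w)
    (fun u v => \sum_(i in D) A u i * A v i).
Proof.
split=> [v|c th].
  under eq_fun do rewrite -big_enum.
  by apply: measurable_sum => i; exact: measurable_funM.
transitivity (\int[P]_w cos (c + \sum_(i in D) (\sum_v th v * A v i) * X i w)).
  apply: eq_Rintegral => w _; congr (cos (_ + _)).
  under eq_bigr do rewrite mulr_sumr.
  rewrite exchange_big/=; apply: eq_bigr => i _; rewrite mulr_suml.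
  by apply: eq_bigr => v _; rewrite mulrA.
rewrite independent_gaussian_cos.
suff -> : \sum_(i in D) (\sum_v th v * A v i) ^+ 2 =
  qform (fun u v => \sum_(i in D) A u i * A v i) th by [].
transitivity (\sum_u \sum_v \sum_(i in D) th u * th v * (A u i * A v i)).
  under [RHS]eq_bigr do rewrite exchange_big.
  rewrite [RHS]exchange_big/=; apply: eq_bigr => i _.
  rewrite expr2 mulr_suml; apply: eq_bigr => u _; rewrite mulr_sumr.
  by apply: eq_bigr => v _; ring.
apply: eq_bigr => u _; apply: eq_bigr => v _.
by rewrite mulr_sumr.
Qed.

End IndependentGaussians.

Section GaussianLaw.
Context d (T : measurableType d) (R : realType) (P : probability T R).

(** For s = 0, [U] has the law of a constant variable on the same space; otherwise it has the law of
    the identity under [normal_prob m s]. Frequency 1 suffices in the last clause, because it is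
    applied to linear combinations that already carry their coefficients. *)
Lemma gaussian_moments (U : T -> R) : measurable_fun setT U -> gaussian P U ->
  exists m s : R, [/\ P.-integrable setT (EFin \o U),
    P.-integrable setT (EFin \o (fun w => U w ^+ 2)),
    \int[P]_w U w = m,
    \int[P]_w (U w - m) ^+ 2 = s ^+ 2
  & forall c, \int[P]_w cos (c + (U w - m)) = cos c * expR (- (s ^+ 2 / 2))].
Proof.
move=> mU [m [s [s_ge0 lawU]]]; exists m, s.
have mid : measurable_fun setT (fun x : R => x) by exact: measurable_id.
have msub : measurable_fun setT (fun x : R => x - m) by exact: measurable_funB.
have mcos c : measurable_fun setT (fun x : R => cos (c + (x - m))).
  by apply: measurable_cos_comp; exact: measurable_funD.
have [s0|s0] := eqVneq s 0.
  have lawE (A : set R) : measurable A -> P (cst m @^-1` A) = P (U @^-1` A).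
    move=> mA; have := lawU A mA; rewrite s0 eqxx /pushforward => ->.
    rewrite diracE; have [Am|Am] := boolP (m \in A).
      rewrite (_ : _ @^-1` _ = setT) ?probability_setT//.
      by apply/seteqP; split => // w _; exact: set_mem.
    rewrite (_ : _ @^-1` _ = set0) ?measure0//.
    by apply/seteqP; split => // w /= mA'; move/negP: Am; apply; exact: mem_set.
  have mcm : measurable_fun setT (cst m : T -> R) by exact: measurable_cst.
  have intc (x : R) : P.-integrable setT (EFin \o cst x).
    exact: (finite_measure_integrable_cst P _ measurableT).
  have I (f : R -> R) : measurable_fun setT f -> P.-integrable setT (EFin \o (fun w => f (U w))).
    by move=> mf; apply: (same_law_integrable mcm mU lawE mf); exact: (intc (f m)).
  have E (f : R -> R) : measurable_fun setT f -> \int[P]_w f (U w) = f m.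
    move=> mf; rewrite -(same_law_Rintegral mcm mU lawE mf); last exact: (intc (f m)).
    exact: (Rintegral_prob_cst P (f m)).
  split.
  - exact: (I _ mid).
  - by apply: (I (fun x => x ^+ 2)); exact: measurable_funX.
  - exact: (E _ mid).
  - rewrite (E (fun x => (x - m) ^+ 2)); last exact: measurable_funX.
    by rewrite s0 subrr.
  - move=> c; rewrite (E (fun x => cos (c + (x - m)))) // subrr addr0 s0.
    by rewrite expr0n/= mul0r oppr0 expR0 mulr1.
have lawE (A : set R) : measurable A ->
    normal_prob m s ((fun x => x) @^-1` A) = P (U @^-1` A).
  by move=> mA; have := lawU A mA; rewrite (negPf s0) => h; exact: (esym h).
pose N := normal_prob m s.
have mid' : measurable_fun setT (fun x : measurableTypeR R => x : R).
  exact: (@measurable_id _ (measurableTypeR R) setT).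
have I (f : R -> R) : measurable_fun setT f -> N.-integrable setT (EFin \o f) ->
    P.-integrable setT (EFin \o (fun w => f (U w))).
  move=> mf intf.
  exact: (@same_law_integrable _ _ _ N _ _ P (fun x => x) U mid' mU lawE f mf intf).
have E (f : R -> R) : measurable_fun setT f -> N.-integrable setT (EFin \o f) ->
    \int[P]_w f (U w) = \int[N]_x f x.
  move=> mf intf; apply/esym.
  exact: (@same_law_Rintegral _ _ _ N _ _ P (fun x => x) U mid' mU lawE f mf intf).
have i1 : N.-integrable setT (EFin \o (fun x => x)).
  have := integrable_addR (integrable_normal_sub m s0)
    (finite_measure_integrable_cst N m measurableT).
  by apply: eq_integrable => // x _ /=; rewrite subrK.
have i2 : N.-integrable setT (EFin \o (fun x => (x - m) ^+ 2)).
  apply: (@integrable_poly_normal _ _ _ s0 _ 1); first exact: measurable_funX.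
  move=> x; rewrite mul1r ger0_norm ?sqr_ge0// (exprM _ 2 2).
  by have := sqr_ge0 ((x - m) ^+ 2 - 1); rewrite !expr2; nra.
have Um : \int[P]_w U w = m.
  rewrite (E _ mid i1).
  have := Rintegral_normal_mean m s0.
  rewrite RintegralB//; last exact: (finite_measure_integrable_cst N m measurableT).
  by rewrite (Rintegral_prob_cst N m) => /eqP; rewrite subr_eq0 => /eqP.
split => //.
- exact: (I _ mid i1).
- apply: (I (fun x => x ^+ 2)); first exact: measurable_funX.
  apply: (@integrable_poly_normal _ _ _ s0 _ (2 + 2 * m ^+ 2)).
    exact: measurable_funX.
  move=> x; rewrite ger0_norm ?sqr_ge0// (exprM _ 2 2).
  set y := x - m; have -> : x = y + m by rewrite subrK.
  have := sqr_ge0 (y - m); have := sqr_ge0 m; have := sqr_ge0 (y ^+ 2).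
  have := sqr_ge0 (y ^+ 2 - 1); rewrite !expr2; nra.
- rewrite (E (fun x => (x - m) ^+ 2))//; last exact: measurable_funX.
  exact: Rintegral_normal_variance.
- move=> c; rewrite (E (fun x => cos (c + (x - m))))//; last first.
    apply: (@integrable_bounded _ _ _ N _ 1 (mcos c)) => x; exact: normr_cos_le1.
  have := Rintegral_normal_cos m s0 c 1; rewrite expr1n mulr1 => <-.
  by apply: eq_Rintegral => x _; rewrite mul1r.
Qed.

Variables (n : nat) (S : 'M[R]_n) (Y : 'I_n -> {RV P >-> R}).
Hypothesis YP : centered_gaussian_vector S Y.

(** Each linear combination is Gaussian by hypothesis; linearity of the mean and the prescribed
    covariances identify its parameters as 0 and the quadratic form of [S]. *)
Lemma centered_gaussian_vector_cf : gaussian_cf P (fun i w => Y i w) (fun i j => S i j).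
Proof.
case: YP => gY meanY covY.
have mY i : measurable_fun setT (Y i) by exact: measurable_funPT.
have single i : gaussian P (Y i).
  have := gY (fun j => (j == i)%:R).
  rewrite (_ : (fun w => _) = (Y i : T -> R))//; apply/funext => w.
  exact: (sum_delta (fun j => Y j w)).
have i1 i : P.-integrable setT (EFin \o Y i).
  by have [m [s []]] := gaussian_moments (mY i) (single i).
have i2 i : P.-integrable setT (EFin \o (fun w => Y i w ^+ 2)).
  by have [m [s []]] := gaussian_moments (mY i) (single i).
have m0 i : \int[P]_w Y i w = 0.
  by have := meanY i; rewrite unlock /Rintegral => ->.
have i3 i j : P.-integrable setT (EFin \o (fun w => Y i w * Y j w)).
  apply: (@integrable_le _ _ _ P _ (fun w => Y i w ^+ 2 + Y j w ^+ 2)).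
  - exact: measurable_funM.
  - move=> w; rewrite normrM -[X in _ <= X + _]real_normK ?num_real//.
    rewrite -[X in _ <= _ + X]real_normK ?num_real//.
    have := sqr_ge0 (`|Y i w| - `|Y j w|).
    have := mulr_ge0 (normr_ge0 (Y i w)) (normr_ge0 (Y j w)).
    by rewrite !expr2; lra.
  - exact: integrable_addR.
have cov i j : \int[P]_w (Y i w * Y j w) = S i j.
  have := covY i j; rewrite unlock !meanY/= => h.
  rewrite /Rintegral.
  move: h; rewrite unlock => h; rewrite -[RHS]/(fine (S i j)%:E) -h; congr fine.
  apply: eq_integral => w _.
  by rewrite -[RHS]/(((Y i w - 0) * (Y j w - 0))%:E) !subr0.
split=> // c th.
have mS : measurable_fun setT (fun w => \sum_i th i * Y i w).
  by apply: measurable_sum => i; exact: measurable_funM.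
have [m [s [_ _ Em Es Ec]]] := gaussian_moments mS (gY th).
have mE : m = 0.
  rewrite -Em Rintegral_sum; last by move=> i; exact: integrable_scaleR.
  by rewrite big1// => i _; rewrite RintegralZl// m0 mulr0.
have sE : s ^+ 2 = qform (fun i j => S i j) th.
  rewrite -Es mE.
  transitivity (\int[P]_w (\sum_i \sum_j th i * th j * (Y i w * Y j w))).
    apply: eq_Rintegral => w _; rewrite subr0 expr2 mulr_suml.
    apply: eq_bigr => i _; rewrite mulr_sumr.
    by apply: eq_bigr => j _; ring.
  rewrite Rintegral_sum; last first.
    by move=> i; apply: integrable_sumR => j; exact: integrable_scaleR.
  apply: eq_bigr => i _; rewrite Rintegral_sum; last first.
    by move=> j; exact: integrable_scaleR.
  by apply: eq_bigr => j _; rewrite RintegralZl// cov.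
rewrite -sE -Ec mE; apply: eq_Rintegral => w _.
by rewrite subr0.
Qed.

End GaussianLaw.

(** * Comparison of increments *)

Section CauchySchwarz.
Context (R : realType) (I : finType).
Implicit Types a c : I -> R.

(** Lagrange's identity exhibits the gap as half a double sum of squares. *)
Lemma cauchy_schwarz_sqr a c :
  (\sum_i a i * c i) ^+ 2 <= (\sum_i a i ^+ 2) * (\sum_i c i ^+ 2).
Proof.
have -> : (\sum_i a i ^+ 2) * (\sum_i c i ^+ 2) =
    (\sum_i a i * c i) ^+ 2 +
    2^-1 * \sum_i \sum_j (a i * c j - a j * c i) ^+ 2.
  have E : \sum_i \sum_j (a i * c j - a j * c i) ^+ 2 =
      2 * ((\sum_i a i ^+ 2) * (\sum_i c i ^+ 2)) - 2 * (\sum_i a i * c i) ^+ 2.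
    transitivity (\sum_i \sum_j (a i ^+ 2 * c j ^+ 2 + c i ^+ 2 * a j ^+ 2 -
        2 * (a i * c i) * (a j * c j))).
      by apply: eq_bigr => i _; apply: eq_bigr => j _; ring.
    under eq_bigr do rewrite sumrB big_split/= -!mulr_sumr.
    rewrite sumrB big_split/= -!mulr_suml -mulr_sumr; ring.
  by rewrite E; field.
rewrite lerDl mulr_ge0 ?invr_ge0// sumr_ge0// => i _.
by rewrite sumr_ge0// => j _; exact: sqr_ge0.
Qed.

Lemma cauchy_schwarz a c :
  \sum_i a i * c i <= Num.sqrt (\sum_i a i ^+ 2) * Num.sqrt (\sum_i c i ^+ 2).
Proof.
rewrite -sqrtrM; last by rewrite sumr_ge0// => i _; exact: sqr_ge0.
apply: (le_trans (ler_norm _)); rewrite -sqrtr_sqr.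
exact: ler_wsqrtr (cauchy_schwarz_sqr a c).
Qed.

End CauchySchwarz.

Section Comparison.
Context (R : realType) (n : nat) (b : 'M[R]_n).
Hypothesis b_sym : forall i j, b i j = b j i.
Implicit Types v w : 'I_n -> R.

(** The function f(v)_j, that is, the standard deviation of the j-th coordinate of X v. *)
Definition wnorm v j : R := Num.sqrt (\sum_i b i j ^+ 2 * v i ^+ 2).

Let wnorm_sqr v j : wnorm v j ^+ 2 = \sum_i b i j ^+ 2 * v i ^+ 2.
Proof.
by rewrite sqr_sqrtr// sumr_ge0// => i _; rewrite mulr_ge0// sqr_ge0.
Qed.

Let wnorm_cs v w j :
  \sum_i b i j ^+ 2 * (v i * w i) <= wnorm v j * wnorm w j.
Proof.
have := cauchy_schwarz (fun i => b i j * v i) (fun i => b i j * w i).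
have -> : \sum_i b i j * v i * (b i j * w i) = \sum_i b i j ^+ 2 * (v i * w i).
  by apply: eq_bigr => i _; ring.
have sq (z : 'I_n -> R) : \sum_i (b i j * z i) ^+ 2 = \sum_i b i j ^+ 2 * z i ^+ 2.
  by apply: eq_bigr => i _; rewrite exprMn.
by rewrite !sq.
Qed.

Definition incr_proj v w := \sum_j (v j * wnorm v j - w j * wnorm w j) ^+ 2.

(** With p, q the values of [wnorm] at [v], [w], the right-hand summand equals (v_j - w_j) (v_j p^2
    - w_j q^2) + (v_j - w_j)^2 p q. Replacing p q by the smaller sum of b_ij^2 v_i w_i turns the
    inequality into an identity. *)
Lemma matrix_incr_le_cross v w :
  \sum_i \sum_j b i j ^+ 2 * (v i * v j - w i * w j) ^+ 2 <=
  incr_proj v w + \sum_j (v j * wnorm v j - w j * wnorm w j) *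
    (v j * wnorm w j - w j * wnorm v j).
Proof.
rewrite /incr_proj -big_split/=.
apply: (@le_trans _ _ (\sum_j ((v j - w j) * (v j * wnorm v j ^+ 2 - w j * wnorm w j ^+ 2) +
   (v j - w j) ^+ 2 * (\sum_i b i j ^+ 2 * (v i * w i))))); last first.
  apply: ler_sum => j _.
  have := ler_wpM2l (sqr_ge0 (v j - w j)) (wnorm_cs v w j).
  set p := wnorm v j; set q := wnorm w j; set t := _ ^+ 2 * (\sum_i _) => h.
  apply: (@le_trans _ _ ((v j - w j) * (v j * p ^+ 2 - w j * q ^+ 2) +
    (v j - w j) ^+ 2 * (p * q))); first by rewrite lerD2l.
  rewrite le_eqVlt; apply/orP; left; apply/eqP; ring.
(* The summands on the two sides differ by an expression antisymmetric in i and j, which the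
   symmetric weights cancel in total. *)
have swap : \sum_j \sum_i b i j ^+ 2 * (v i * w i * (v j ^+ 2 + w j ^+ 2)) =
    \sum_j \sum_i b i j ^+ 2 * (v j * w j * (v i ^+ 2 + w i ^+ 2)).
  rewrite exchange_big/=; apply: eq_bigr => i _; apply: eq_bigr => j _.
  by rewrite b_sym.
rewrite exchange_big/= le_eqVlt; apply/orP; left; apply/eqP.
rewrite -[LHS]addr0 -[X in _ + X](subrr (\sum_j \sum_i b i j ^+ 2 *
  (v j * w j * (v i ^+ 2 + w i ^+ 2)))) -[X in X - _]swap.
rewrite -sumrB -big_split/=; apply: eq_bigr => j _.
rewrite !wnorm_sqr -sumrB -big_split/=.
have -> : (v j - w j) * (v j * (\sum_i b i j ^+ 2 * v i ^+ 2) -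
    w j * (\sum_i b i j ^+ 2 * w i ^+ 2)) =
    \sum_i (v j - w j) * (v j * (b i j ^+ 2 * v i ^+ 2) - w j * (b i j ^+ 2 * w i ^+ 2)).
  by rewrite -mulr_sumr sumrB -!mulr_sumr.
by rewrite mulr_sumr -big_split/=; apply: eq_bigr => i _; ring.
Qed.

(** Summed over j, this is (v p - w q)^2 - (v q - w p)^2 = (v^2 - w^2) (p^2 - q^2). It is where the
    quadratic form of the matrix of squares, and hence its negative part, enters. *)
Lemma incr_projE v w :
  incr_proj v w = \sum_j (v j * wnorm w j - w j * wnorm v j) ^+ 2 +
   \sum_i \sum_j (v i ^+ 2 - w i ^+ 2) * (v j ^+ 2 - w j ^+ 2) * b i j ^+ 2.
Proof.
rewrite exchange_big/= /incr_proj -big_split/=; apply: eq_bigr => j _.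
have -> : \sum_i (v i ^+ 2 - w i ^+ 2) * (v j ^+ 2 - w j ^+ 2) * b i j ^+ 2 =
   (v j ^+ 2 - w j ^+ 2) * (wnorm v j ^+ 2 - wnorm w j ^+ 2).
  rewrite !wnorm_sqr -sumrB mulr_sumr; apply: eq_bigr => i _; ring.
ring.
Qed.

Lemma matrix_incr_le v w (gamma : R) : 0 < gamma ->
  2 * \sum_i \sum_j b i j ^+ 2 * (v i * v j - w i * w j) ^+ 2 <=
  (2 + gamma + gamma^-1) * incr_proj v w -
  gamma * \sum_i \sum_j (v i ^+ 2 - w i ^+ 2) * (v j ^+ 2 - w j ^+ 2) * b i j ^+ 2.
Proof.
move=> g0; set G := \sum_i \sum_j b i j ^+ 2 * _.
set dl := \sum_i \sum_j _ * b i j ^+ 2.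
have h1 := matrix_incr_le_cross v w.
have h2 := incr_projE v w; rewrite -/G -/dl in h1 h2 *.
set D := incr_proj v w in h1 h2 *.
set E := \sum_j (v j * wnorm w j - w j * wnorm v j) ^+ 2 in h2.
set C := \sum_j (_ - _) * _ in h1.
(* Young's inequality with parameter [gamma]; afterwards [E] is traded for D - dl, giving the
   coefficient 2 + gamma + 1/gamma. *)
have h3 : 2 * C <= gamma^-1 * D + gamma * E.
  rewrite /C /D /E /incr_proj !mulr_sumr -big_split/=; apply: ler_sum => j _.
  set x := v j * wnorm v j - _; set y := v j * wnorm w j - _.
  have -> : gamma^-1 * x ^+ 2 + gamma * y ^+ 2 =
    2 * (x * y) + gamma^-1 * (x - gamma * y) ^+ 2.
    by field; rewrite gt_eqF.
  by rewrite lerDl mulr_ge0 ?sqr_ge0// invr_ge0 ltW.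
have -> : (2 + gamma + gamma^-1) * D - gamma * dl =
  2 * D + gamma^-1 * D + gamma * (D - dl) by ring.
have -> : D - dl = E by rewrite h2 addrK.
by lra.
Qed.

(** Both forms are sums over the same eigenvectors of squares of <z, u_k>, so the claim reduces to
    min(lam_k, 0) <= lam_k. *)
Lemma negative_part_dominates (M : 'M[R]_n) (z : 'I_n -> R) :
  is_negative_part (\matrix_(i, j) (b i j ^+ 2)) M ->
  - \sum_i \sum_j z i * z j * b i j ^+ 2 <= \sum_i \sum_j z i * z j * M i j.
Proof.
move=> [lam [u [[_ BE] ->]]].
have quad (mu : 'I_n -> R) :
    \sum_i \sum_j z i * z j * (\sum_k mu k *: (u k *m (u k)^T)) i j =
    \sum_k mu k * (\sum_i z i * u k i ord0) ^+ 2.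
  transitivity (\sum_i \sum_j \sum_k mu k * ((z i * u k i ord0) * (z j * u k j ord0))).
    apply: eq_bigr => i _; apply: eq_bigr => j _.
    rewrite summxE mulr_sumr; apply: eq_bigr => k _.
    by rewrite !mxE big_ord1 !mxE; ring.
  under eq_bigr do rewrite exchange_big.
  rewrite exchange_big/=; apply: eq_bigr => k _.
  rewrite expr2 mulr_suml mulr_sumr; apply: eq_bigr => i _.
  by rewrite !mulr_sumr.
have -> : \sum_i \sum_j z i * z j * b i j ^+ 2 =
    \sum_k lam k * (\sum_i z i * u k i ord0) ^+ 2.
  rewrite -quad -BE; apply: eq_bigr => i _; apply: eq_bigr => j _.
  by rewrite mxE.
have -> : \sum_i \sum_j z i * z j *
    (- \sum_k Num.min (lam k) 0 *: (u k *m (u k)^T)) i j =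
    - \sum_k Num.min (lam k) 0 * (\sum_i z i * u k i ord0) ^+ 2.
  rewrite -quad -[RHS]sumrN; apply: eq_bigr => i _.
  by rewrite -[RHS]sumrN; apply: eq_bigr => j _; rewrite mxE mulrN.
rewrite lerN2; apply: ler_sum => k _.
by rewrite ler_wpM2r ?sqr_ge0// ge_min lexx.
Qed.

End Comparison.

(** * The spectral norm as a maximum over a net *)

Section EuclideanNorm.
Context (R : realType) (I : finType).
Implicit Types x y z : I -> R.

Definition enorm x : R := Num.sqrt (\sum_i x i ^+ 2).

Lemma enorm_ge0 x : 0 <= enorm x.
Proof. exact: sqrtr_ge0. Qed.

Lemma enorm_sqr x : enorm x ^+ 2 = \sum_i x i ^+ 2.
Proof. by rewrite sqr_sqrtr// sumr_ge0// => i _; exact: sqr_ge0. Qed.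

Lemma enorm_eq0 x : enorm x = 0 -> forall i, x i = 0.
Proof.
move=> x0 i; have /eqP : \sum_i x i ^+ 2 = 0 by rewrite -enorm_sqr x0 expr0n.
rewrite psumr_eq0 => [/allP/(_ i (mem_index_enum i))/=|j _]; last exact: sqr_ge0.
by rewrite sqrf_eq0 => /eqP.
Qed.

Lemma enormZ a x : enorm (fun i => a * x i) = `|a| * enorm x.
Proof.
rewrite -sqrtr_sqr -sqrtrM ?sqr_ge0//; congr Num.sqrt.
by rewrite mulr_sumr; apply: eq_bigr => i _; rewrite exprMn.
Qed.

Lemma enorm_cs x y : `|\sum_i x i * y i| <= enorm x * enorm y.
Proof.
rewrite -sqrtrM; last by rewrite sumr_ge0// => i _; exact: sqr_ge0.
rewrite -sqrtr_sqr; exact: ler_wsqrtr (cauchy_schwarz_sqr x y).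
Qed.

Lemma enorm_triangle x y : enorm (fun i => x i + y i) <= enorm x + enorm y.
Proof.
rewrite -(ler_pXn2r (n := 2))// ?nnegrE ?addr_ge0 ?enorm_ge0//.
rewrite enorm_sqr sqrrD !enorm_sqr.
have -> : \sum_i (x i + y i) ^+ 2 =
    \sum_i x i ^+ 2 + 2 * (\sum_i x i * y i) + \sum_i y i ^+ 2.
  rewrite mulr_sumr -!big_split/=; apply: eq_bigr => i _; ring.
rewrite lerD2r lerD2l -[leRHS]mulr_natl ler_wpM2l//.
exact: (le_trans (ler_norm _) (enorm_cs x y)).
Qed.

Lemma le_enorm x y : (forall i, `|x i| <= y i) -> enorm x <= enorm y.
Proof.
move=> xy; apply: ler_wsqrtr; apply: ler_sum => i _.
rewrite -real_normK ?num_real// lerXn2r ?nnegrE//.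
exact: le_trans (xy i).
Qed.

Lemma enorm_cst a : 0 <= a -> enorm (fun=> a) = Num.sqrt #|I|%:R * a.
Proof.
by move=> a0; rewrite /enorm sumr_const -[_ ^+ 2 *+ _]mulr_natl sqrtrM// sqrtr_sqr ger0_norm.
Qed.

Definition normalize x i := (enorm x)^-1 * x i.

Lemma enorm_normalize x : enorm x != 0 -> enorm (normalize x) = 1.
Proof.
by move=> x0; rewrite enormZ normfV ger0_norm ?enorm_ge0// mulVf.
Qed.

(* Normalising an approximation of a unit vector at most doubles the error. *)
Lemma enorm_sub_normalize v x : enorm v = 1 -> enorm x != 0 ->
  enorm (fun i => v i - normalize x i) <= 2 * enorm (fun i => v i - x i).
Proof.
move=> v1 x0; have xge0 := enorm_ge0 x.
set dl := enorm (fun i => v i - x i).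
have h1 : enorm (fun i => x i - normalize x i) = `|enorm x - 1|.
  rewrite (_ : (fun i => _) = (fun i => (1 - (enorm x)^-1) * x i)); last first.
    by apply/funext => i; rewrite /normalize mulrBl mul1r.
  rewrite enormZ -[X in _ * X]ger0_norm// -normrM mulrBl mul1r mulVf//.
have h2 : enorm v <= dl + enorm x.
  rewrite (_ : v = (fun i => (v i - x i) + x i)); first exact: enorm_triangle.
  by apply/funext => i; rewrite subrK.
have h3 : enorm x <= dl + enorm v.
  have -> : dl = enorm (fun i => x i - v i).
    rewrite /dl (_ : (fun i => v i - x i) = (fun i => -1 * (x i - v i))).
      by rewrite enormZ normrN1 mul1r.
    by apply/funext => i; rewrite mulN1r opprB.
  rewrite {1}(_ : x = (fun i => (x i - v i) + v i)); first exact: enorm_triangle.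
  by apply/funext => i; rewrite subrK.
rewrite (_ : (fun i => _) = (fun i => (v i - x i) + (x i - normalize x i))); last first.
  by apply/funext => i; rewrite addrA subrK.
apply: (le_trans (enorm_triangle _ _)); rewrite h1 -/dl.
have : `|enorm x - 1| <= dl by rewrite ler_norml; rewrite v1 in h2 h3; lra.
by lra.
Qed.

End EuclideanNorm.

Section SpectralNorm.
Context (R : realType) (n : nat) (A : 'M[R]_n).
Implicit Types x y z v w : 'I_n -> R.

Definition mulv x i : R := \sum_j A i j * x j.

Definition bilin x y : R := \sum_i x i * mulv y i.

Lemma eucl_normE (x : 'cV[R]_n) : eucl_norm x = enorm (fun i => x i ord0).
Proof. by []. Qed.

Lemma eucl_norm_mulmx (x : 'cV[R]_n) :
  eucl_norm (A *m x) = enorm (mulv (fun j => x j ord0)).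
Proof.
by congr Num.sqrt; apply: eq_bigr => i _; rewrite mxE.
Qed.

Lemma mulvZ a x i : mulv (fun j => a * x j) i = a * mulv x i.
Proof. by rewrite mulr_sumr; apply: eq_bigr => j _; rewrite mulrCA. Qed.

Lemma mulvB x y i : mulv (fun j => x j - y j) i = mulv x i - mulv y i.
Proof. by rewrite -sumrB; apply: eq_bigr => j _; rewrite mulrBr. Qed.

Lemma mulvD x y i : mulv (fun j => x j + y j) i = mulv x i + mulv y i.
Proof. by rewrite -big_split; apply: eq_bigr => j _; rewrite mulrDr. Qed.

Lemma bilinZ a x : bilin (fun j => a * x j) (fun j => a * x j) = a ^+ 2 * bilin x x.
Proof.
rewrite mulr_sumr; apply: eq_bigr => i _; rewrite mulvZ; ring.
Qed.

Let S := [set eucl_norm (A *m x) | x in [set x : 'cV[R]_n | eucl_norm x <= 1]].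

Let has_supS : has_sup S.
Proof.
split.
  exists (eucl_norm (A *m 0)), 0 => //=.
  rewrite /eucl_norm big1 ?sqrtr0// => i _; by rewrite mxE expr0n.
pose C := enorm (fun i => enorm (fun j => A i j)).
exists C => _ [x /= x1 <-]; rewrite eucl_norm_mulmx.
apply: le_enorm => i; apply: (le_trans (enorm_cs _ _)).
by rewrite -[leRHS]mulr1 ler_wpM2l ?enorm_ge0.
Qed.

Lemma spectral_norm_ge0 : 0 <= spectral_norm A.
Proof.
apply: (@le_trans _ _ (eucl_norm (A *m 0))); first exact: sqrtr_ge0.
apply: sup_upper_bound => //; exists 0 => //=.
by rewrite /eucl_norm big1 ?sqrtr0// => i _; rewrite mxE expr0n.
Qed.

Lemma spectral_norm_le q : (forall x, enorm x <= 1 -> enorm (mulv x) <= q) ->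
  spectral_norm A <= q.
Proof.
move=> h; apply: ge_sup; first exact: has_supS.1.
by move=> _ [x /= x1 <-]; rewrite eucl_norm_mulmx; apply: h.
Qed.

Lemma enorm_mulv_le x : enorm (mulv x) <= spectral_norm A * enorm x.
Proof.
have [x0|x0] := eqVneq (enorm x) 0.
  have z : mulv x = (fun=> 0).
    by apply/funext => i; rewrite /mulv big1// => j _; rewrite (enorm_eq0 x0) mulr0.
  by rewrite z x0 mulr0 /enorm big1 ?sqrtr0// => i _; rewrite expr0n.
have xgt0 : 0 < enorm x by rewrite lt_def x0 enorm_ge0.
rewrite -ler_pdivrMr// mulrC.
have -> : (enorm x)^-1 * enorm (mulv x) = enorm (mulv (normalize x)).
  rewrite (_ : mulv (normalize x) = (fun i => (enorm x)^-1 * mulv x i)).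
    by rewrite enormZ normfV gtr0_norm.
  by apply/funext => i; exact: mulvZ.
have -> : mulv (normalize x) = mulv (fun j => (\col_i normalize x i) j ord0).
  by congr mulv; apply/funext => i; rewrite mxE.
rewrite -eucl_norm_mulmx; apply: sup_upper_bound => //.
exists (\col_i normalize x i) => //=; rewrite eucl_normE.
have -> : (fun i => (\col_i0 normalize x i0) i ord0) = normalize x.
  by apply/funext => i; rewrite mxE.
by rewrite enorm_normalize.
Qed.

Lemma bilin_lipschitz v w : enorm v = 1 -> enorm w = 1 ->
  `|bilin v v - bilin w w| <= 2 * spectral_norm A * enorm (fun i => v i - w i).
Proof.
move=> v1 w1; set dl := enorm _.
have -> : bilin v v - bilin w w = \sum_i (v i - w i) * mulv v i +
    \sum_i w i * mulv (fun j => v j - w j) i.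
  rewrite /bilin -sumrB -big_split/=; apply: eq_bigr => i _.
  by rewrite mulvB; ring.
apply: (le_trans (ler_normD _ _)).
have h1 := le_trans (enorm_cs (fun i => v i - w i) (mulv v))
  (ler_wpM2l (enorm_ge0 _) (enorm_mulv_le v)).
have h2 := le_trans (enorm_cs w (mulv (fun j => v j - w j)))
  (ler_wpM2l (enorm_ge0 _) (enorm_mulv_le (fun j => v j - w j))).
move: h1 h2; rewrite v1 w1 -/dl mulr1 mul1r.
move: (spectral_norm A) => sn h1 h2.
have -> : 2 * sn * dl = dl * sn + sn * dl by ring.
exact: lerD.
Qed.

Hypothesis A_sym : forall i j, A i j = A j i.

(** Polarization instead of eigenvalues: for y the direction of A x, 4 |A x| = <x+y, A (x+y)> -
    <x-y, A (x-y)>, and the parallelogram law bounds this by 2 q (|x|^2 + |y|^2) <= 4 q. *)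
Lemma spectral_norm_le_bilin q :
  (forall v, enorm v = 1 -> `|bilin v v| <= q) -> 0 <= q -> spectral_norm A <= q.
Proof.
move=> hq q0.
have hq2 v : `|bilin v v| <= q * enorm v ^+ 2.
  have [v0|v0] := eqVneq (enorm v) 0.
    rewrite v0 expr0n mulr0 /bilin big1 ?normr0// => i _.
    by rewrite (enorm_eq0 v0) mul0r.
  have := hq _ (enorm_normalize v0).
  rewrite /normalize bilinZ normrM exprVn (ger0_norm (_ : 0 <= _^-1)); last first.
    by rewrite invr_ge0 sqr_ge0.
  by rewrite mulrC ler_pdivrMr// exprn_even_gt0.
apply: spectral_norm_le => x x1.
set z := mulv x; have [z0|z0] := eqVneq (enorm z) 0; first by rewrite z0.
have zgt0 : 0 < enorm z by rewrite lt_def z0 enorm_ge0.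
pose y := normalize z.
have y1 : enorm y = 1 by exact: enorm_normalize.
have yz : \sum_i y i * mulv x i = enorm z.
  transitivity ((enorm z)^-1 * enorm z ^+ 2); last by rewrite expr2 mulrA mulVf// mul1r.
  by rewrite enorm_sqr mulr_sumr; apply: eq_bigr => i _; rewrite /y /normalize -/z; ring.
have sym : \sum_i x i * mulv y i = \sum_i y i * mulv x i.
  rewrite /mulv; under eq_bigr do rewrite mulr_sumr.
  under [RHS]eq_bigr do rewrite mulr_sumr.
  rewrite exchange_big/=; apply: eq_bigr => i _; apply: eq_bigr => j _.
  by rewrite A_sym; ring.
have pol : bilin (fun i => x i + y i) (fun i => x i + y i) -
    bilin (fun i => x i - y i) (fun i => x i - y i) = 4 * enorm z.
  transitivity (2 * \sum_i y i * mulv x i + 2 * \sum_i x i * mulv y i).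
    rewrite /bilin -sumrB !mulr_sumr -big_split/=; apply: eq_bigr => i _.
    by rewrite mulvD mulvB; ring.
  by rewrite sym yz; ring.
have par : enorm (fun i => x i + y i) ^+ 2 + enorm (fun i => x i - y i) ^+ 2 =
   2 * (enorm x ^+ 2 + enorm y ^+ 2).
  rewrite !enorm_sqr -!big_split/= mulr_sumr; apply: eq_bigr => i _ /=; ring.
have x21 : enorm x ^+ 2 <= 1 by rewrite exprn_ile1 ?enorm_ge0.
have h1 := hq2 (fun i => x i + y i); have h2 := hq2 (fun i => x i - y i).
move: h1 h2; rewrite !ler_norml => /andP[_ h1] /andP[h2 _].
have h3 : 4 * enorm z <= q * (2 * (enorm x ^+ 2 + enorm y ^+ 2)).
  by rewrite -par -pol mulrDr; lra.
have h4 : q * (2 * (enorm x ^+ 2 + enorm y ^+ 2)) <= q * 4.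
  by rewrite ler_wpM2l// y1 expr1n; lra.
by lra.
Qed.

End SpectralNorm.

Section Net.
Context (R : realType) (n : nat).

(** Mesh 1/m on [-1, 1], hence 2 m + 1 values per coordinate. *)
Definition grid_point (m : nat) (k : {ffun 'I_n.+1 -> 'I_(m.*2).+1}) (i : 'I_n.+1) : R :=
  (k i)%:R / m%:R - 1.

(* The origin, which cannot be normalised, is replaced by a basis vector. *)
Definition net_point (m : nat) (k : {ffun 'I_n.+1 -> 'I_(m.*2).+1}) (i : 'I_n.+1) : R :=
  if enorm (grid_point k) == 0 then (i == ord0)%:R else normalize (grid_point k) i.

Lemma enorm_net_point m k : enorm (@net_point m k) = 1.
Proof.
rewrite /net_point; case: eqVneq => [_|k0]; last exact: enorm_normalize.
rewrite /enorm (bigD1 ord0)//= big1 ?eqxx ?expr1n ?addr0 ?sqrtr1// => i /negPf ->.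
by rewrite expr0n.
Qed.

(** Rounding each coordinate down costs at most 1/m, so sqrt(n+1)/m in norm. That this is below 1
    keeps the grid point away from the origin; normalizing it accounts for the factor 2. *)
Lemma net_approx m (v : 'I_n.+1 -> R) : (0 < m)%N -> Num.sqrt n.+1%:R / m%:R < 1 :> R ->
  enorm v = 1 ->
  exists k : {ffun 'I_n.+1 -> 'I_(m.*2).+1},
    enorm (fun i => v i - net_point k i) <= 2 * (Num.sqrt n.+1%:R / m%:R).
Proof.
move=> m0 m1 v1.
have mR : 0 < m%:R :> R by rewrite ltr0n.
have vi i : `|v i| <= 1.
  rewrite -v1 /enorm -sqrtr_sqr; apply: ler_wsqrtr.
  by rewrite (bigD1 i)//= lerDl sumr_ge0// => j _; exact: sqr_ge0.
pose k : {ffun 'I_n.+1 -> 'I_(m.*2).+1} := [ffun i => inord (Num.trunc ((v i + 1) * m%:R))].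
have vge0 i : 0 <= (v i + 1) * m%:R.
  apply: mulr_ge0; last exact: ltW.
  by have := vi i; rewrite ler_norml => /andP[? _]; lra.
have kE i : (k i : nat) = Num.trunc ((v i + 1) * m%:R).
  rewrite ffunE inordK// ltnS -(ler_nat R).
  have /andP[h _] := truncn_itv (vge0 i).
  apply: (le_trans h); rewrite -muln2 natrM [leRHS]mulrC; apply: ler_wpM2r; first exact: ltW.
  by have := vi i; rewrite ler_norml => /andP[_ ?]; lra.
have close i : `|v i - grid_point k i| <= m%:R^-1.
  have /andP[h1 h2] := truncn_itv (vge0 i).
  rewrite /grid_point kE.
  have -> : v i - ((Num.trunc ((v i + 1) * m%:R))%:R / m%:R - 1) =
     ((v i + 1) * m%:R - (Num.trunc ((v i + 1) * m%:R))%:R) / m%:R.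
    by field; rewrite gt_eqF.
  rewrite normrM normfV (gtr0_norm mR) ler_piMl ?invr_ge0 ?(ltW mR)//.
  rewrite ger0_norm ?subr_ge0// lerBlDr; apply: (le_trans (ltW h2)).
  by rewrite -natr1 addrC.
have dl : enorm (fun i => v i - grid_point k i) <= Num.sqrt n.+1%:R / m%:R.
  apply: (le_trans (le_enorm close)).
  by rewrite enorm_cst ?invr_ge0 ?(ltW mR)// card_ord.
exists k.
have k0 : enorm (grid_point k) != 0.
  apply/eqP => k0; have := enorm_triangle (fun i => v i - grid_point k i) (grid_point k).
  rewrite (_ : (fun i => _) = v); last by apply/funext => i; rewrite subrK.
  by rewrite v1 k0; lra.
have -> : net_point k = normalize (grid_point k).
  by apply/funext => i; rewrite /net_point (negPf k0).
apply: (le_trans (enorm_sub_normalize v1 k0)).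
by rewrite ler_wpM2l.
Qed.

(** The mesh is chosen before [A], so one finite family serves every outcome of the random matrix.
    The discretization error is proportional to the norm of [A] itself and moves to the left
    side. *)
Lemma spectral_norm_net (eps : R) : 0 < eps -> exists m : nat,
  forall A : 'M[R]_n.+1, (forall i j, A i j = A j i) ->
  exists k : {ffun 'I_n.+1 -> 'I_(m.*2).+1},
    (1 - eps) * spectral_norm A <= `|bilin A (net_point k) (net_point k)|.
Proof.
move=> e0; pose N := Num.sqrt n.+1%:R : R.
have N0 : 0 <= N by exact: sqrtr_ge0.
have [m [m0 m1 me]] : exists m : nat,
    [/\ (0 < m)%N, N / m%:R < 1 & 4 * (N / m%:R) <= eps].
  (* Any m > a satisfies both N / m < 1 and 4 N / m <= eps; the 4 is the Lipschitz factor 2 times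
     the approximation factor 2. *)
  pose a := N + 4 * N / eps.
  have a0 : 0 <= a by rewrite addr_ge0// divr_ge0 ?mulr_ge0// ltW.
  exists (Num.trunc a).+1.
  have /andP[_ h] := truncn_itv a0.
  have mR : 0 < (Num.trunc a).+1%:R :> R by rewrite ltr0n.
  have q0 : 0 <= 4 * N / eps by rewrite divr_ge0 ?mulr_ge0// ltW.
  split => //.
    by rewrite ltr_pdivrMr// mul1r; apply: le_lt_trans h; rewrite lerDl.
  rewrite mulrA ler_pdivrMr// -ler_pdivrMl// [leLHS]mulrC.
  by apply: (le_trans _ (ltW h)); rewrite lerDr.
exists m => A A_sym.
pose k := [arg max_(k > ([ffun=> ord0] : {ffun 'I_n.+1 -> 'I_(m.*2).+1}))
  `|bilin A (net_point k) (net_point k)|]%O.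
exists k.
have kmax (j : {ffun 'I_n.+1 -> 'I_(m.*2).+1}) : `|bilin A (net_point j) (net_point j)| <=
    `|bilin A (net_point k) (net_point k)|.
  by rewrite /k; case: arg_maxP => // i _ h; apply: (h j).
set q := `|bilin A _ _| in kmax *.
have sn0 := spectral_norm_ge0 A.
have : spectral_norm A <= q + eps * spectral_norm A.
  apply: spectral_norm_le_bilin => //; last by rewrite addr_ge0 ?mulr_ge0 ?normr_ge0// ltW.
  move=> v v1; have [j hj] := net_approx m0 m1 v1.
  have := bilin_lipschitz A v1 (enorm_net_point j).
  have h1 : 2 * spectral_norm A * enorm (fun i => v i - net_point j i) <=
     2 * spectral_norm A * (2 * (N / m%:R)) by rewrite ler_wpM2l// mulr_ge0.
  have h2 : 2 * spectral_norm A * (2 * (N / m%:R)) <= eps * spectral_norm A.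
    have -> : 2 * spectral_norm A * (2 * (N / m%:R)) = (4 * (N / m%:R)) * spectral_norm A by ring.
    by rewrite ler_wpM2r.
  have h3 := kmax j.
  have h4 := ler_normD (bilin A v v - bilin A (net_point j) (net_point j))
    (bilin A (net_point j) (net_point j)).
  rewrite subrK in h4.
  by move=> h5; lra.
by rewrite mulrBl mul1r; lra.
Qed.

End Net.

(** * Assembly of the bound *)

Section FiniteMaximum.
Context (R : realType) (I : finType) (i0 : I).

(** [maxf] is convertible to the case of ordinals with [i0] equal to [ord0], so these lemmas apply
    to it directly. *)
Definition fmax (F : I -> R) : R := \big[Num.max/F i0]_i F i.

Lemma fmax_attained F : exists i, fmax F = F i.
Proof.
apply: (big_ind (fun x => exists i, x = F i)) => [|x y [i ->] [j ->]|i _].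
- by exists i0.
- by case: (leP (F i) (F j)) => _; [exists j|exists i].
- by exists i.
Qed.

Lemma le_fmax F i : F i <= fmax F.
Proof. exact: le_bigmax. Qed.

Context d (T : measurableType d) (P : probability T R) (F : I -> T -> R).
Hypothesis mF : forall i, measurable_fun setT (F i).

Lemma measurable_fmax : measurable_fun setT (fun w => fmax (F ^~ w)).
Proof.
rewrite /fmax; elim: (index_enum I) => [|i r IH].
  under eq_fun do rewrite big_nil.
  exact: mF.
under eq_fun do rewrite big_cons.
exact: measurable_maxr.
Qed.

Lemma integrable_fmax : (forall i, P.-integrable setT (EFin \o F i)) ->
  P.-integrable setT (EFin \o (fun w => fmax (F ^~ w))).
Proof.
move=> intF; apply: (@integrable_le _ _ _ P _ (fun w => \sum_i `|F i w|)).
- exact: measurable_fmax.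
- move=> w; have [i ->] := fmax_attained (F ^~ w).
  by rewrite (bigD1 i)//= lerDl sumr_ge0.
- by apply: integrable_sumR => i; exact: (integrable_abse (intF i)).
Qed.

End FiniteMaximum.

Lemma integral_prob_cst d (T : measurableType d) (R : realType)
  (P : probability T R) (a : \bar R) : (\int[P]_y (cst a y) = a)%E.
Proof.
rewrite integral_cst// -[RHS]mule1; congr (_ * _)%E; exact: probability_setT.
Qed.

Section ProductMarginals.
Context d (T : measurableType d) d' (T' : measurableType d') (R : realType).
Variables (P : probability T R) (Q : probability T' R).

Lemma integrable_fst (f : T -> R) : P.-integrable setT (EFin \o f) ->
  (P \x Q)%E.-integrable setT (EFin \o (fun z => f z.1)).
Proof.
move=> /[dup] intf /integrableP[/measurable_EFinP mf h].
apply/integrable12ltyP; first by apply: measurable_EFin; exact: measurableT_comp.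
rewrite (eq_integral (fun x => `|(f x)%:E|)%E)// => x _.
exact: (integral_prob_cst Q `|(f x)%:E|%E).
Qed.

Lemma Rintegral_fst (f : T -> R) : P.-integrable setT (EFin \o f) ->
  \int[(P \x Q)%E]_z f z.1 = \int[P]_x f x.
Proof.
move=> intf; rewrite (@Rintegral_prod1 _ _ _ _ _ P Q (fun z => f z.1)).
- by apply: eq_Rintegral => x _; exact: (Rintegral_prob_cst Q (f x)).
- exact: integrable_fst.
- by move=> x; exact: (finite_measure_integrable_cst Q (f x) measurableT).
Qed.

Lemma integrable_snd (f : T' -> R) : Q.-integrable setT (EFin \o f) ->
  (P \x Q)%E.-integrable setT (EFin \o (fun z => f z.2)).
Proof.
move=> /[dup] intf /integrableP[/measurable_EFinP mf h].
apply/integrable12ltyP; first by apply: measurable_EFin; exact: measurableT_comp.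
by rewrite (integral_prob_cst P (\int[Q]_y `|(f y)%:E|)%E).
Qed.

Lemma Rintegral_snd (f : T' -> R) : Q.-integrable setT (EFin \o f) ->
  \int[(P \x Q)%E]_z f z.2 = \int[Q]_x f x.
Proof.
move=> intf; rewrite (@Rintegral_prod1 _ _ _ _ _ P Q (fun z => f z.2)).
- exact: (Rintegral_prob_cst P (\int[Q]_y f y)).
- exact: integrable_snd.
- by [].
Qed.

End ProductMarginals.

(* Meant for [spectral_norm], whose measurability is never established. *)
Lemma ge0_integral_mono d (T : measurableType d) (R : realType)
    (mu : {measure set T -> \bar R}) (f g : T -> \bar R) :
  (forall x, 0 <= f x)%E -> (forall x, f x <= g x)%E ->
  (\int[mu]_x f x <= \int[mu]_x g x)%E.
Proof.
move=> f0 fg; have g0 x : (0 <= g x)%E by exact: le_trans (fg x).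
rewrite !ge0_integralTE//; apply: le_ereal_sup => _ [h hf <-].
by exists h => // x; exact: le_trans (fg x).
Qed.

Lemma gaussian_cf_image d (T : measurableType d) (R : realType)
    (P : probability T R) (I J : finType) (X : I -> T -> R) (K : I -> I -> R)
    (A : J -> I -> R) : gaussian_cf P X K ->
  gaussian_cf P (fun u w => \sum_i A u i * X i w)
    (fun u v => \sum_i \sum_j A u i * A v j * K i j).
Proof.
move=> gX; split=> [u|c th]; first exact: (measurable_linear gX).
transitivity (\int[P]_w cos (c + \sum_i (\sum_u th u * A u i) * X i w)).
  apply: eq_Rintegral => w _; congr (cos (_ + _)).
  under eq_bigr do rewrite mulr_sumr.
  rewrite exchange_big/=; apply: eq_bigr => i _; rewrite mulr_suml.
  by apply: eq_bigr => u _; rewrite mulrA.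
rewrite gX.2.
suff -> : qform K (fun i => \sum_u th u * A u i) =
  qform (fun u v => \sum_i \sum_j A u i * A v j * K i j) th by [].
rewrite /qform.
transitivity (\sum_i \sum_j \sum_u \sum_v th u * th v * (A u i * A v j * K i j)).
  apply: eq_bigr => i _; apply: eq_bigr => j _.
  rewrite mulr_suml mulr_suml; apply: eq_bigr => u _.
  rewrite mulr_sumr mulr_suml; apply: eq_bigr => v _; ring.
transitivity (\sum_u \sum_v \sum_i \sum_j th u * th v * (A u i * A v j * K i j)); last first.
  apply: eq_bigr => u _; apply: eq_bigr => v _.
  by rewrite mulr_sumr; apply: eq_bigr => i _; rewrite mulr_sumr.
under eq_bigr do rewrite exchange_big.
rewrite exchange_big/=; apply: eq_bigr => u _.
under eq_bigr do rewrite exchange_big.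
by rewrite exchange_big.
Qed.

Section LowerTriangle.
Context (R : realType) (n : nat).
Notation D := [set p : 'I_n * 'I_n | (p.2 <= p.1)%N]%SET.

(* The off-diagonal Gaussians occur twice in the symmetric matrix. *)
Definition mult (p : 'I_n * 'I_n) : R := if p.1 == p.2 then 1 else 2.

Lemma sum_lower_triangle (F : 'I_n -> 'I_n -> R) : (forall i j, F i j = F j i) ->
  \sum_i \sum_j F i j = \sum_(p in D) mult p * F p.1 p.2.
Proof.
move=> Fsym; rewrite pair_bigA/= (bigID (mem D))/=.
have -> : \sum_(p in D) mult p * F p.1 p.2 =
    \sum_(p in D) F p.1 p.2 + \sum_(p in D | p.1 != p.2) F p.1 p.2.
  rewrite big_mkcondr -big_split/=; apply: eq_bigr => p _.
  by rewrite /mult; case: eqP => _; rewrite ?mul1r ?addr0// mulr_natl mulr2n.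
congr (_ + _).
pose swap (p : 'I_n * 'I_n) := (p.2, p.1).
have swapK : involutive swap by case.
rewrite (reindex_inj (inv_inj swapK))/=.
apply: eq_big => [p|p _]; last exact: Fsym.
rewrite !inE/= -ltnNge ltn_neqAle andbC; congr (_ && _).
by rewrite eq_sym.
Qed.

End LowerTriangle.

Section MatrixIncrements.
Context (R : realType) (n : nat) (b : 'M[R]_n) (bm : R).
Hypotheses (b_ge0 : forall i j, 0 <= b i j) (b_sym : forall i j, b i j = b j i).
Hypothesis b_le : forall i j, b i j <= bm.
Implicit Types v w : 'I_n -> R.
Notation D := [set p : 'I_n * 'I_n | (p.2 <= p.1)%N]%SET.

(** The coefficient in <v, X v> of the independent Gaussian indexed by [p]. *)
Definition coef v (p : 'I_n * 'I_n) : R := mult R p * b p.1 p.2 * (v p.1 * v p.2).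

Lemma bilin_coef v (G : 'I_n -> 'I_n -> R) : (forall i j, G i j = G j i) ->
  bilin (\matrix_(i, j) (b i j * G i j)) v v = \sum_(p in D) coef v p * G p.1 p.2.
Proof.
move=> Gsym; transitivity (\sum_i \sum_j b i j * G i j * (v i * v j)).
  rewrite /bilin /mulv; apply: eq_bigr => i _; rewrite mulr_sumr.
  by apply: eq_bigr => j _; rewrite mxE; ring.
rewrite (sum_lower_triangle (F := fun i j => b i j * G i j * (v i * v j))).
  by apply: eq_bigr => p _; rewrite /coef; ring.
by move=> i j; rewrite b_sym Gsym [v i * _]mulrC.
Qed.

Let mult_bounds (p : 'I_n * 'I_n) : 0 <= mult R p <= 2.
Proof. by rewrite /mult; case: eqP => _; lra. Qed.

(** mult^2 <= 2 mult, with equality off the diagonal: the source of the factor 2 in front of the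
    full double sums. *)
Let weight_le (p : 'I_n * 'I_n) (x y : R) : 0 <= x -> y = b p.1 p.2 ^+ 2 * x ->
  mult R p ^+ 2 * y <= 2 * (mult R p * y).
Proof.
move=> x0 ->; have /andP[m0 m2] := mult_bounds p.
rewrite expr2 -mulrA; apply: ler_wpM2r => //.
by rewrite mulr_ge0// mulr_ge0// sqr_ge0.
Qed.

Lemma sum_coef_sub v w : \sum_(p in D) (coef v p - coef w p) ^+ 2 <=
  2 * \sum_i \sum_j b i j ^+ 2 * (v i * v j - w i * w j) ^+ 2.
Proof.
rewrite (sum_lower_triangle (F := fun i j => b i j ^+ 2 * (v i * v j - w i * w j) ^+ 2)).
  rewrite mulr_sumr; apply: ler_sum => p _.
  have -> : (coef v p - coef w p) ^+ 2 = mult R p ^+ 2 *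
      (b p.1 p.2 ^+ 2 * (v p.1 * v p.2 - w p.1 * w p.2) ^+ 2) by rewrite /coef; ring.
  exact: (weight_le (sqr_ge0 _) erefl).
by move=> i j; rewrite b_sym [v i * _]mulrC [w i * _]mulrC.
Qed.

(** This covariance of two values of the form is at most 2 (max b)^2 times the square of the sum of
    |v_i w_i|, and that sum is at most 1 by Cauchy-Schwarz. *)
Lemma sum_coef_mul v w : enorm v = 1 -> enorm w = 1 ->
  \sum_(p in D) coef v p * coef w p <= 2 * bm ^+ 2.
Proof.
move=> v1 w1; pose z i := `|v i * w i|.
have z0 i : 0 <= z i by exact: normr_ge0.
apply: (@le_trans _ _ (2 * \sum_i \sum_j b i j ^+ 2 * (z i * z j))).
  rewrite (sum_lower_triangle (F := fun i j => b i j ^+ 2 * (z i * z j))); last first.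
    by move=> i j; rewrite b_sym [z i * _]mulrC.
  rewrite mulr_sumr; apply: ler_sum => p _.
  have -> : coef v p * coef w p = mult R p ^+ 2 * (b p.1 p.2 ^+ 2 *
      ((v p.1 * w p.1) * (v p.2 * w p.2))) by rewrite /coef; ring.
  apply: (@le_trans _ _ (mult R p ^+ 2 * (b p.1 p.2 ^+ 2 * (z p.1 * z p.2)))).
    rewrite ler_wpM2l ?sqr_ge0// ler_wpM2l ?sqr_ge0//.
    by rewrite -normrM ler_norm.
  exact: (weight_le (mulr_ge0 (z0 _) (z0 _)) erefl).
have zs : \sum_i z i <= 1.
  have := enorm_cs (fun i => `|v i|) (fun i => `|w i|).
  have E (x : 'I_n -> R) : enorm (fun i => `|x i|) = enorm x.
    by rewrite /enorm; congr Num.sqrt; apply: eq_bigr => i _; rewrite real_normK ?num_real.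
  rewrite !E v1 w1 mulr1 => /(le_trans (ler_norm _)); apply: le_trans.
  by apply: ler_sum => i _; rewrite /z normrM.
have zs0 : 0 <= \sum_i z i by exact: sumr_ge0.
rewrite ler_wpM2l//.
apply: (@le_trans _ _ (bm ^+ 2 * (\sum_i z i) ^+ 2)); last first.
  by rewrite ler_piMr ?sqr_ge0// exprn_ile1.
rewrite [(\sum_i z i) ^+ 2]expr2 mulr_suml mulr_sumr; apply: ler_sum => i _.
rewrite !mulr_sumr; apply: ler_sum => j _.
rewrite ler_wpM2r ?mulr_ge0// lerXn2r ?nnegrE ?b_ge0//.
exact: le_trans (b_le i j).
Qed.

Lemma sum_coef_signed v w (s t : R) : enorm v = 1 -> enorm w = 1 ->
  s ^+ 2 = 1 -> t ^+ 2 = 1 ->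
  \sum_(p in D) (s * coef v p - t * coef w p) ^+ 2 <=
  2 * \sum_i \sum_j b i j ^+ 2 * (v i * v j - w i * w j) ^+ 2 +
  2 * bm ^+ 2 * (s - t) ^+ 2.
Proof.
move=> v1 w1 s1 t1.
(* As s^2 = t^2 = 1, (s - t)^2 = 2 - 2 s t; the effect of the signs is isolated in the covariance
   term. *)
have -> : \sum_(p in D) (s * coef v p - t * coef w p) ^+ 2 =
    \sum_(p in D) (coef v p - coef w p) ^+ 2 +
    (\sum_(p in D) coef v p * coef w p) * (s - t) ^+ 2.
  rewrite mulr_suml -big_split/=; apply: eq_bigr => p _.
  have -> : (s - t) ^+ 2 = s ^+ 2 + t ^+ 2 - 2 * (s * t) by ring.
  have -> : (s * coef v p - t * coef w p) ^+ 2 =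
    s ^+ 2 * coef v p ^+ 2 + t ^+ 2 * coef w p ^+ 2 - 2 * (s * t) * (coef v p * coef w p) by ring.
  by rewrite s1 t1; ring.
apply: lerD; first exact: sum_coef_sub.
by apply: ler_wpM2r; [exact: sqr_ge0|exact: sum_coef_mul].
Qed.

End MatrixIncrements.

Lemma incr_var_sum (R : realType) (I J : finType) (D : {set I}) (A : J -> I -> R) u v :
  incr_var (fun u v => \sum_(i in D) A u i * A v i) u v =
  \sum_(i in D) (A u i - A v i) ^+ 2.
Proof.
rewrite /incr_var -!sumrN -!big_split/=; apply: eq_bigr => i _ /=; ring.
Qed.

Lemma incr_var_image (R : realType) (I J : finType) (K : I -> I -> R) (A : J -> I -> R) u v :
  incr_var (fun u v => \sum_i \sum_j A u i * A v j * K i j) u v =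
  \sum_i \sum_j (A u i - A v i) * (A u j - A v j) * K i j.
Proof.
rewrite /incr_var -!sumrN -!big_split/=; apply: eq_bigr => i _.
by rewrite -!sumrN -!big_split/=; apply: eq_bigr => j _ /=; ring.
Qed.

Section StandardGaussian.
Context (R : realType).
Notation N := (normal_prob (0 : R) 1).

Lemma normal_prob_cf (J : finType) (a : J -> R) :
  gaussian_cf N (fun u x => a u * x) (fun u v => a u * a v).
Proof.
split=> [u|c th]; first by exact: measurable_funM.
have := @Rintegral_normal_cos R 0 1 (oner_neq0 _) c (\sum_u th u * a u).
rewrite expr1n mul1r.
have -> : (\sum_u th u * a u) ^+ 2 = qform (fun u v => a u * a v) th.
  rewrite expr2 mulr_suml; apply: eq_bigr => u _; rewrite mulr_sumr.
  by apply: eq_bigr => v _; ring.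
move=> <-; apply: eq_Rintegral => x _; rewrite subr0 mulr_suml.
by congr (cos (_ + _)); apply: eq_bigr => u _; rewrite mulrA.
Qed.

Lemma integrable_normal_abs : N.-integrable setT (EFin \o (fun x : R => `|x|)).
Proof.
have h : N.-integrable setT (EFin \o (fun x : R => x - 0)) :=
  integrable_normal_sub 0 (oner_neq0 R).
by have := integrable_abse h; apply: eq_integrable => // x _ /=; rewrite subr0.
Qed.

Lemma Rintegral_normal_abs_le : \int[N]_x `|x| <= 1.
Proof.
have i2 : N.-integrable setT (EFin \o (fun x : R => (x - 0) ^+ 2)).
  apply: (@integrable_poly_normal _ _ _ (oner_neq0 R) _ 1).
    by apply: measurable_funX; exact: measurable_funB.
  move=> x; rewrite mul1r subr0 ger0_norm ?sqr_ge0// (exprM _ 2 2).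
  by have := sqr_ge0 (x ^+ 2 - 1); have := sqr_ge0 x; rewrite !expr2; nra.
have i1 : N.-integrable setT (EFin \o cst (1 : R)).
  exact: (finite_measure_integrable_cst N 1 measurableT).
have V := @Rintegral_normal_variance R 0 1 (oner_neq0 _).
apply: (@le_trans _ _ (\int[N]_x (2^-1 * (cst 1 x + (x - 0) ^+ 2)))).
  apply: le_Rintegral => //.
  - exact: integrable_normal_abs.
  - by apply: integrable_scaleR; exact: integrable_addR.
  - move=> x _ /=; rewrite subr0 -(@real_normK _ x) ?num_real//.
    by have := sqr_ge0 (`|x| - 1); rewrite !expr2; nra.
rewrite RintegralZl//; last exact: integrable_addR.
rewrite RintegralD// V (Rintegral_prob_cst N 1) expr1n; lra.
Qed.

End StandardGaussian.

Section GaussianFamilies.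
Context (R : realType) (n : nat) (b : 'M[R]_n.+1).
Hypotheses (b_ge0 : forall i j, 0 <= b i j) (b_sym : forall i j, b i j = b j i).
Notation D := [set p : 'I_n.+1 * 'I_n.+1 | (p.2 <= p.1)%N]%SET.

Definition bmax : R := maxf (fun i => maxf (fun j => b i j)).

Lemma le_bmax i j : b i j <= bmax.
Proof.
apply: (@le_trans _ _ (maxf (fun j => b i j))).
  exact: (le_fmax ord0 (fun j => b i j)).
exact: (le_fmax ord0 (fun i => maxf (fun j => b i j))).
Qed.

Lemma bmax_ge0 : 0 <= bmax.
Proof. exact: le_trans (b_ge0 ord0 ord0) (le_bmax _ _). Qed.

Definition rowmax (g : 'I_n.+1 -> R) : R :=
  maxf (fun i => Num.sqrt (\sum_j b i j ^+ 2 * g j ^+ 2)).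

Lemma le_rowmax g i : Num.sqrt (\sum_j b i j ^+ 2 * g j ^+ 2) <= rowmax g.
Proof. exact: (le_fmax ord0 (fun i => Num.sqrt (\sum_j b i j ^+ 2 * g j ^+ 2))). Qed.

Lemma rowmax_ge0 g : 0 <= rowmax g.
Proof. exact: le_trans (sqrtr_ge0 _) (le_rowmax g ord0). Qed.

(** After Cauchy-Schwarz, exchanging the sums turns the squared norm of wnorm_j g_j into an average,
    with weights v_i^2, of the squared row quantities. *)
Lemma wnorm_le_rowmax (v g : 'I_n.+1 -> R) : enorm v = 1 ->
  \sum_j v j * wnorm b v j * g j <= rowmax g.
Proof.
move=> v1.
have := enorm_cs v (fun j => wnorm b v j * g j); rewrite v1 mul1r => h.
apply: le_trans (le_trans (ler_norm _) (le_trans _ h)) _.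
  by under eq_bigr do rewrite -mulrA.
rewrite -(@ger0_norm _ (rowmax g)) ?rowmax_ge0// -sqrtr_sqr; apply: ler_wsqrtr.
have -> : \sum_j (wnorm b v j * g j) ^+ 2 =
    \sum_i v i ^+ 2 * \sum_j b i j ^+ 2 * g j ^+ 2.
  under [RHS]eq_bigr do rewrite mulr_sumr.
  rewrite exchange_big/=; apply: eq_bigr => j _.
  rewrite exprMn sqr_sqrtr; last first.
    by apply: sumr_ge0 => i _; rewrite mulr_ge0// sqr_ge0.
  by rewrite mulr_suml; apply: eq_bigr => i _; ring.
rewrite -[leRHS]mul1r -[in X in _ <= X * _](expr1n _ 2) -v1 enorm_sqr mulr_suml.
apply: ler_sum => i _; rewrite ler_wpM2l ?sqr_ge0//.
have s0 : 0 <= \sum_j b i j ^+ 2 * g j ^+ 2.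
  by apply: sumr_ge0 => j _; rewrite mulr_ge0// sqr_ge0.
rewrite -[leLHS](sqr_sqrtr s0) lerXn2r ?nnegrE ?sqrtr_ge0 ?rowmax_ge0//.
exact: le_rowmax.
Qed.

Lemma sum_sqr_le_max (v y : 'I_n.+1 -> R) : enorm v = 1 ->
  \sum_i v i ^+ 2 * y i <= maxf y.
Proof.
move=> v1; rewrite -[leRHS]mul1r -[in X in _ <= X * _](expr1n _ 2) -v1 enorm_sqr mulr_suml.
apply: ler_sum => i _; rewrite ler_wpM2l ?sqr_ge0//.
exact: (le_fmax ord0 y).
Qed.

Context (dX : measure_display) (TX : measurableType dX) (PX : probability TX R)
  (gX : 'I_n.+1 -> 'I_n.+1 -> {RV PX >-> R}) (gXP : symmetric_gaussian_array gX).
Context (Bneg : 'M[R]_n.+1)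
  (BnegP : is_negative_part (\matrix_(i, j) (b i j ^+ 2)) Bneg).
Context (dY : measure_display) (TY : measurableType dY) (PY : probability TY R)
  (Y : 'I_n.+1 -> {RV PY >-> R}) (YP : centered_gaussian_vector Bneg Y).
Context (dg : measure_display) (Tg : measurableType dg) (Pg : probability Tg R)
  (g : 'I_n.+1 -> {RV Pg >-> R}) (gP : iid_standard_gaussian g).
Context (gamma : R) (gamma_gt0 : 0 < gamma).

Let c := Num.sqrt (2 + gamma + gamma^-1).
Notation N := (normal_prob (0 : R) 1).

Let c_sqr : c ^+ 2 = 2 + gamma + gamma^-1.
Proof. by rewrite sqr_sqrtr// !addr_ge0 ?invr_ge0// ltW. Qed.

Lemma integrable_standard_gaussian_sqr j :
  Pg.-integrable setT (EFin \o (fun w => g j w ^+ 2)).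
Proof.
have mg : measurable_fun setT (g j) by exact: measurable_funPT.
have gg : gaussian Pg (g j).
  exists 0, 1; split; first by [].
  by move=> A mA; rewrite oner_eq0; exact: (gP.1 j A mA).
by have [m [s []]] := gaussian_moments mg gg.
Qed.

Lemma integrable_rowmax :
  Pg.-integrable setT (EFin \o (fun w => rowmax (g ^~ w))).
Proof.
have mg j : measurable_fun setT (g j) by exact: measurable_funPT.
have mq i : measurable_fun setT (fun w => \sum_j b i j ^+ 2 * g j w ^+ 2).
  apply: measurable_sum => j; apply: measurable_funM => //.
  exact: measurable_funX.
apply: (@integrable_fmax R _ ord0 _ _ Pg (fun i w => Num.sqrt (\sum_j b i j ^+ 2 * g j w ^+ 2))).
  by move=> i; apply: measurableT_comp (mq i); exact: continuous_measurable_fun (@sqrt_continuous R).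
move=> i; apply: (@integrable_le _ _ _ Pg _
    (fun w => cst 1 w + \sum_j b i j ^+ 2 * g j w ^+ 2)).
- by apply: measurableT_comp (mq i); exact: continuous_measurable_fun (@sqrt_continuous R).
- move=> w; set q := \sum_j _.
  have q0 : 0 <= q by apply: sumr_ge0 => j _; rewrite mulr_ge0// sqr_ge0.
  rewrite ger0_norm ?sqrtr_ge0// -[X in _ <= _ + X](sqr_sqrtr q0) /=.
  by have := sqr_ge0 (Num.sqrt q - 1); have := sqrtr_ge0 q; rewrite !expr2; nra.
- apply: integrable_addR; first exact: (finite_measure_integrable_cst Pg 1 measurableT).
  by apply: integrable_sumR => j; apply: integrable_scaleR; exact: integrable_standard_gaussian_sqr.
Qed.

Lemma integrable_maxY : PY.-integrable setT (EFin \o (fun w => maxf (fun i => Y i w))).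
Proof.
apply: (@integrable_fmax R _ ord0 _ _ PY (fun i w => Y i w)).
  by move=> i; exact: measurable_funPT.
by move=> i; exact: (gaussian_cf_integrable (centered_gaussian_vector_cf YP) i).
Qed.

Context (I : finType) (V : I -> 'I_n.+1 -> R) (V1 : forall k, enorm (V k) = 1).
Notation J := (I * bool)%type.
Let sg (u : J) : R := (-1) ^+ u.2.

Let sg_sqr u : sg u ^+ 2 = 1.
Proof. by rewrite /sg sqrr_sign. Qed.

Definition form_process (u : J) (w : TX) : R :=
  \sum_(p in D) ((-1) ^+ u.2 * coef b (V u.1) p) * gX p.1 p.2 w.

Lemma form_process_cf : gaussian_cf PX form_process
  (fun u v => \sum_(p in D) (sg u * coef b (V u.1) p) * (sg v * coef b (V v.1) p)).
Proof.
case: gXP => _ sgX indX.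
exact: (gaussian_cf_independent indX (fun p => sgX p.1 p.2)
  (fun (u : J) p => sg u * coef b (V u.1) p)).
Qed.

Lemma form_processE u w :
  form_process u w = (-1) ^+ u.2 * bilin (random_matrix b gX w) (V u.1) (V u.1).
Proof.
case: gXP => gXsym _ _.
rewrite /random_matrix (bilin_coef b_sym (V u.1) (G := fun i j => gX i j w))//.
by rewrite mulr_sumr /form_process; apply: eq_bigr => p _; rewrite -mulrA.
Qed.

(** Written as two nested instances of [gaussian_cf_prod], whence the outer [1 *]. The third factor
    of the product space carries the auxiliary xi. *)
Definition comparison_process (u : J) (w : Tg * TY * R) : R :=
  1 * (c * (\sum_(j in [set: 'I_n.+1]%SET) (V u.1 j * wnorm b (V u.1) j) * g j w.1.1) +
       Num.sqrt gamma * (\sum_i V u.1 i ^+ 2 * Y i w.1.2)) +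
  (Num.sqrt 2 * bmax) * (sg u * w.2).

Let L1 (u v : J) := \sum_(j in [set: 'I_n.+1]%SET)
  (V u.1 j * wnorm b (V u.1) j) * (V v.1 j * wnorm b (V v.1) j).
Let L2 (u v : J) := \sum_i \sum_j V u.1 i ^+ 2 * V v.1 j ^+ 2 * Bneg i j.

Lemma comparison_process_cf : gaussian_cf ((Pg \x PY) \x N)%E comparison_process
  (fun u v => 1 ^+ 2 * (c ^+ 2 * L1 u v + Num.sqrt gamma ^+ 2 * L2 u v) +
     (Num.sqrt 2 * bmax) ^+ 2 * (sg u * sg v)).
Proof.
have h1 := gaussian_cf_independent gP.2 gP.1 (fun (u : J) j => V u.1 j * wnorm b (V u.1) j).
have h2 := gaussian_cf_image (fun (u : J) i => V u.1 i ^+ 2) (centered_gaussian_vector_cf YP).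
have h3 := normal_prob_cf sg.
exact: (gaussian_cf_prod (gaussian_cf_prod h1 h2 c (Num.sqrt gamma)) h3 1 (Num.sqrt 2 * bmax)).
Qed.

Lemma process_incr_le u v :
  incr_var (fun u v => \sum_(p in D) (sg u * coef b (V u.1) p) * (sg v * coef b (V v.1) p)) u v <=
  incr_var (fun u v => 1 ^+ 2 * (c ^+ 2 * L1 u v + Num.sqrt gamma ^+ 2 * L2 u v) +
     (Num.sqrt 2 * bmax) ^+ 2 * (sg u * sg v)) u v.
Proof.
rewrite incr_var_sum.
apply: (le_trans (sum_coef_signed b_ge0 b_sym le_bmax (V1 u.1) (V1 v.1) (sg_sqr u) (sg_sqr v))).
have -> : incr_var (fun u v => 1 ^+ 2 * (c ^+ 2 * L1 u v + Num.sqrt gamma ^+ 2 * L2 u v) +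
     (Num.sqrt 2 * bmax) ^+ 2 * (sg u * sg v)) u v =
   c ^+ 2 * incr_var L1 u v + Num.sqrt gamma ^+ 2 * incr_var L2 u v +
   Num.sqrt 2 ^+ 2 * bmax ^+ 2 * (sg u - sg v) ^+ 2.
  by rewrite /incr_var; ring.
rewrite c_sqr !sqr_sqrtr ?(ltW gamma_gt0)// lerD2r.
rewrite incr_var_sum (incr_var_image _ (fun (u : J) i => V u.1 i ^+ 2)).
apply: (le_trans (matrix_incr_le b_sym (V u.1) (V v.1) gamma_gt0)).
have -> : \sum_(j in [set: 'I_n.+1]%SET) (V u.1 j * wnorm b (V u.1) j -
    V v.1 j * wnorm b (V v.1) j) ^+ 2 = incr_proj b (V u.1) (V v.1).
  by apply: eq_bigl => j; rewrite inE.
(* After the common projection term cancels, what remains is the comparison of - B with B^- at the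
   vector v^2 - w^2. *)
rewrite lerD2l -mulrN ler_wpM2l ?(ltW gamma_gt0)//.
exact: negative_part_dominates BnegP.
Qed.

Lemma expected_max_form_le (u0 : J) :
  \int[PX]_w fmax u0 (form_process ^~ w) <=
  c * \int[Pg]_w rowmax (g ^~ w) +
  Num.sqrt gamma * \int[PY]_w maxf (fun i => Y i w) + 2 * bmax.
Proof.
pose G (w : Tg * TY * R) : R := c * rowmax (g ^~ w.1.1) +
  Num.sqrt gamma * maxf (fun i => Y i w.1.2) + Num.sqrt 2 * bmax * `|w.2|.
have i1 := integrable_fst N (integrable_fst PY integrable_rowmax).
have i2 := integrable_fst N (integrable_snd Pg integrable_maxY).
have i3 := integrable_snd (Pg \x PY)%E (integrable_normal_abs R).
have i12 := integrable_addR (integrable_scaleR c i1) (integrable_scaleR (Num.sqrt gamma) i2).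
have iG := integrable_addR i12 (integrable_scaleR (Num.sqrt 2 * bmax) i3).
have intX : PX.-integrable setT (EFin \o (fun w => fmax u0 (form_process ^~ w))).
  by apply: integrable_fmax => u; [exact: form_process_cf.1|exact: gaussian_cf_integrable form_process_cf u].
have sq0 := sqrtr_ge0 (2 : R); have bm0 := bmax_ge0.
apply: (@le_trans _ _ (\int[((Pg \x PY) \x N)%E]_w G w)).
  apply: (sudakov_fernique form_process_cf comparison_process_cf process_incr_le intX iG).
  - by move=> w; have [u ->] := fmax_attained u0 (form_process ^~ w); exists u.
  - move=> w u; rewrite /G /comparison_process mul1r; apply: lerD; first apply: lerD.
    + rewrite ler_wpM2l ?sqrtr_ge0//.
      have := wnorm_le_rowmax (g ^~ w.1.1) (V1 u.1); apply: le_trans.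
      by rewrite le_eqVlt; apply/orP; left; apply/eqP; apply: eq_bigl => j; rewrite inE.
    + by rewrite ler_wpM2l ?sqrtr_ge0//; exact: sum_sqr_le_max.
    + rewrite ler_wpM2l ?mulr_ge0//; apply: (le_trans (ler_norm _)).
      by rewrite normrM /sg normr_sign mul1r.
rewrite /G RintegralD//; last by apply: integrable_scaleR.
rewrite RintegralD//; [|exact: integrable_scaleR|exact: integrable_scaleR].
rewrite !RintegralZl//.
rewrite (Rintegral_fst N (integrable_fst PY integrable_rowmax)).
rewrite (Rintegral_fst PY integrable_rowmax).
rewrite (Rintegral_fst N (integrable_snd Pg integrable_maxY)).
rewrite (Rintegral_snd Pg integrable_maxY).
rewrite (Rintegral_snd (Pg \x PY)%E (integrable_normal_abs R)).
rewrite lerD2l mulrAC ler_wpM2r//.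
have s2 : Num.sqrt (2 : R) <= 2.
  by rewrite -[leRHS]ger0_norm// -sqrtr_sqr; apply: ler_wsqrtr; rewrite expr2; lra.
apply: (@le_trans _ _ (Num.sqrt 2 * 1)); last by rewrite mulr1.
by rewrite ler_wpM2l// Rintegral_normal_abs_le.
Qed.

End GaussianFamilies.

Lemma expectationE d (T : measurableType d) (R : realType) (P : probability T R)
    (f : T -> R) : P.-integrable setT (EFin \o f) -> ('E_P[f] = (\int[P]_w f w)%:E)%E.
Proof.
by move=> intf; rewrite unlock /Rintegral fineK//; exact: integrable_fin_num.
Qed.

Theorem theorem4p1 (R : realType) (n : nat)
  (b : 'M[R]_n.+1)
  (b_ge0 : forall i j, 0 <= b i j)
  (b_sym : forall i j, b i j = b j i)
  (dX : measure_display) (TX : measurableType dX) (PX : probability TX R)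
  (gX : 'I_n.+1 -> 'I_n.+1 -> {RV PX >-> R})
  (gXP : symmetric_gaussian_array gX)
  (Bneg : 'M[R]_n.+1)
  (BnegP : is_negative_part (\matrix_(i, j) (b i j ^+ 2)) Bneg)
  (dY : measure_display) (TY : measurableType dY) (PY : probability TY R)
  (Y : 'I_n.+1 -> {RV PY >-> R})
  (YP : centered_gaussian_vector Bneg Y)
  (dg : measure_display) (Tg : measurableType dg) (Pg : probability Tg R)
  (g : 'I_n.+1 -> {RV Pg >-> R})
  (gP : iid_standard_gaussian g)
  (gamma : R) (gamma_gt0 : 0 < gamma) :
  ('E_PX[fun w => spectral_norm (random_matrix b gX w)] <=
   (Num.sqrt (2 + gamma + gamma^-1))%:E *
     'E_Pg[fun w => maxf (fun i => Num.sqrt (\sum_j b i j ^+ 2 * g j w ^+ 2))] +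
   (Num.sqrt gamma)%:E * 'E_PY[fun w => maxf (fun i => Y i w)] +
   (2 * maxf (fun i => maxf (fun j => b i j)))%:E)%E.
Proof.
rewrite (expectationE (integrable_rowmax b gP)) (expectationE (integrable_maxY YP)).
rewrite -!EFinM -!EFinD -/(bmax b) unlock.
set r := (X in (_ <= X%:E)%E).
set S := (\int[PX]_w _)%E.
have sn0 w : 0 <= spectral_norm (random_matrix b gX w) by exact: spectral_norm_ge0.
have S0 : (0 <= S)%E by apply: integral_ge0 => w _; rewrite lee_fin.
(* The net depends on k, so each bound uses its own finite family; [r] does not depend on it, which
   allows the limit. *)
have S_le (k : nat) : (S <= (r + r * k.+1%:R^-1)%:E)%E.
  have k0 : 0 < k.+1%:R :> R by rewrite ltr0n.
  have k1 : 0 < k.+1%:R + 1 :> R by rewrite addr_gt0.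
  (* Chosen so that 1 / (1 - eps) = 1 + 1/(k+1). *)
  pose eps : R := (k.+1%:R + 1)^-1.
  have eps0 : 0 < eps by rewrite invr_gt0.
  have [m net] := spectral_norm_net n eps0.
  pose V := @net_point R n m.
  have V1 j : enorm (V j) = 1 by exact: enorm_net_point.
  pose u0 : {ffun 'I_n.+1 -> 'I_(m.*2).+1} * bool := ([ffun=> ord0], true).
  pose f w := fmax u0 ((form_process b gX V) ^~ w).
  have fle : \int[PX]_w f w <= r.
    exact: (expected_max_form_le b_ge0 b_sym gXP BnegP YP gP gamma_gt0 V1 u0).
  have cf := form_process_cf b gXP V.
  have intf : PX.-integrable setT (EFin \o f).
    by apply: integrable_fmax => u; [exact: cf.1|exact: gaussian_cf_integrable cf u].
  have sn_le w : spectral_norm (random_matrix b gX w) <= (1 + k.+1%:R^-1) * f w.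
    have [|j hj] := net (random_matrix b gX w).
      by move=> i j; rewrite !mxE b_sym; case: gXP => ->.
    (* The index [true] carries the sign -1 and [false] the sign +1, so the maximum over both
       dominates the absolute value. *)
    have hf : `|bilin (random_matrix b gX w) (V j) (V j)| <= f w.
      rewrite ler_norml; apply/andP; split.
        have := le_fmax u0 ((form_process b gX V) ^~ w) (j, true).
        by rewrite form_processE//= expr1 mulN1r lerNl.
      have := le_fmax u0 ((form_process b gX V) ^~ w) (j, false).
      by rewrite form_processE//= expr0 mul1r.
    have -> : spectral_norm (random_matrix b gX w) = (1 + k.+1%:R^-1) *
        ((1 - eps) * spectral_norm (random_matrix b gX w)).
      by rewrite /eps; field; rewrite !gt_eqF.
    rewrite ler_wpM2l ?addr_ge0 ?invr_ge0 ?(ltW k0)//.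
    exact: le_trans hj hf.
  apply: (@le_trans _ _ (\int[PX]_w ((1 + k.+1%:R^-1) * f w)%:E)%E).
    by apply: ge0_integral_mono => w; rewrite lee_fin.
  rewrite -(fineK (integrable_fin_num measurableT (integrable_scaleR (1 + k.+1%:R^-1) intf))) lee_fin.
  rewrite -/(Rintegral _ _ _) RintegralZl//.
  have -> : r + r * k.+1%:R^-1 = (1 + k.+1%:R^-1) * r by ring.
  by rewrite ler_wpM2l ?addr_ge0 ?invr_ge0 ?(ltW k0).
(* Finiteness of the expected norm comes out of the bound at k = 0 and permits passing to the limit
   in the reals. *)
have Sfin : S \is a fin_num by rewrite ge0_fin_numE// (le_lt_trans (S_le 0))// ltry.
rewrite -(fineK Sfin) lee_fin; apply: (@ler_harmonic _ _ _ r) => k.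
by rewrite -lee_fin fineK.
Qed.
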